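(* Let $\mathbb{H}$ be a real separable Hilbert space with norm $|\cdot|$, let $A:\mathbb{H}\to\mathbb{H}$ be a bounded self-adjoint linear operator (independent of $t$), and let $\mathcal{G}:\mathbb{H}\to\mathbb{H}$ be an infinitely (Fréchet) differentiable map with $\mathcal{G}(0)=0$, $\sup_{x\in\mathbb{H}}\|D_x\mathcal{G}\|\le 1/4$, and $\sup_{x\in\mathbb{H}}\|D_x^k\mathcal{G}\|<+\infty$ for all $k\ge 1$. Let $x:(0,+\infty)\to\mathbb{H}$ be a weak $L^2_{loc}$ solution of $$\frac{d}{dt}(Ax)=-x+\mathcal{G}(x)$$ that belongs to $L^\infty(0,+\infty)$. Then $x$ is (after modification on a null set) $C^\infty$ on $(0,+\infty)$, and $x$ and all its derivatives decay exponentially as $t\to\infty$. Moreover, for all $t>0$ and all integers $k\ge 0$, $$\left|\left(\tfrac{d}{dt}\right)^k x(t)\right|\le\begin{cases}C\,t^{-k}, & 0<t<1,\\ C\,e^{-ct}, & t\ge 1,\end{cases}$$ where $c>0$ depends only on $\|A\|$, and $C$ depends only on $\|x\|_{L^\infty(0,+\infty)}$, $\|A\|$, $k$, and $\sup_{x\in\mathbb{H}}\|D_x^j\mathcal{G}\|$ for $j=1,2,\dots,k+1$.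
   Context: $D_x^k\mathcal{G}$ denotes the $k$-th Fréchet derivative of $\mathcal{G}$ at the point $x$, a bounded $k$-linear map, with its usual norm. Spaces $L^2_{loc}$, $H^1_{loc}$, $L^\infty$ are spaces of $\mathbb{H}$-valued functions. A weak $L^2_{loc}$ solution of $(d/dt)(Ax)=-x+\mathcal{G}(x)$ on $(0,+\infty)$ is a function $x\in L^2_{loc}(0,+\infty)$ such that $Ax\in H^1_{loc}(0,+\infty)$ and the equation holds as an equality in $L^2_{loc}(0,+\infty)$, with $(d/dt)(Ax)$ the weak derivative. $A$ is not assumed to be invertible or injective. *)

(* Defs.v *)
From HB Require Import structures.
From mathcomp Require Import all_boot all_order all_algebra.
From mathcomp Require Import all_classical all_reals all_analysis.
From mathcomp Require Import ess_sup_inf.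

Set Implicit Arguments.
Unset Strict Implicit.
Unset Printing Implicit Defensive.

Import Order.TTheory GRing.Theory Num.Theory.
Import numFieldNormedType.Exports.

Local Open Scope classical_set_scope.
Local Open Scope ring_scope.

Definition separable_space (T : topologicalType) : Prop :=
  exists2 D : set T, countable D & dense D.

(* A real Hilbert space is a complete normed module whose norm comes from a
   positive definite symmetric bilinear form. *)
Definition hilbert_inner (R : realType) (H : completeNormedModType R)
    (ip : {dot H for (idfun : R -> R)}) : Prop :=
  forall u : H, ip u u = `|u| ^+ 2.

Definition self_adjoint (R : realType) (H : completeNormedModType R)
    (ip : {dot H for (idfun : R -> R)}) (A : H -> H) : Prop :=
  forall u v : H, ip (A u) v = ip u (A v).

Definition opnorm (R : realType) (H : completeNormedModType R)
    (A : H -> H) : \bar R :=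
  ereal_sup [set (`|A h|)%:E | h in [set h : H | `|h| <= 1]].

(* k-linear maps are functions on k.-tuple H; for k = 0 they are the elements
   of H. *)
Definition multilinear (R : realType) (H : completeNormedModType R) (k : nat)
    (L : k.-tuple H -> H) : Prop :=
  forall (i : 'I_k) (v : k.-tuple H) (a : R) (g h : H),
    let subst w := [tuple if j == i then w else tnth v j | j < k] in
    L (subst (a *: g + h)) = a *: L (subst g) + L (subst h).

Definition mlnorm (R : realType) (H : completeNormedModType R) (k : nat)
    (L : k.-tuple H -> H) : \bar R :=
  ereal_sup [set (`|L v|)%:E |
    v in [set v : k.-tuple H | forall i, `|tnth v i| <= 1]].

Definition bounded_multilinear (R : realType) (H : completeNormedModType R)
    (k : nat) (L : k.-tuple H -> H) : Prop :=
  multilinear L /\ (mlnorm L < +oo)%E.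

(* F takes values in the normed space of bounded k-linear maps; its derivative
   at x, a bounded linear map from H to k-linear maps, is identified with the
   (k+1)-linear map L whose first argument is the direction of
   differentiation. *)
Definition has_frechet_derivative (R : realType) (H : completeNormedModType R)
    (k : nat) (F : H -> k.-tuple H -> H) (x : H) (L : k.+1.-tuple H -> H)
    : Prop :=
  bounded_multilinear L /\
  forall e : R, 0 < e -> \forall h \near nbhs (0 : H),
    (mlnorm (fun v : k.-tuple H =>
       (F (x + h) v - F x v - L [tuple of h :: v])%R) <= (e * `|h|)%:E)%E.

(* [frechet k G x] is $D_x^k G$. A Fréchet derivative is unique, so [xget]
   returns it whenever it exists; [frechet_smooth] says that it always does. *)
Fixpoint frechet (R : realType) (H : completeNormedModType R) (k : nat)
    (G : H -> H) : H -> k.-tuple H -> H :=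
  match k with
  | 0 => fun x _ => G x
  | k'.+1 => fun x => xget (fun _ => 0)
      [set L : k'.+1.-tuple H -> H |
        has_frechet_derivative (@frechet R H k' G) x L]
  end.
Arguments frechet {R H} k G x v.

Definition frechet_smooth (R : realType) (H : completeNormedModType R)
    (G : H -> H) : Prop :=
  forall (k : nat) (x : H),
    exists L, has_frechet_derivative (frechet k G) x L.

Definition sup_frechet (R : realType) (H : completeNormedModType R)
    (G : H -> H) (k : nat) : \bar R :=
  ereal_sup (range (fun x : H => mlnorm (frechet k G x))).

(* Only the values of x : R -> H on `]0, +oo[ matter. Measurability is with
   respect to the Borel sets of H; as H is separable this is strong
   measurability. *)
Definition hmeasurable (R : realType) (H : completeNormedModType R)
    (x : R -> H) : Prop :=
  measurable_fun (`]0, +oo[ : set (measurableTypeR R))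
    (x : R -> g_sigma_algebraType (@open H)).

Definition L2loc (R : realType) (H : completeNormedModType R) (x : R -> H)
    : Prop :=
  hmeasurable x /\ locally_integrable `]0, +oo[ (fun t => `|x t| ^+ 2).

Definition Linf_norm (R : realType) (H : completeNormedModType R)
    (x : R -> H) : \bar R :=
  ess_sup (mrestr lebesgue_measure (measurable_itv `]0%R, +oo[))
    (fun t : R => (`|x t|)%:E).

Definition Linf (R : realType) (H : completeNormedModType R) (x : R -> H)
    : Prop :=
  hmeasurable x /\ (Linf_norm x < +oo)%E.

Definition smooth_on (R : realType) (H : completeNormedModType R)
    (D : set R) (y : R -> H) : Prop :=
  forall (k : nat) (t : R), D t -> derivable (y^`(k)%classic) t 1.

Definition test_function (R : realType) (H : completeNormedModType R)
    (phi : R -> H) : Prop :=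
  smooth_on setT phi /\
  exists K : set R, [/\ compact K, K `<=` `]0, +oo[ &
    forall t, ~ K t -> phi t = 0].

Definition weak_derivative (R : realType) (H : completeNormedModType R)
    (ip : {dot H for (idfun : R -> R)}) (u v : R -> H) : Prop :=
  forall phi : R -> H, test_function phi ->
    \int[lebesgue_measure]_(t in `]0, +oo[) ip (u t) (phi^`()%classic t) =
    - \int[lebesgue_measure]_(t in `]0, +oo[) ip (v t) (phi t).

Definition H1loc (R : realType) (H : completeNormedModType R)
    (ip : {dot H for (idfun : R -> R)}) (u : R -> H) : Prop :=
  L2loc u /\ exists2 v, L2loc v & weak_derivative ip u v.

Definition weak_L2loc_solution (R : realType) (H : completeNormedModType R)
    (ip : {dot H for (idfun : R -> R)}) (A G : H -> H) (x : R -> H) : Prop :=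
  [/\ L2loc x, H1loc ip (A \o x) &
    exists v : R -> H, [/\ L2loc v, weak_derivative ip (A \o x) v &
      {ae lebesgue_measure, forall t : R, 0 < t -> v t = - x t + G (x t)}]].

Definition exp_decay (R : realType) (H : completeNormedModType R)
    (y : R -> H) : Prop :=
  exists c K : R, 0 < c /\
    \forall t \near +oo, `|y t| <= K * expR (- c * t).

(* Main.v *)
(* Pairing the equation with a cut-off multiple of x gives
   int w' <Ax, x> = 2 int w <x - G(x), x>. As |G(x)| <= |x|/4, this bounds the
   tail of |x|^2 after time t + 1 by a multiple, depending only on |A|, of its
   integral over [t, t + 1], so the tails decay exponentially. The difference
   x(. + h) - x solves an equation of the same kind, and although A need not be
   invertible, Ax is Lipschitz; the energy estimate therefore bounds the
   L^2 tails of the difference by a multiple of h. A one-dimensional Agmon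
   inequality turns L^2 bounds on a function and on its differences into
   pointwise bounds. By induction on n the iterated differences of order n
   satisfy the equation with a source bounded by a quarter of themselves plus
   differences of lower order, which yields
   |difs [h_1; ..; h_n] x (t)| <= C prod_i (h_i / min(t,1)) e^{-ct}.
   For all n at once, these bounds imply that x is smooth, and dividing by the
   steps gives the bounds on the derivatives. *)
From HB Require Import structures.
Require Import Defs.
From mathcomp Require Import all_boot all_order all_algebra.
From mathcomp Require Import all_classical all_reals all_analysis.
From mathcomp Require Import measurable_realfun ess_sup_inf ring lra ssrAC.

Set Implicit Arguments.
Unset Strict Implicit.
Unset Printing Implicit Defensive.

Import Order.TTheory GRing.Theory Num.Theory.
Import numFieldNormedType.Exports.

Local Open Scope classical_set_scope.
Local Open Scope ring_scope.

(** The obstacle is a circle. Agmon at order n needs the L^2 size of the differences of order n + 1;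
    the energy estimate for these needs pointwise control at order n, which enters through the
    increment of [A] over one step. The circle closes because the dependence is mild. Let [sig] be
    the best pointwise constant at order n. The L^2 size at order n is already known and the one at
    order n + 1 grows at most linearly in [sig], so Agmon yields sig^2 <= M (sig + 1). For this, the
    differences of G(x) must not bring in higher powers of [sig]: their factors of order n are
    measured in L^2, all of them for n >= 2 and one out of two for n = 1. The factor 1/4 on the top
    difference has to survive at every order, so it always comes from the Lipschitz bound of [G] and
    never from an expansion in derivatives. Constants may not depend on the steps nor on the space,
    the operator and the map. Hence steps are measured against min(t, 1), and constants are produced
    before these data are introduced. The decay rate is a quarter of the rate of the tails of |x|^2:
    one factor 2 is lost from squares to norms, another in the square root of Agmon. *)

Lemma eq_imp_le (R : numDomainType) (x y : R) : x = y -> x <= y.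
Proof. by move->. Qed.

(** * Iterated differences *)

Section Differences.
Variables V W : zmodType.
Implicit Types (h : V) (hs : seq V) (f g : V -> W) (t : V).

Definition dif h f t := f (t + h) - f t.

Definition difs hs f := foldl (fun f h => dif h f) f hs.

Lemma difs_dif hs h f : difs hs (dif h f) = dif h (difs hs f).
Proof.
elim: hs f => [//|l hs IH] f /=; rewrite -IH; congr difs.
apply/funext => t; rewrite /dif (addrAC t) !opprB.
by rewrite (AC (2*2) ((1*4)*(3*2))).
Qed.

Lemma difs_consE h hs f t :
  difs (h :: hs) f t = difs hs f (t + h) - difs hs f t.
Proof. by rewrite /= difs_dif. Qed.

Lemma difs_cat hs1 hs2 f : difs (hs1 ++ hs2) f = difs hs2 (difs hs1 f).
Proof. exact: foldl_cat. Qed.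

Lemma difs_insert hs1 h hs2 f t : difs (hs1 ++ h :: hs2) f t =
  difs (hs1 ++ hs2) f (t + h) - difs (hs1 ++ hs2) f t.
Proof. by rewrite !difs_cat difs_consE. Qed.

Lemma difsD hs f g t : difs hs (f \+ g) t = difs hs f t + difs hs g t.
Proof.
elim: hs f g t => [//|h hs IH] f g t; rewrite !difs_consE !IH.
by rewrite opprD addrACA.
Qed.

Lemma difsN hs f t : difs hs (fun s => - f s) t = - difs hs f t.
Proof.
elim: hs f t => [//|h hs IH] f t; rewrite !difs_consE !IH.
by rewrite opprB opprK addrC.
Qed.

Lemma difs_shift hs h f t :
  difs hs (fun s => f (s + h)) t = difs hs f (t + h).
Proof.
elim: hs f t => [//|l hs IH] f t; rewrite !difs_consE !IH.
by rewrite addrAC.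
Qed.

End Differences.

Lemma difs_comp_additive (V W W' : zmodType) (L : {additive W -> W'})
  (hs : seq V) (f : V -> W) t : difs hs (L \o f) t = L (difs hs f t).
Proof.
elim: hs f t => [//|h hs IH] f t; rewrite !difs_consE !IH.
by rewrite raddfB.
Qed.

Fixpoint all_prop (T : Type) (P : T -> Prop) (s : seq T) : Prop :=
  if s is x :: s' then P x /\ all_prop P s' else True.

Lemma all_prop_cat (T : Type) (P : T -> Prop) (s1 s2 : seq T) :
  all_prop P (s1 ++ s2) <-> all_prop P s1 /\ all_prop P s2.
Proof. by elim: s1 => [|x s IH] /=; tauto. Qed.

Lemma all_prop_impl (T : Type) (P Q : T -> Prop) (s : seq T) :
  (forall x, P x -> Q x) -> all_prop P s -> all_prop Q s.
Proof. by move=> PQ; elim: s => [//|x s IH] /= [/PQ ? /IH]. Qed.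

Lemma all_prop_map (T U : Type) (f : T -> U) (P : U -> Prop) (s : seq T) :
  all_prop P [seq f x | x <- s] <-> all_prop (fun x => P (f x)) s.
Proof. by elim: s => [//|x s IH] /=; tauto. Qed.

(** * Iterated differences of a composition with [G] *)

Section Composition.
Variables (R : realType) (H : normedModType R) (G : H -> H) (K : R) (n : nat).
Hypothesis K0 : 0 <= K.
Hypothesis GK : forall bs z, (0 < size bs <= n)%N ->
  `|difs bs G z| <= K * \prod_(b <- bs) `|b|.
Variable e : R -> R.
Hypothesis e0 : forall h, 0 <= e h.
Implicit Types (f g : R -> H) (hs T S : seq R) (t : R).

Let E hs : R := \prod_(h <- hs) e h.

Let E0 hs : 0 <= E hs.
Proof. by rewrite /E; elim/big_ind : _ => // *; exact: mulr_ge0. Qed.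

(** Base points are the vertices t + sum S of the cube spanned by the steps. The family is stable
    under a shift by one step and under taking one difference, each time consuming that step, which
    is what an induction on [hs] needs. The threshold [k] is 1 for a base point of [G], since [G] is
    controlled uniformly in the base point, and 0 for an increment. *)
Definition cube_bound (k : nat) (B : R) hs f t := forall T S,
  (k <= size T)%N -> subseq T hs -> subseq S hs ->
  `|difs T f (t + \sum_(h <- S) h)| <= B * \prod_(h <- T) e h.

Lemma cube_bound_shift k B h hs f t : cube_bound k B (h :: hs) f t ->
  cube_bound k B hs (fun s => f (s + h)) t.
Proof.
move=> bf T S kT Th Sh; rewrite difs_shift.
have := bf T (h :: S) kT (subseq_trans Th (subseq_cons _ _)).
by rewrite big_cons -addrA (addrC h) /= eqxx; exact.
Qed.

Lemma cube_bound_behead k B h hs f t : cube_bound k B (h :: hs) f t ->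
  cube_bound k B hs f t.
Proof.
move=> bf T S kT Th Sh; apply: bf => //.
  exact: subseq_trans Th (subseq_cons _ _).
exact: subseq_trans Sh (subseq_cons _ _).
Qed.

Lemma cube_bound_dif B h hs f t : cube_bound 1 B (h :: hs) f t ->
  cube_bound 0 (B * e h) hs (dif h f) t.
Proof.
move=> bf T S _ Th Sh; have := bf (h :: T) S erefl.
rewrite /= eqxx big_cons mulrA; apply => //.
exact: subseq_trans Sh (subseq_cons _ _).
Qed.

Lemma cube_boundD k B C hs f g t : cube_bound k B hs f t ->
  cube_bound k C hs g t -> cube_bound k (B + C) hs (f \+ g) t.
Proof.
move=> bf bg T S kT Th Sh; rewrite difsD (le_trans (ler_normD _ _))// mulrDl.
by rewrite lerD// ?bf ?bg.
Qed.

Lemma cube_boundN k B hs f t : cube_bound k B hs f t ->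
  cube_bound k B hs (fun s => - f s) t.
Proof. by move=> bf T S kT Th Sh; rewrite difsN normrN; exact: bf. Qed.

Lemma cube_bound_dif2 k B h hs f t : cube_bound k B (h :: hs) f t ->
  cube_bound k (2 * B) hs (dif h f) t.
Proof.
move=> bf; have -> : 2 * B = B + B by ring.
apply: cube_boundD; first exact: cube_bound_shift.
by apply: cube_boundN; exact: cube_bound_behead bf.
Qed.

Lemma cube_bound_le k l B C hs f t : (k <= l)%N -> B <= C ->
  cube_bound k B hs f t -> cube_bound l C hs f t.
Proof.
move=> kl BC bf T S kT Th Sh; apply: le_trans (bf T S _ Th Sh) _.
  exact: leq_trans kT.
by apply: ler_wpM2r => //; exact: E0.
Qed.

Implicit Type gs : seq ((R -> H) * R).

Let term gs f s := difs [seq p.1 s | p <- gs] G (f s).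

(** Two bounds per increment: [p.2] controls it together with its differences and becomes a factor
    of the final estimate, whereas [B] controls only its differences of positive order and serves
    when the increment is added to the base point. *)
Let slots B hs gs t := all_prop (fun p => [/\ 0 <= p.2, cube_bound 1 B hs p.1 t &
  cube_bound 0 p.2 hs p.1 t]) gs.

(** Of the [j] steps, removing one creates a term with m + 1 slots (the base point moved) and m
    terms with m slots (one increment moved). Each of them has [B] doubled, hence the power of 2. *)
Fixpoint comp_const (j m : nat) : R :=
  if j is j'.+1 then
    2 ^+ j' * (comp_const j' m.+1 + m%:R * comp_const j' m)
  else 1.

Lemma comp_const_ge0 j m : 0 <= comp_const j m.
Proof.
elim: j m => [|j IH] m /=; first exact: ler01.
by rewrite mulr_ge0 ?exprn_ge0 ?addr_ge0// mulr_ge0.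
Qed.

Let bnd j m B gs hs : R := comp_const j m * K * (\prod_(p <- gs) p.2) *
  (1 + B) ^+ j * E hs.

Let slots_ge0 B hs gs t : slots B hs gs t -> 0 <= \prod_(p <- gs) p.2.
Proof.
elim: gs => [|p gs IH] /=; first by rewrite big_nil.
by rewrite big_cons => -[[? _ _] /IH ?]; exact: mulr_ge0.
Qed.

Let shift_slots h gs := [seq ((fun s => p.1 (s + h)), p.2) | p <- gs].

(** The shift is undone slot by slot, [ps] being the slots already restored. Changing one increment
    from g (s + h) to g s costs a difference of [G] whose increment there is [dif h g] and whose
    base point is f + g, so that [B] doubles. *)
Let telescope_bound j h hs f B t ps gs :
  (forall gs', size gs' = (size ps + size gs)%N -> forall f',
     cube_bound 1 (2 * B) hs f' t -> slots (2 * B) hs gs' t ->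
     `|difs hs (term gs' f') t| <= bnd j (size gs') (2 * B) gs' hs) ->
  0 <= B -> cube_bound 1 B hs f t ->
  slots B hs ps t -> slots B (h :: hs) gs t ->
  `|difs hs (fun s => term (ps ++ shift_slots h gs) f s - term (ps ++ gs) f s) t|
  <= (size gs)%:R * (bnd j (size ps + size gs) (2 * B) (ps ++ gs) hs * e h).
Proof.
move=> IH B0 bf sps; have B2 : B <= 2 * B by lra.
elim: gs ps sps IH => [|[g c] gs IHgs] ps sps IH sgs /=.
  rewrite mul0r (_ : (fun _ => _) = (fun s => term ps f s - term ps f s)).
    have -> : (fun s : R => term ps f s - term ps f s) = term ps f \+ (fun s => - term ps f s) by [].
    by rewrite difsD difsN subrr normr0.
  by rewrite cats0.
case: sgs => -[/= c0 bg1 bg0] sgs.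
have sgs' : slots B hs (shift_slots h gs) t.
  apply/all_prop_map; apply: all_prop_impl sgs => p [? ? ?]; split => //=;
  exact: cube_bound_shift.
rewrite (_ : (fun _ => _) =
   term (ps ++ (dif h g, c * e h) :: shift_slots h gs) (f \+ g) \+
   (fun s => term (rcons ps (g, c) ++ shift_slots h gs) f s
             - term (rcons ps (g, c) ++ gs) f s)); last first.
  apply/funext => s; rewrite /term /= !cat_rcons !map_cat /= !difs_insert.
  have -> : f s + g s + dif h g s = f s + g (s + h) by rewrite -addrA subrKC.
  by rewrite [RHS]addrA subrKA.
rewrite difsD (le_trans (ler_normD _ _))// -natr1 mulrDl mul1r addrC lerD//.
  have IHg := IHgs (rcons ps (g, c)); rewrite size_rcons addSnnS in IHg.
  have -> : ps ++ (g, c) :: gs = rcons ps (g, c) ++ gs by rewrite cat_rcons.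
  apply: IHg => //.
    rewrite -cats1; apply/all_prop_cat; split => //=; split => //; split => //.
      exact: cube_bound_behead bg1.
    exact: cube_bound_behead bg0.
rewrite (le_trans (IH _ _ _ _ _))//.
- by rewrite size_cat /= size_map.
- have -> : 2 * B = B + B by ring.
  by apply: cube_boundD => //; exact: cube_bound_behead bg1.
- apply/all_prop_cat; split=> /=.
    apply: all_prop_impl sps => p [? b1 b0]; split => //.
    exact: cube_bound_le b1.
  split; last first.
    apply: all_prop_impl sgs' => p [? b1 b0]; split => //.
    exact: cube_bound_le b1.
  split => /=; first exact: mulr_ge0.
    exact: cube_bound_dif2.
  move=> T S _ Th Sh; have := bg0 (h :: T) S erefl.
  rewrite /= eqxx big_cons mulrA; apply => //.
  exact: subseq_trans Sh (subseq_cons _ _).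
- rewrite /bnd size_cat /= size_map !big_cat/= !big_cons/= big_map.
  by apply: eq_imp_le; ring.
Qed.

(* The cocycle identity of differences replaces the chain rule: shifting the
   base point of an iterated difference of [G] adds one increment, shifting
   an increment [g] replaces it by its own difference at base point [f + g]. *)
Lemma difs_term_bound hs gs f t (B : R) : 0 <= B ->
  (0 < size gs)%N -> (size gs + size hs <= n)%N ->
  cube_bound 1 B hs f t ->
  all_prop (fun p => [/\ 0 <= p.2, cube_bound 1 B hs p.1 t &
    cube_bound 0 p.2 hs p.1 t]) gs ->
  `|difs hs (fun s => difs [seq p.1 s | p <- gs] G (f s)) t| <=
    comp_const (size hs) (size gs) * K * (\prod_(p <- gs) p.2) *
      (1 + B) ^+ size hs * \prod_(h <- hs) e h.
Proof.
rewrite -/(slots B hs gs t) -/(term gs f) -/(E hs) -/(bnd (size hs) (size gs) B gs hs).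
elim: hs gs f t B => [|h hs IH] gs f t B B0 gs0 gsn bf sgs.
  rewrite /bnd /= /E big_nil expr0 mul1r !mulr1 /term.
  apply: le_trans (GK _ _) _.
    by rewrite size_map gs0 /= (leq_trans _ gsn)// leq_addr.
  rewrite ler_wpM2l// big_map.
  elim: gs sgs {gs0 gsn} => [|p gs IHgs] /=; first by rewrite !big_nil.
  move=> [[p0 _ bp] /IHgs ?]; rewrite !big_cons ler_pM//.
    by elim/big_ind : _ => // *; exact: mulr_ge0.
  have := bp [::] [::] erefl erefl erefl.
  by rewrite /= !big_nil addr0 mulr1.
(* The base point moves first, with all increments already shifted: f (s + h) - f s becomes a new
   slot of size B * e h, and this factor pays for the removed step. *)
rewrite /= (_ : dif h (term gs f) =
  term ((dif h f, B * e h) :: shift_slots h gs) f \+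
  (fun s => term (shift_slots h gs) f s - term gs f s)); last first.
  apply/funext => s; rewrite /term /= difs_dif /dif -map_comp.
  by rewrite subrKC subrKA.
have B2 : B <= 2 * B by lra.
have bf' : cube_bound 1 B hs f t by exact: cube_bound_behead bf.
rewrite difsD (le_trans (ler_normD _ _))//.
have bB (j : nat) : (1 + 2 * B) ^+ j <= 2 ^+ j * (1 + B) ^+ j.
  by rewrite -exprMn lerXn2r ?nnegrE; lra.
have P0 : 0 <= \prod_(p <- gs) p.2 by exact: slots_ge0 sgs.
have KP j m : 0 <= comp_const j m * K * \prod_(p <- gs) p.2.
  by rewrite !mulr_ge0 // comp_const_ge0.
have h1 : `|difs hs (term ((dif h f, B * e h) :: shift_slots h gs) f) t| <=
   2 ^+ size hs * comp_const (size hs) (size gs).+1 *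
   (K * (\prod_(p <- gs) p.2) * (1 + B) ^+ (size hs).+1 * (e h * E hs)).
  apply: le_trans (IH _ _ _ (2 * B) _ _ _ _ _) _ => //=.
  - by rewrite mulr_ge0.
  - by rewrite size_map (leq_trans _ gsn)//= addnS.
  - exact: cube_bound_le bf'.
  - split.
      split; [exact: mulr_ge0|exact: cube_bound_dif2|exact: cube_bound_dif].
    apply/all_prop_map; apply: all_prop_impl sgs => p [? ? ?]; split => //=.
      by apply: cube_bound_le (leqnn _) B2 _; exact: cube_bound_shift.
    exact: cube_bound_shift.
  - rewrite /bnd /= size_map big_cons big_map /=.
    set P := \prod_(_ <- _) _; set c := comp_const _ _.
    rewrite [leLHS](_ : _ = (c * K * P * e h * E hs) * (B * (1 + 2 * B) ^+ size hs)); last ring.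
    rewrite [leRHS](_ : _ = (c * K * P * e h * E hs) * (2 ^+ size hs * (1 + B) ^+ (size hs).+1)); last ring.
    apply: ler_wpM2l; first by rewrite !mulr_ge0// comp_const_ge0.
    rewrite exprS mulrCA; apply: ler_pM => //; first (by apply: exprn_ge0; lra).
    lra.
have h2 : `|difs hs (fun s => term (shift_slots h gs) f s - term gs f s) t| <=
   2 ^+ size hs * ((size gs)%:R * comp_const (size hs) (size gs)) *
   (K * (\prod_(p <- gs) p.2) * (1 + B) ^+ (size hs).+1 * (e h * E hs)).
  apply: le_trans (@telescope_bound (size hs) h hs f B t [::] gs _ _ _ _ _) _ => //.
    move=> gs' gs'E f' bf2 sgs'; apply: IH => //.
    - by rewrite mulr_ge0.
    - by rewrite gs'E.
    - by rewrite gs'E (leq_trans _ gsn)// leq_add2l.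
  rewrite /bnd /= add0n; set P := \prod_(_ <- _) _; set c := comp_const _ _.
  set m := (size gs)%:R.
  rewrite [leLHS](_ : _ = (m * c * K * P * e h * E hs) * (1 * (1 + 2 * B) ^+ size hs)); last ring.
  rewrite [leRHS](_ : _ = (m * c * K * P * e h * E hs) * (2 ^+ size hs * (1 + B) ^+ (size hs).+1)); last ring.
  apply: ler_wpM2l; first by rewrite !mulr_ge0// ?comp_const_ge0// ler0n.
  rewrite exprS mulrCA; apply: ler_pM => //; first (by apply: exprn_ge0; lra).
    lra.
apply: le_trans (lerD h1 h2) _.
rewrite /bnd [E (h :: hs)]big_cons -/(E hs) /= -mulrDl -mulrDr.
by apply: eq_imp_le; ring.
Qed.

Hypothesis G4 : forall u v, `|G u - G v| <= 4^-1 * `|u - v|.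

Fixpoint lip_const (j : nat) : R :=
  if j is j'.+1 then 2 ^+ j' * (lip_const j' + comp_const j' 2) else 0.

Lemma lip_const_ge0 j : 0 <= lip_const j.
Proof.
elim: j => [|j IH] //=.
by rewrite mulr_ge0 ?exprn_ge0 ?addr_ge0// comp_const_ge0.
Qed.

(** Removing a step h splits the difference into G (f' + dif h g) - G f', of the same form with base
    f' = f (s + h) + g s, and a difference of [G] with the two increments [dif h f] and [g]. The
    second part involves [g] only below top order. After the last step the first part is estimated
    by the Lipschitz constant, so the top difference of [g] carries exactly 1/4. The recursion of
    [lip_const] records these two parts. *)
Lemma difs_increment_bound hs f g t (B C : R) : 0 <= B -> 0 <= C ->
  (0 < size hs < n)%N ->
  cube_bound 1 B hs f t ->
  (forall T S, (0 < size T < size hs)%N -> subseq T hs -> subseq S hs ->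
    `|difs T g (t + \sum_(h <- S) h)| <= B * \prod_(h <- T) e h) ->
  (forall T S, (size T < size hs)%N -> subseq T hs -> subseq S hs ->
    `|difs T g (t + \sum_(h <- S) h)| <= C * \prod_(h <- T) e h) ->
  `|difs hs (fun s => G (f s + g s) - G (f s)) t| <= 4^-1 * `|difs hs g t| +
    lip_const (size hs) * K * C * B * (1 + B) ^+ (size hs).-1 *
    \prod_(h <- hs) e h.
Proof.
rewrite -/(E hs).
elim: hs f g t B C => [//|h hs IH] f g t B C B0 C0 hsn bf bg1 bg0 /=.
pose f' := fun s => f (s + h) + g s.
have bgt1 : cube_bound 1 B hs g t.
  move=> T S kT Th Sh; apply: bg1.
  - by rewrite kT /= ltnS; exact: size_subseq.
  - exact: subseq_trans Th (subseq_cons _ _).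
  - exact: subseq_trans Sh (subseq_cons _ _).
have bgt0 : cube_bound 0 C hs g t.
  move=> T S kT Th Sh; apply: bg0.
  - by rewrite /= ltnS; exact: size_subseq.
  - exact: subseq_trans Th (subseq_cons _ _).
  - exact: subseq_trans Sh (subseq_cons _ _).
rewrite (_ : dif h _ = (fun s => G (f' s + dif h g s) - G (f' s)) \+
   (fun s => difs [seq p.1 s | p <- [:: (dif h f, B * e h); (g, C)]] G (f s))); last first.
  apply/funext => s; rewrite /= /dif /f' /= !opprB.
  rewrite -[f (s + h) + g s + _]addrA !subrKC.
  rewrite -[f s + g s + _]addrA (addrC (g s)) addrA subrKC.
  by rewrite [RHS]addrA subrKA [RHS](AC (2*2) ((1*4)*(3*2))).
rewrite difsD (le_trans (ler_normD _ _))//.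
have B2 : B <= 2 * B by lra.
have h2 : `|difs hs (fun s => difs [seq p.1 s | p <- [:: (dif h f, B * e h); (g, C)]] G (f s)) t|
   <= 2 ^+ size hs * comp_const (size hs) 2 * K * C * B * (1 + B) ^+ size hs * (e h * E hs).
  apply: le_trans (difs_term_bound (B := 2 * B) _ _ _ _ _) _ => //=.
  - by rewrite mulr_ge0.
  - by apply: cube_bound_le (cube_bound_behead bf).
  - split; [split => //=|split => //; split => //=].
    + exact: mulr_ge0.
    + exact: cube_bound_dif2.
    + exact: cube_bound_dif.
    + exact: cube_bound_le bgt1.
  - rewrite !big_cons big_nil mulr1 /= -/(E hs).
    rewrite [leLHS](_ : _ = comp_const (size hs) 2 * K * B * C * e h * E hs * (1 + 2 * B) ^+ size hs); last ring.
    rewrite [leRHS](_ : _ = comp_const (size hs) 2 * K * B * C * e h * E hs * (2 ^+ size hs * (1 + B) ^+ size hs)); last ring.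
    apply: ler_wpM2l; first by rewrite !mulr_ge0// comp_const_ge0.
    by rewrite -exprMn lerXn2r ?nnegrE; lra.
have h1 : `|difs hs (fun s => G (f' s + dif h g s) - G (f' s)) t| <=
   4^-1 * `|difs hs (dif h g) t| +
   2 ^+ size hs * lip_const (size hs) * K * C * B * (1 + B) ^+ size hs * (e h * E hs).
  case: hs IH hsn bf bg1 bg0 bgt1 bgt0 {h2} => [|h' hs] IH hsn bf bg1 bg0 bgt1 bgt0.
    rewrite /= !mulr0 !mul0r addr0 (le_trans (G4 _ _))//.
    by rewrite addrAC subrr add0r.
  apply: le_trans (IH _ _ _ (2 * B) (C * e h) _ _ _ _ _ _) _.
  - by rewrite mulr_ge0.
  - by rewrite mulr_ge0.
  - exact: ltnW hsn.
  - have -> : 2 * B = B + B by ring.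
    by apply: cube_boundD => //; exact: cube_bound_shift.
  - move=> T S /andP[T0 Ts] Th Sh; rewrite difs_dif /dif.
    rewrite (le_trans (ler_normB _ _))//.
    have -> : 2 * B = B + B by ring.
    have Th' := subseq_trans Th (subseq_cons _ _).
    have Ts' : (0 < size T < size (h :: h' :: hs))%N by rewrite T0 /= ltnW// ltnS.
    rewrite mulrDl lerD//; last first.
      by apply: bg1 => //; exact: subseq_trans Sh (subseq_cons _ _).
    have := bg1 T (h :: S) Ts' (Th' _) _.
    by rewrite big_cons -addrA [h + _]addrC; apply; rewrite /= eqxx.
  - move=> T S Ts Th Sh; have := bg0 (h :: T) S; rewrite big_cons mulrA; apply.
    + by rewrite /= ltnS.
    + by rewrite /= eqxx.
    + exact: subseq_trans Sh (subseq_cons _ _).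
  - rewrite lerD2l; set hs' := h' :: hs.
    have := lip_const_ge0 (size hs'); set c := lip_const _; clearbody c => c0.
    rewrite [leLHS](_ : _ = c * K * B * C * e h * E hs' * (2 * (1 + 2 * B) ^+ (size hs').-1)); last by rewrite /E; ring.
    rewrite [leRHS](_ : _ = c * K * B * C * e h * E hs' * (2 ^+ size hs' * (1 + B) ^+ size hs')); last ring.
    apply: ler_wpM2l; first by rewrite !mulr_ge0.
    rewrite /= exprS -mulrA ler_wpM2l//.
    rewrite (@le_trans _ _ (2 ^+ size hs * (1 + B) ^+ size hs))//.
      by rewrite -exprMn lerXn2r ?nnegrE; lra.
    by rewrite ler_wpM2l ?exprn_ge0// exprS ler_peMl ?exprn_ge0//; lra.
apply: le_trans (lerD h1 h2) _.
rewrite -addrA lerD2l [E (h :: hs)]big_cons -/(E hs) /=.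
by apply: eq_imp_le; ring.
Qed.

End Composition.

(** * Differences of smooth maps *)

Section Inner.
Variables (R : realType) (H : completeNormedModType R).
Variable ip : {dot H for (idfun : R -> R)}.
Hypothesis hip : hilbert_inner ip.
Implicit Types u v w q : H.

Lemma ipDl u v w : ip (u + v) w = ip u w + ip v w.
Proof. exact: linearDl. Qed.
Lemma ipBl u v w : ip (u - v) w = ip u w - ip v w.
Proof. exact: linearBl. Qed.
Lemma ipNl u w : ip (- u) w = - ip u w.
Proof. exact: linearNl. Qed.
Lemma ipZl a u w : ip (a *: u) w = a * ip u w.
Proof. exact: linearZl_LR. Qed.
Lemma ipC u v : ip u v = ip v u.
Proof. by rewrite (@hermC _ _ idfun) expr0 mul1r. Qed.
Lemma ipDr u v w : ip w (u + v) = ip w u + ip w v.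
Proof. by rewrite ipC ipDl !(ipC w). Qed.
Lemma ipBr u v w : ip w (u - v) = ip w u - ip w v.
Proof. by rewrite ipC ipBl !(ipC w). Qed.
Lemma ipZr a u w : ip w (a *: u) = a * ip w u.
Proof. by rewrite ipC ipZl !(ipC w). Qed.

Lemma normB_sqr u v : `|u - v| ^+ 2 = `|u| ^+ 2 + `|v| ^+ 2 - 2 * ip u v.
Proof. by rewrite -!hip !ipBl !ipBr (ipC v u); ring. Qed.

Lemma ip_le u v : ip u v <= `|u| * `|v|.
Proof.
have [->|u0] := eqVneq u 0.
  by rewrite normr0 mul0r -(subrr 0) ipBl subrr.
have [->|v0] := eqVneq v 0.
  by rewrite normr0 mulr0 -(subrr 0) ipBr subrr.
have pu : 0 < `|u| by rewrite normr_gt0.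
have pv : 0 < `|v| by rewrite normr_gt0.
have := sqr_ge0 (`| (`|v| *: u - `|u| *: v) |).
rewrite normB_sqr !normrZ !normr_id ipZl ipZr.
rewrite (_ : _ - _ = 2 * (`|v| * `|u|) * (`|u| * `|v| - ip u v)); last ring.
by rewrite pmulr_rge0 ?subr_ge0// !mulr_gt0.
Qed.

Lemma ip_norm u v : `|ip u v| <= `|u| * `|v|.
Proof.
by rewrite ler_norml ip_le andbT lerNl -ipNl (le_trans (ip_le _ _))// normrN.
Qed.

Lemma norm_le_ip u (c : R) : 0 <= c -> (forall q, ip u q <= c * `|q|) -> `|u| <= c.
Proof.
move=> c0 /(_ u); rewrite hip expr2; have [->|u0] := eqVneq u 0.
  by rewrite normr0.
by rewrite ler_pM2r ?normr_gt0.
Qed.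

Lemma ip_continuous q : continuous (fun u => ip u q).
Proof.
move=> u; apply/cvgrPdist_le => /= e e0.
have q1 : 0 < `|q| + 1 by rewrite ltr_pwDr.
near=> v; rewrite -ipBl (le_trans (ip_norm _ _))//.
rewrite (@le_trans _ _ (`|u - v| * (`|q| + 1)))//; first by rewrite ler_wpM2l ?lerDl.
rewrite -ler_pdivlMr//; near: v.
by apply: cvgr_dist_le; [exact: cvg_id|exact: divr_gt0].
Unshelve. all: by end_near. Qed.

End Inner.

Section DirectionalDerivative.
Variables (R : realType) (V : normedModType R).

Lemma is_deriveP (f : R -> V) (t : R) (d : V) :
  is_derive t (1 : R) f d <-> h^-1 *: (f (h + t) - f t) @[h --> 0^'] --> d.
Proof.
have E : (fun h : R => h^-1 *: (f (h + t) - f t)) =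
   (fun h : R => h^-1 *: ((f \o shift t) (h *: 1) - f t)).
  by apply/funext => h; rewrite /= -[h *: 1]/(h * 1) mulr1.
split=> [[fd <-]|]; first by rewrite E; exact: fd.
rewrite E => fd; apply: DeriveDef; first by apply/cvg_ex; exists d.
exact: cvg_lim.
Qed.

Lemma is_derive_cont (f : R -> V) (t : R) (d : V) : is_derive t (1 : R) f d -> {for t, continuous f}.
Proof.
by move=> [fd _]; exact/differentiable_continuous/derivable1_diffP.
Qed.

End DirectionalDerivative.

Section MeanValue.
Variables (R : realType) (H : completeNormedModType R).
Variable ip : {dot H for (idfun : R -> R)}.
Hypothesis hip : hilbert_inner ip.

Lemma is_derive_ip (f : R -> H) (t : R) (d q : H) : is_derive t (1 : R) f d ->
  is_derive t (1 : R) (fun s => ip (f s) q) (ip d q).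
Proof.
move=> /is_deriveP fd; apply/is_deriveP.
under eq_fun do rewrite -ipBl -[_ *: _]/(_ * _) -ipZl.
exact: (continuous_cvg _ (@ip_continuous _ _ _ hip q d) fd).
Qed.

(** Each scalar function [ip (f s) q] satisfies the real mean value theorem with a bound
    proportional to |q|; the norm is then recovered by duality. *)
Lemma mean_value_le (f f' : R -> H) (a b c : R) : a <= b ->
  (forall t, is_derive t (1 : R) f (f' t)) -> (forall t, `|f' t| <= c) ->
  `|f b - f a| <= c * (b - a).
Proof.
move=> ab df f'c; apply: (norm_le_ip hip) => [|q].
  by rewrite mulr_ge0 ?subr_ge0// (le_trans _ (f'c 0)).
have dq t := is_derive_ip q (df t).
have [|s _ /= Es] := @MVT_segment R (fun s => ip (f s) q) (fun s => ip (f' s) q) a b ab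
   (fun t _ => dq t).
- by apply: continuous_subspaceT => t; exact: is_derive_cont (dq t).
- rewrite ipBl Es mulrAC ler_wpM2r ?subr_ge0//.
  by rewrite (le_trans (ip_le hip _ _))// ler_wpM2r.
Qed.

End MeanValue.

Section FrechetDifferences.
Variables (R : realType) (H : completeNormedModType R).
Variable ip : {dot H for (idfun : R -> R)}.
Hypothesis hip : hilbert_inner ip.
Variable G : H -> H.
Hypothesis smoothG : frechet_smooth G.

Lemma has_frechet k x : has_frechet_derivative (frechet k G) x (frechet k.+1 G x).
Proof. by have [L hL] := smoothG k x; exact: (xgetPex _ (ex_intro _ L hL)). Qed.

Lemma mlnorm_ub k (L : k.-tuple H -> H) v :
  (forall i, `|tnth v i| <= 1) -> (`|L v|%:E <= mlnorm L)%E.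
Proof. by move=> v1; apply: ereal_sup_ubound; exists v. Qed.

Lemma is_derive_frechet k (v : k.-tuple H) (d x : H) (t : R) :
  (forall i, `|tnth v i| <= 1) -> `|d| <= 1 ->
  is_derive t (1 : R) (fun s => frechet k G (x + s *: d) v)
    (frechet k.+1 G (x + t *: d) [tuple of d :: v]).
Proof.
move=> v1 d1; apply/is_deriveP; set y := x + t *: d.
have [[mL _] dF] := has_frechet k y.
set L := frechet k.+1 G y in mL dF *.
have LZ (a : R) : L [tuple of (a *: d) :: v] = a *: L [tuple of d :: v].
  have substE (w : H) : [tuple if j == ord0 then w else tnth [tuple of d :: v] j | j < k.+1]
     = [tuple of w :: v].
    apply: eq_from_tnth => j; rewrite tnth_mktuple; case: eqP => [->|/eqP j0].
      by rewrite tnth0.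
    by case: (unliftP ord0 j) j0 => [i ->|->]; rewrite ?eqxx// !tnthS.
  have := mL ord0 [tuple of d :: v] a d 0; rewrite /= !substE addr0 => ->.
  (* Linearity at two zero vectors reads L(0) = L(0) + L(0), so the value with a zero slot vanishes
     and homogeneity remains. *)
  have := mL ord0 [tuple of d :: v] 1 0 0; rewrite /= !substE scaler0 addr0 scale1r.
  by move/eqP; rewrite -subr_eq0 opprD addNKr oppr_eq0 => /eqP ->; rewrite addr0.
apply/cvgrPdist_le => /= e e0.
have : (fun s : R => s *: d) @ 0 --> (0 : H).
  by rewrite -[X in _ --> X](scale0r d); apply: cvgZr_tmp; exact: cvg_id.
move=> /(_ _ (dF e e0)) /= dF0.
near=> s.
have s0 : s != 0 by near: s; exact: nbhs_dnbhs_neq.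
have : (mlnorm (fun v0 : k.-tuple H => (frechet k G (y + s *: d) v0 -
    frechet k G y v0 - L [tuple of (s *: d) :: v0])%R) <= (e * `|s *: d|)%:E)%E.
  near: s; apply: nbhs_dnbhs; exact: dF0.
move=> /(le_trans (mlnorm_ub _ v1)); rewrite lee_fin LZ => h.
have -> : x + (s + t) *: d = y + s *: d by rewrite addrC scalerDl (AC (2*1) ((3*2)*1)).
rewrite (_ : L _ - _ = - (s^-1 *: (frechet k G (y + s *: d) v - frechet k G y v
    - s *: L [tuple of d :: v]))); last first.
  by rewrite [in RHS]scalerBr scalerA mulVf// scale1r opprB.
rewrite normrN normrZ normfV ler_pdivrMl ?normr_gt0// mulrC.
apply: le_trans h _; rewrite normrZ mulrA ler_piMr// mulr_ge0// ltW.
Unshelve. all: by end_near. Qed.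

Lemma is_derive_difs k (v : k.-tuple H) (d : H) bs x (t : R) :
  (forall i, `|tnth v i| <= 1) -> `|d| <= 1 ->
  is_derive t (1 : R) (fun s => difs bs (fun z => frechet k G z v) (x + s *: d))
    (difs bs (fun z => frechet k.+1 G z [tuple of d :: v]) (x + t *: d)).
Proof.
move=> v1 d1; elim: bs x => [|b bs IH] x; first exact: is_derive_frechet.
rewrite difs_consE.
under eq_fun do rewrite difs_consE.
apply: is_deriveB; rewrite addrAC.
by under eq_fun do rewrite addrAC.
Qed.

(** The mean value inequality along the segment of [b] trades this step for the factor |b| and one
    more derivative, in the unit direction b / |b|. The order [k] and the unit directions [v] are
    general because both grow along the induction. *)
Lemma difs_frechet_le n (K : R) :
  (forall k, (0 < k <= n)%N -> (sup_frechet G k <= K%:E)%E) ->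
  forall bs k (v : k.-tuple H) z, (forall i, `|tnth v i| <= 1) ->
    (0 < k + size bs <= n)%N ->
    `|difs bs (fun x => frechet k G x v) z| <= K * \prod_(b <- bs) `|b|.
Proof.
move=> GK; elim=> [|b bs IH] k v z v1.
  rewrite addn0 big_nil mulr1 => /GK kn /=; rewrite -lee_fin.
  apply: le_trans (mlnorm_ub _ v1) (le_trans _ kn).
  by apply: ereal_sup_ubound; exists z.
rewrite /= addnS -addSn => kn.
have [->|b0] := eqVneq b 0.
  rewrite difs_dif /dif addr0 subrr normr0 big_cons normr0 mul0r mulr0//.
have pb : 0 < `|b| by rewrite normr_gt0.
pose d := `|b|^-1 *: b.
have d1 : `|d| <= 1 by rewrite normrZ normfV normr_id mulVf ?gt_eqF.
rewrite big_cons mulrCA mulrC; pose F s := difs bs (fun z => frechet k G z v) (z + s *: d).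
have -> : difs bs (dif b (fun x => frechet k G x v)) z = F `|b| - F 0.
  by rewrite difs_dif /F scale0r addr0 /d scalerA divff ?gt_eqF// scale1r.
rewrite -[X in _ * X]subr0.
apply: (mean_value_le hip (ltW pb) (fun t => is_derive_difs bs z t v1 d1)) => t.
apply: IH => // i; case: (unliftP ord0 i) => [j ->|->]; rewrite ?tnth0//.
by rewrite tnthS.
Qed.

Lemma difs_smooth_le n (K : R) :
  (forall k, (0 < k <= n)%N -> (sup_frechet G k <= K%:E)%E) ->
  forall bs z, (0 < size bs <= n)%N ->
    `|difs bs G z| <= K * \prod_(b <- bs) `|b|.
Proof.
move=> GK bs z bsn.
by apply: (@difs_frechet_le n K GK bs 0 [tuple] z); rewrite ?add0n// => -[].
Qed.

End FrechetDifferences.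

(** * Integration on the half-line *)

Section Translation.
Variable R : realType.
Local Notation mu := (@lebesgue_measure R).
Implicit Types (h : R) (D N : set R).

Lemma measurable_shift h :
  measurable_fun [set: R] ((fun t => t + h) : R -> measurableTypeR R).
Proof. exact: measurable_funD. Qed.

Lemma lebesgue_measure_shift h D : measurable D ->
  pushforward mu ((fun t => t + h) : R -> measurableTypeR R) D = mu D.
Proof.
move=> mD; apply/esym; pose ms := measurable_shift h.
have := @lebesgue_measure_unique R (pushforward mu ((fun t => t + h) : R -> measurableTypeR R)).
apply => //= _ [[a b]] _ <-; rewrite /= /pushforward.
rewrite (_ : _ @^-1` _ = `]a - h, b - h]%classic); last first.
  by apply/seteqP; split=> t /=; rewrite !in_itv/= ltrBlDr lerBrDr.
by rewrite !lebesgue_measure_itv/= !lte_fin ltrD2r -!EFinB opprB addrA subrK.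
Qed.

Lemma measurable_preimage_shift h D : measurable D ->
  measurable ((fun t : R => t + h) @^-1` D).
Proof. by move=> mD; rewrite -[X in measurable X]setTI; exact: measurable_shift. Qed.

Lemma ge0_integral_shift h D (f : R -> \bar R) : measurable D ->
  measurable_fun D f -> (forall t, D t -> (0 <= f t)%E) ->
  (\int[mu]_(t in [set t : R | D (t + h)%R]) f (t + h)%R = \int[mu]_(t in D) f t)%E.
Proof.
move=> mD mf f0.
transitivity (\int[pushforward mu ((fun t => t + h)%R : R -> measurableTypeR R)]_(t in D) f t)%E.
  rewrite ge0_integral_pushforward//; first exact: measurable_shift.
  by move=> t /[!inE]; exact: f0.
apply: eq_measure_integral => [|mphi A mA _]; first exact: measurable_shift.
exact: lebesgue_measure_shift.
Qed.

Lemma integrable_shift h (f : R -> R) : mu.-integrable setT (EFin \o f) ->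
  mu.-integrable setT (EFin \o (fun t => f (t + h))).
Proof.
move=> /integrableP[mf fy]; apply/integrableP; split.
  have := measurableT_comp mf (measurable_shift h); exact.
apply: le_lt_trans fy; rewrite -[leRHS](ge0_integral_shift h)//=.
by apply/measurable_EFinP/measurableT_comp => //; exact/measurable_EFinP.
Qed.

Lemma Rintegral_shift h (f : R -> R) : mu.-integrable setT (EFin \o f) ->
  \int[mu]_t f (t + h) = \int[mu]_t f t.
Proof.
move=> fi; have [mf _] := integrableP _ _ _ fi; congr fine.
transitivity (\int[pushforward mu ((fun t => t + h)%R : R -> measurableTypeR R)]_t (f t)%:E)%E.
  rewrite integral_pushforward//; first exact: measurable_shift.
  exact: integrable_shift.
apply: eq_measure_integral => [|mphi A mA _]; first exact: measurable_shift.
exact: lebesgue_measure_shift.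
Qed.

Lemma negligible_shift h N : mu.-negligible N ->
  mu.-negligible [set t | N (t + h)].
Proof.
move=> [A [mA A0 NA]]; exists ((fun t => t + h) @^-1` A); split.
- exact: measurable_preimage_shift.
- by rewrite -A0; exact: lebesgue_measure_shift.
- by move=> t /NA.
Qed.

End Translation.

Section AlmostEverywhere.
Variable R : realType.
Local Notation mu := (@lebesgue_measure R).
Implicit Types P Q : R -> Prop.

Lemma lebesgue_aeS P Q : (forall t, P t -> Q t) ->
  {ae mu, forall t, P t} -> {ae mu, forall t, Q t}.
Proof. by move=> PQ; apply: negligibleS => t /= nQ /PQ. Qed.

Lemma lebesgue_aeI P Q : {ae mu, forall t, P t} -> {ae mu, forall t, Q t} ->
  {ae mu, forall t, P t /\ Q t}.
Proof.
move=> p q; apply: negligibleS (negligibleU p q) => t /= /not_andP[]; by [left|right].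
Qed.

Lemma lebesgue_ae_countable (T : Type) (D : set T) (P : T -> R -> Prop) :
  countable D -> (forall i, D i -> {ae mu, forall t, P i t}) ->
  {ae mu, forall t, forall i, D i -> P i t}.
Proof.
move=> /countable_injP[f injf] aP.
pose B n := [set t | exists i, [/\ D i, f i = n & ~ P i t]].
apply: (@negligibleS _ _ _ mu (\bigcup_n B n)).
  move=> t /= /existsNP[i /not_implyP[Di nP]].
  by exists (f i) => //; exists i.
apply: negligible_bigcup => n; have [[i [Di fi]]|noi] := pselect (exists i, D i /\ f i = n).
  apply: negligibleS (aP _ Di) => t [j [Dj fj nP]] /=.
  by rewrite (injf i j) ?inE ?fi ?fj.
by apply: negligibleS (negligible_set0 mu) => t [j [Dj fj _]]; apply: noi; exists j.
Qed.

Lemma lebesgue_ae_shift h P : {ae mu, forall t, P t} ->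
  {ae mu, forall t, P (t + h)}.
Proof. exact: negligible_shift. Qed.

Lemma lebesgue_aeW P : (forall t, P t) -> {ae mu, forall t, P t}.
Proof. by move=> p; apply: (@aeW _ _ _ mu P). Qed.

End AlmostEverywhere.

Section BoundedIntegrals.
Variable R : realType.
Local Notation mu := (@lebesgue_measure R).

Lemma integrable_indic_itv (a b C : R) :
  mu.-integrable setT (EFin \o (fun t => C * \1_`[a, b] t)).
Proof.
apply/integrableP; split.
  exact/measurable_EFinP/measurable_funM/measurable_indic.
under eq_integral => t _ do rewrite /= normrM EFinM.
rewrite ge0_integralZl//; last first.
  exact/measurable_EFinP/measurableT_comp/measurable_indic.
under eq_integral => t _ do rewrite ger0_norm//.
rewrite integral_indic// setIT [X in (_ * X)%E]lebesgue_measure_itv /=.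
by case: ifP => // _; rewrite ?mule0 ?ltry// -EFinB -EFinM ltry.
Qed.

Lemma integrable_bounded (f : R -> R) (a b C : R) : measurable_fun setT f ->
  (forall t, `|f t| <= C * \1_`[a, b] t) -> mu.-integrable setT (EFin \o f).
Proof.
move=> mf fC; apply: (le_integrable _ _ _ (integrable_indic_itv a b C)) => //.
  exact/measurable_EFinP.
by move=> t _ /=; rewrite lee_fin (le_trans (fC t))// ler_norm.
Qed.

Lemma Rintegral_dominated (f_ : nat -> R -> R) (f : R -> R) (a b C : R) :
  (forall n, measurable_fun setT (f_ n)) -> measurable_fun setT f ->
  {ae mu, forall t, (fun n => f_ n t) @ \oo --> f t} ->
  {ae mu, forall t, forall n, `|f_ n t| <= C * \1_`[a, b] t} ->
  \int[mu]_t f_ n t @[n --> \oo] --> \int[mu]_t f t.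
Proof.
move=> mf_ mf f_f fC.
have [|||||/= fi _ cv] := @dominated_convergence _ _ _ mu setT measurableT (fun n => EFin \o f_ n)
  (EFin \o f) (EFin \o (fun t => C * \1_`[a, b] t)).
- by move=> n; apply/measurable_EFinP; exact: mf_.
- exact/measurable_EFinP.
- apply: lebesgue_aeS f_f => t ft _ /=.
  by apply: cvg_EFin => //; exact: nearW.
- exact: integrable_indic_itv.
- by apply: lebesgue_aeS fC => t ft n _ /=; rewrite lee_fin.
apply: fine_cvg; rewrite fineK; last exact: integrable_fin_num fi.
exact: cv.
Qed.

End BoundedIntegrals.

Section Tails.
Variable R : realType.
Local Notation mu := (@lebesgue_measure R).
Local Open Scope ereal_scope.
Implicit Types (s h c : R) (F G : R -> R).

Definition tail (s : R) (F : R -> R) : \bar R := \int[mu]_(t in `]s, +oo[) (F t)%:E.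

Lemma tail_ge0 s F : (forall t, (s < t)%R -> (0 <= F t)%R) -> 0 <= tail s F.
Proof.
by move=> F0; apply: integral_ge0 => t /=; rewrite in_itv/= andbT lee_fin; exact: F0.
Qed.

Lemma le_tail s F G : measurable_fun setT F -> measurable_fun setT G ->
  (forall t, (s < t)%R -> (0 <= F t <= G t)%R) -> tail s F <= tail s G.
Proof.
move=> mF mG FG; apply: ge0_le_integral => //.
- by move=> t /=; rewrite in_itv/= andbT lee_fin => /FG/andP[].
- by apply/measurable_EFinP; exact: measurable_funTS.
- by apply/measurable_EFinP; exact: measurable_funTS.
- by move=> t /=; rewrite in_itv/= andbT lee_fin => /FG/andP[].
Qed.

Lemma tail_shift s h F : measurable_fun setT F ->
  (forall t, (s + h < t)%R -> (0 <= F t)%R) ->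
  tail s (fun t => F (t + h)%R) = tail (s + h)%R F.
Proof.
move=> mF F0; rewrite /tail -(ge0_integral_shift h (D := `](s + h)%R, +oo[%classic))//.
- congr (integral _ _ _); apply/seteqP; split => t /=;
  by rewrite !in_itv/= !andbT ltrD2r.
- by apply/measurable_EFinP; exact: measurable_funTS.
- by move=> t /=; rewrite in_itv/= andbT lee_fin; exact: F0.
Qed.

Lemma tail_anti s s' F : measurable_fun setT F ->
  (forall t, (s < t)%R -> (0 <= F t)%R) -> (s <= s')%R -> tail s' F <= tail s F.
Proof.
move=> mF F0 ss'; apply: ge0_subset_integral => //.
- by apply/measurable_EFinP; exact: measurable_funTS.
- by move=> t /=; rewrite in_itv/= andbT lee_fin; exact: F0.
- by move=> t /=; rewrite !in_itv/= !andbT; exact: le_lt_trans.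
Qed.

Lemma tailD s F G : measurable_fun setT F -> measurable_fun setT G ->
  (forall t, (s < t)%R -> (0 <= F t)%R) -> (forall t, (s < t)%R -> (0 <= G t)%R) ->
  tail s (fun t => F t + G t)%R = tail s F + tail s G.
Proof.
move=> mF mG F0 G0; rewrite /tail -ge0_integralD//.
- by move=> t /=; rewrite in_itv/= andbT lee_fin; exact: F0.
- by apply/measurable_EFinP; exact: measurable_funTS.
- by move=> t /=; rewrite in_itv/= andbT lee_fin; exact: G0.
- by apply/measurable_EFinP; exact: measurable_funTS.
Qed.

Lemma tailZ s F (c : R) : measurable_fun setT F ->
  (forall t, (s < t)%R -> (0 <= F t)%R) -> (0 <= c)%R ->
  tail s (fun t => c * F t)%R = c%:E * tail s F.
Proof.
move=> mF F0 c0; rewrite /tail -ge0_integralZl//.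
- by apply/measurable_EFinP; exact: measurable_funTS.
- by move=> t /=; rewrite in_itv/= andbT lee_fin; exact: F0.
Qed.

End Tails.

Lemma dense_seq (R : realType) (H : normedModType R) : separable_space H ->
  exists d : nat -> H, forall (z : H) (e : R), 0 < e -> exists k, `|z - d k| < e.
Proof.
move=> [D /countable_injP[f injf] dD].
exists (fun n => xget 0 [set d | D d /\ f d = n]) => z e e0.
have [|d []] := dD (ball z e)^° _ (@open_interior _ _).
  by exists z; exact: nbhsx_ballx.
move=> /interior_subset; rewrite -ball_normE /= => zd Dd; exists (f d).
case: xgetP => [d' _ [Dd' fd']|/(_ d)]; last by case.
by rewrite (injf d' d) ?inE.
Qed.

(** * Borel measurable maps into a separable space *)

Section HilbertMeasurable.
Variables (R : realType) (H : completeNormedModType R).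
Hypothesis sepH : separable_space H.
Implicit Types u v : R -> H.

Definition hmeas u := forall U : set H, open U -> measurable (u @^-1` U).

Lemma hmeas_comp u (phi : H -> H) : continuous phi -> hmeas u -> hmeas (phi \o u).
Proof.
move=> /continuousP cphi mu U /cphi oU; rewrite comp_preimage; exact: mu.
Qed.

Lemma hmeas_real u (phi : H -> R) : continuous phi -> hmeas u ->
  measurable_fun setT (phi \o u).
Proof.
move=> /continuousP cphi mu _; apply: (measurability _ (RGenOpens.measurableE R)).
move=> _ [_ [a [b ->] <-]]; rewrite setTI comp_preimage.
  by apply: mu; apply: cphi; exact: itv_open.
exact: measurableT.
Qed.

Lemma hmeas_norm u : hmeas u -> measurable_fun setT (fun t => `|u t|).
Proof. by move=> /hmeas_real; apply; exact: norm_continuous. Qed.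

Lemma hmeas_normB u (c : H) : hmeas u -> measurable_fun setT (fun t => `|u t - c|).
Proof.
move=> mu; apply: (hmeas_real (phi := fun z => `|z - c|)) => // z.
apply: cvg_norm; apply: cvgB; [exact: cvg_id|exact: cvg_cst].
Qed.

Lemma hmeas_shift u h : hmeas u -> hmeas (fun t => u (t + h)).
Proof. by move=> mu U /mu mU; exact: (measurable_preimage_shift h mU). Qed.

Lemma hmeas_cst (c : H) : hmeas (fun=> c).
Proof. by move=> U _; rewrite preimage_cst; case: ifP. Qed.

(** By separability an open set is the countable union of the balls of radius 1 / (n + 1) around
    points of a dense sequence that it contains, so the scalar distance functions detect
    measurability. *)
Lemma hmeasP u : (forall c, measurable_fun setT (fun t => `|u t - c|)) -> hmeas u.
Proof.
move=> muc U oU; have [d dd] := dense_seq sepH.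
pose B (k n : nat) := [set t | `|u t - d k| < n.+1%:R^-1].
rewrite (_ : _ @^-1` _ =
  \bigcup_k \bigcup_(n in [set n | ball (d k) n.+1%:R^-1 `<=` U]) B k n); last first.
  apply/seteqP; split => t /=; last first.
    by move=> [k _ [n /= dU dt]]; apply: dU; rewrite -ball_normE /= distrC.
  move=> Ut; have [e /= e0 eU] := (@nbhs_ballP _ _ _ _).1 (open_nbhs_nbhs (conj oU Ut)).
  have [n ne] : exists n : nat, n.+1%:R^-1 < e / 2.
    have [n _ nP] := near_infty_natSinv_lt (PosNum (divr_gt0 e0 (ltr0n _ 2))).
    by exists n; exact: (nP n (leqnn n)).
  have n0 : 0 < n.+1%:R^-1 :> R by rewrite invr_gt0.
  have [k udk] := dd (u t) _ n0.
  exists k => //; exists n => //= z.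
  rewrite -ball_normE /= => dz; apply: eU; rewrite -ball_normE /=.
  have := ler_distD (d k) (u t) z; move: ne udk dz.
  by set r := _^-1; clearbody r; lra.
apply: bigcup_measurable => k _; apply: bigcup_measurable => n _.
have := muc (d k) measurableT `]-oo, n.+1%:R^-1[%classic (measurable_itv _).
by rewrite setTI; congr measurable; apply/seteqP; split => t /=; rewrite in_itv.
Qed.

(** The inequality |u + v - c| < e holds exactly when |u - d k| + |v - (c - d k)| < e for some point
    [d k] of a dense sequence, a countable union of measurable conditions. *)
Lemma hmeasD u v : hmeas u -> hmeas v -> hmeas (fun t => u t + v t).
Proof.
move=> mu mv; apply: hmeasP => c; have [d dd] := dense_seq sepH.
move=> _; apply: (measurability _ (RGenInftyO.measurableE R)) => //.
move=> _ [_ [e ->] <-]; rewrite setTI.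
rewrite (_ : _ @^-1` _ = \bigcup_k [set t | `|u t - d k| + `|v t - (c - d k)| < e]).
  apply: bigcup_measurable => k _.
  have mk : measurable_fun setT (fun t => `|u t - d k| + `|v t - (c - d k)|).
    by apply: measurable_funD; exact: hmeas_normB.
  have := mk measurableT `]-oo, e[%classic (measurable_itv _).
  by rewrite setTI; congr measurable; apply/seteqP; split => t /=; rewrite in_itv.
apply/seteqP; split => t /=; rewrite in_itv/=.
  move=> ue; pose r := (e - `|u t + v t - c|) / 2.
  have r0 : 0 < r by rewrite divr_gt0 ?subr_gt0.
  have [k uk] := dd (u t) r r0; exists k => //=.
  rewrite (_ : v t - (c - d k) = (u t + v t - c) - (u t - d k)); last first.
    by rewrite !opprB [RHS](AC (3*2) ((2*(4*3))*(1*5)))/= subrr addr0.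
  rewrite (le_lt_trans (lerD (lexx _) (ler_normB _ _)))//.
  by rewrite /r in uk; lra.
move=> [k _ /=]; apply: le_lt_trans.
rewrite (_ : u t + v t - c = (u t - d k) + (v t - (c - d k))); first exact: ler_normD.
by rewrite opprB [RHS](AC (2*(1*2)) ((1*3*5)*(2*4)))/= addNr addr0.
Qed.

Lemma hmeasZ u (a : R) : hmeas u -> hmeas (fun t => a *: u t).
Proof. by apply: hmeas_comp; exact: scaler_continuous. Qed.

Lemma hmeasN u : hmeas u -> hmeas (fun t => - u t).
Proof. by apply: hmeas_comp; exact: opp_continuous. Qed.

Lemma hmeas_dif u h : hmeas u -> hmeas (dif h u).
Proof. by move=> mu; apply: hmeasD; [exact: hmeas_shift|exact: hmeasN]. Qed.

Lemma hmeas_difs u hs : hmeas u -> hmeas (difs hs u).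
Proof. by elim: hs u => [//|h hs IH] u mu; apply: IH; exact: hmeas_dif. Qed.

Lemma hmeas_ip (ip : {dot H for (idfun : R -> R)}) u v : hilbert_inner ip ->
  hmeas u -> hmeas v -> measurable_fun setT (fun t => ip (u t) (v t)).
Proof.
move=> hip mu mv.
rewrite (_ : (fun _ => _) = (fun t =>
    2^-1 * (`|u t| ^+ 2 + `|v t| ^+ 2 - `|u t - v t| ^+ 2))); last first.
  by apply/funext => t; rewrite (normB_sqr hip); field.
apply: measurable_funM => //; apply: measurable_funB; last first.
  by apply: measurable_funX; exact: (hmeas_norm (hmeasD mu (hmeasN mv))).
by apply: measurable_funD; apply: measurable_funX; exact: hmeas_norm.
Qed.

Lemma hmeas_patch u (E : set R) : measurable E -> hmeas u ->
  hmeas (fun t => if t \in E then u t else 0).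
Proof.
move=> mE mu U oU; rewrite (_ : _ @^-1` _ =
    (E `&` u @^-1` U) `|` (~` E `&` (fun=> 0) @^-1` U)).
  apply: measurableU; apply: measurableI => //; [exact: mu|exact: measurableC|].
  exact: hmeas_cst.
apply/seteqP; split => t /=.
  case: ifPn => [/set_mem Et Ut|nE U0]; [by left|right; split => //].
  by move=> Et; rewrite mem_set in nE.
move=> [[Et Ut]|[nE U0]]; first by rewrite mem_set.
by rewrite memNset.
Qed.

End HilbertMeasurable.

(** * Primitives of bounded functions and Lebesgue points *)

Section Primitive.
Variable R : realType.
Local Notation mu := (@lebesgue_measure R).
Implicit Types (f g : R -> R) (s t h C : R).

(** Anchored at 0 although the equation lives on t > 0: the integrands used are bounded on the whole
    line, and only increments between positive times matter. *)
Definition prim f t := \int[mu]_(s in `[0, t]) f s.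

Lemma integrable_bounded_itv f C a b : measurable_fun setT f ->
  (forall t, `|f t| <= C) -> mu.-integrable `[a, b] (EFin \o f).
Proof.
move=> mf fC; apply: measurable_bounded_integrable => //.
- by rewrite /= lebesgue_measure_itv; case: ifP => _; rewrite ?ltry.
- exact: measurable_funTS.
- exists C; split; first exact: num_real.
  by move=> x Cx t _ /=; rewrite (le_trans (fC t))// ltW.
Qed.

Lemma primB f C s t : measurable_fun setT f -> (forall t, `|f t| <= C) ->
  0 <= s <= t -> prim f t - prim f s = \int[mu]_(x in `]s, t]) f x.
Proof.
move=> mf fC /andP[s0 st]; apply: Rintegral_itvB; rewrite ?bnd_simp//.
exact: integrable_bounded_itv fC.
Qed.

Lemma Rintegral_itv_le f C s t : measurable_fun setT f -> (forall t, `|f t| <= C) ->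
  s <= t -> `|\int[mu]_(x in `]s, t]) f x| <= C * (t - s).
Proof.
move=> mf fC st; have fi : mu.-integrable `]s, t] (EFin \o f).
  by apply: integrableS (integrable_bounded_itv s t mf fC) => //; exact: subset_itv_oc_cc.
rewrite (le_trans (le_normr_Rintegral _ fi))//.
have -> : C * (t - s) = \int[mu]_(x in `]s, t]) C.
  rewrite Rintegral_cst//= lebesgue_measure_itv/= lte_fin.
  by move: st; rewrite le_eqVlt => /predU1P[->|->]//=; rewrite ltxx subrr.
have Ci : mu.-integrable `]s, t] (EFin \o (fun=> C)).
  apply: integrableS (integrable_bounded_itv s t (measurable_cst C) (C := `|C|) _) => //.
  exact: subset_itv_oc_cc.
apply: (le_Rintegral _ _ Ci) => [//||x _]; last exact: fC.
exact: integrable_norm.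
Qed.

Lemma prim_lipschitz f C s t : measurable_fun setT f -> (forall t, `|f t| <= C) ->
  0 <= s -> 0 <= t -> `|prim f t - prim f s| <= C * `|t - s|.
Proof.
move=> mf fC; wlog st : s t / s <= t.
  move=> W s0 t0; case/orP: (le_total s t) => st; first exact: W.
  by rewrite distrC (distrC t); exact: W.
move=> s0 t0; rewrite (primB mf fC) ?s0// [`|t - s|]ger0_norm ?subr_ge0//.
exact: Rintegral_itv_le.
Qed.

Lemma ae_lebesgue_pt f C : measurable_fun setT f -> (forall t, `|f t| <= C) ->
  {ae mu, forall t, lebesgue_pt f t}.
Proof.
move=> mf fC; apply: lebesgue_differentiation; split => //; first exact: openT.
move=> K _ cK; have mK : measurable K := compact_measurable cK.
have : mu.-integrable K (EFin \o f).
  apply: measurable_bounded_integrable => //; [exact: compact_finite_measure|exact: measurable_funTS|].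
  exists C; split; first exact: num_real.
  by move=> x Cx t _ /=; rewrite (le_trans (fC t))// ltW.
by move=> /integrableP[_].
Qed.

Lemma lebesgue_pt_quotient f C t (h : nat -> R) : measurable_fun setT f ->
  (forall t, `|f t| <= C) -> 0 < t -> lebesgue_pt f t ->
  (forall n, h n != 0) -> h n @[n --> \oo] --> 0 ->
  (h n)^-1 * (prim f (t + h n) - prim f t) @[n --> \oo] --> f t.
Proof.
move=> mf fC t0 ft hn0 h0.
have [||df Ef] := @FTC1_lebesgue_pt R f (BLeft 0) t (t + 1) _ (integrable_bounded_itv 0 (t + 1) mf fC) _ ft.
- by rewrite ltrDl.
- by rewrite lte_fin.
have fd := DeriveDef df (etrans (esym (derive1E _ _)) Ef).
move/is_deriveP : fd => /cvgr_dnbhsP /(_ h (conj hn0 h0)).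
apply: cvg_trans; apply: near_eq_cvg; apply: nearW => n /=.
by rewrite (addrC t).
Qed.

End Primitive.

(** * The equation in integrated form *)

Section SmoothFunctions.
Variable R : realType.

Lemma is_derive_conv (V : normedModType R) (f : R -> V) (t : R) (d d' : V) :
  is_derive t (1 : R) f d -> d = d' -> is_derive t (1 : R) f d'.
Proof. by move=> fd <-. Qed.

(** Differentiability n times, with the successive derivatives exhibited: closure under products and
    inverses then goes by induction, without any formula for iterated derivatives. *)
Fixpoint cn (V : normedModType R) (n : nat) (f : R -> V) : Prop :=
  if n is n'.+1 then exists2 f', (forall t, is_derive t (1 : R) f (f' t)) & cn n' f'
  else True.

Section Normed.
Variable V : normedModType R.
Implicit Types f g : R -> V.

Lemma cn_derivable n f : cn n.+1 f -> forall t, derivable (f^`(n)%classic) t 1.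
Proof.
elim: n f => [|n IH] f; first by move=> [f' df _] t; case: (df t).
move=> [f' df /IH nf'] t; rewrite derive1Sn.
suff -> : f^`()%classic = f' by exact: nf'.
by apply/funext => s; rewrite derive1E; case: (df s).
Qed.

Lemma cn_derive1 f (f' : R -> V) : (forall t, is_derive t (1 : R) f (f' t)) ->
  f^`()%classic = f'.
Proof. by move=> df; apply/funext => s; rewrite derive1E; case: (df s). Qed.

Lemma cnS n f : cn n.+1 f -> cn n f.
Proof.
by elim: n f => [//|n IH] f [f' df /IH nf']; exists f'.
Qed.

Lemma cnD n f g : cn n f -> cn n g -> cn n (fun t => f t + g t).
Proof.
elim: n f g => [//|n IH] f g [f' df nf] [g' dg ng].
by exists (fun t => f' t + g' t); [move=> t; exact: is_deriveD|exact: IH].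
Qed.

Lemma cnZ n f (a : R) : cn n f -> cn n (fun t => a *: f t).
Proof.
elim: n f => [//|n IH] f [f' df nf].
by exists (fun t => a *: f' t); [move=> t; exact: is_deriveZ|exact: IH].
Qed.

Lemma is_derive_scalel (f : R -> R) (t d : R) (q : V) : is_derive t (1 : R) f d ->
  is_derive t (1 : R) (fun s => f s *: q) (d *: q).
Proof.
move=> /is_deriveP fd; apply/is_deriveP.
rewrite (_ : (fun _ => _) = (fun h => (h^-1 *: (f (h + t) - f t)) *: q)).
  exact: cvgZr_tmp fd.
by apply/funext => h; rewrite -scalerBl scalerA.
Qed.

Lemma cn_scalel n (f : R -> R) (q : V) : cn n f -> cn n (fun t => f t *: q).
Proof.
elim: n f => [//|n IH] f [f' df nf].
by exists (fun t => f' t *: q); [move=> t; exact: is_derive_scalel|exact: IH].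
Qed.

End Normed.

Implicit Types f g : R -> R.

Lemma cnM n f g : cn n f -> cn n g -> cn n (fun t => f t * g t).
Proof.
elim: n f g => [//|n IH] f g cf cg; have [f' df nf] := cf; have [g' dg ng] := cg.
exists (fun t => f t * g' t + g t * f' t); first by move=> t; exact: is_deriveM.
by apply: cnD; apply: IH => //; exact: cnS.
Qed.

Lemma cnV n f : (forall t, f t != 0) -> cn n f -> cn n (fun t => (f t)^-1).
Proof.
move=> f0; elim: n => [//|n IH] cf; have [f' df nf] := cf.
exists (fun t => - ((f t)^-1 * (f t)^-1) * f' t).
  by move=> t; apply: (is_derive_conv (is_deriveV (f0 t) (df t))); rewrite expr2 invfM.
have := cnS cf => /IH cV.
by apply: cnM => //; rewrite (_ : (fun _ => _) = (fun t => -1 * ((f t)^-1 * (f t)^-1))); [apply: cnZ; exact: cnM|apply/funext => t; rewrite mulN1r].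
Qed.

Lemma cn_affine n f (a b : R) : cn n f -> cn n (fun t => f (a * t + b)).
Proof.
elim: n f => [//|n IH] f [f' df nf].
exists (fun t => a * f' (a * t + b)); last exact/cnZ/IH.
move=> t; have da : is_derive t (1 : R) (fun s => a * s + b) a.
  apply: (is_derive_conv (is_deriveD (is_deriveZ a (is_derive_id t 1)) (is_derive_cst b t 1))).
  by rewrite addr0 -[LHS]/(_ * _) mulr1.
by apply: (is_derive_conv (is_derive1_comp (df _) da)); rewrite mulrC.
Qed.

(** The classical flat function exp(-1/t), multiplied by t^-k so that the linear span of the family
    is closed under differentiation. *)
Definition flat (k : nat) (t : R) : R :=
  if 0 < t then t^-1 ^+ k * expR (- t^-1) else 0.

Lemma flat_ge0 k t : 0 <= flat k t.
Proof.
by rewrite /flat; case: ifP => // t0; rewrite mulr_ge0 ?expR_ge0 ?exprn_ge0 ?invr_ge0 ?ltW.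
Qed.

Lemma flat_gt0 k t : 0 < t -> 0 < flat k t.
Proof. by move=> t0; rewrite /flat t0 mulr_gt0 ?expR_gt0 ?exprn_gt0 ?invr_gt0. Qed.

Lemma flat_le k t : flat k t <= k.+1`!%:R * `|t|.
Proof.
rewrite /flat; case: ifPn => t0; last by rewrite mulr_ge0.
rewrite (gtr0_norm t0) expRN ler_pdivrMr ?expR_gt0//.
have := expR_ge1Dxn k (ltW (_ : 0 < t^-1)); rewrite invr_gt0 => /(_ t0) h.
have {}h : t^-1 ^+ k.+1 / k.+1`!%:R <= expR t^-1 by rewrite (le_trans _ h)// lerDr.
rewrite (@le_trans _ _ (k.+1`!%:R * t * (t^-1 ^+ k.+1 / k.+1`!%:R)))//.
  have F0 : k.+1`!%:R != 0 :> R by rewrite pnatr_eq0 -lt0n fact_gt0.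
  rewrite exprS; set X := _ ^+ k; move: F0; set F := _%:R => F0.
  by apply: eq_imp_le; field; rewrite F0 gt_eqF.
by rewrite ler_wpM2l// mulr_ge0// ltW.
Qed.

Lemma is_derive_flat k (t : R) :
  is_derive t (1 : R) (flat k) (- k%:R * flat k.+1 t + flat k.+2 t).
Proof.
have [t0|t0|->] := ltgtP t 0.
- have -> : - k%:R * flat k.+1 t + flat k.+2 t = 0.
    by rewrite /flat ltNge ltW//= mulr0 addr0.
  apply: (near_eq_is_derive _ (is_derive_cst (0 : R) t (1 : R))).
  near=> s; rewrite /flat ifF//; apply/negbTE; rewrite -leNgt.
  by near: s; move: (lt_nbhsl t0); apply: filterS => x; exact: ltW.
- have dV : is_derive t (1 : R) (fun s : R => s^-1) (- t ^- 2).
    have tn0 : t != 0 by rewrite gt_eqF.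
    apply: (is_derive_conv (is_deriveV tn0 (is_derive_id t 1))).
    by rewrite -[LHS]/(_ * _) mulr1.
  have dE : is_derive t (1 : R) (fun s => expR (- s^-1)) (t ^- 2 * expR (- t^-1)).
    apply: (is_derive_conv (is_derive1_comp (is_derive_expR _) (is_deriveN dV))).
    by rewrite opprK mulrC.
  have dX : is_derive t (1 : R) (fun s : R => s^-1 ^+ k) (- k%:R * t^-1 ^+ k.+1).
    elim: k => [|k IH]; first by rewrite oppr0 mul0r; exact: is_derive_cst.
    rewrite (_ : (fun _ => _) = (fun s : R => s^-1 * s^-1 ^+ k)); last first.
      by apply/funext => s; rewrite exprS.
    apply: (is_derive_conv (is_deriveM dV IH)).
    rewrite -![_ *: _]/(_ * _) !exprS !exprVn -natr1; field.
    by rewrite ?expf_neq0 gt_eqF.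
  have dF : is_derive t (1 : R) (fun s => s^-1 ^+ k * expR (- s^-1))
      (- k%:R * flat k.+1 t + flat k.+2 t).
    apply: (is_derive_conv (is_deriveM dX dE)).
    rewrite -![_ *: _]/(_ * _) /flat t0 !exprS !exprVn; field.
    by rewrite ?expf_neq0 gt_eqF.
  apply: (near_eq_is_derive _ dF).
  by near=> s; rewrite /flat ifT//; near: s; exact: lt_nbhsr.
- have f0 m : flat m 0 = 0 by rewrite /flat ltxx.
  rewrite !f0 mulr0 addr0; apply/is_deriveP.
  apply/cvgrPdist_le => /= e e0; have kf0 : 0 < k.+2`!%:R :> R by rewrite ltr0n fact_gt0.
  near=> h; have h0 : h != 0 by near: h; exact: nbhs_dnbhs_neq.
  rewrite addr0 f0 subr0 sub0r normrN.
  (* At the origin the difference quotient is again a member of the family, and [flat_le] makes it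
     tend to 0. *)
  have -> : h^-1 *: flat k h = flat k.+1 h.
    by rewrite /flat; case: ifP => _; rewrite ?scaler0// exprS -mulrA.
  rewrite ger0_norm ?flat_ge0// (le_trans (flat_le _ _))// mulrC -ler_pdivlMr//.
  by near: h; apply: dnbhs0_le; exact: divr_gt0.
Unshelve. all: by end_near. Qed.

Lemma cn_flat n k : cn n (flat k).
Proof.
elim: n k => [//|n IH] k; exists (fun t => - k%:R * flat k.+1 t + flat k.+2 t).
  exact: is_derive_flat.
by apply: cnD => //; exact: cnZ.
Qed.

Definition smoothstep (t : R) := flat 0 t / (flat 0 t + flat 0 (1 - t)).

Let den_gt0 t : 0 < flat 0 t + flat 0 (1 - t).
Proof.
have [t0|t0] := ltP 0 t; first by rewrite ltr_pwDl ?flat_gt0 ?flat_ge0.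
by rewrite ltr_wpDl ?flat_ge0 ?flat_gt0// subr_gt0 (le_lt_trans t0).
Qed.

Lemma cn_smoothstep n : cn n smoothstep.
Proof.
apply: cnM; first exact: cn_flat.
apply: cnV; first by move=> t; rewrite gt_eqF.
apply: cnD; first exact: cn_flat.
rewrite (_ : (fun t => flat 0 (1 - t)) = (fun t => flat 0 (-1 * t + 1))).
  by apply: cn_affine; exact: cn_flat.
by apply/funext => t; rewrite mulN1r addrC.
Qed.

Lemma smoothstep0 t : t <= 0 -> smoothstep t = 0.
Proof. by move=> t0; rewrite /smoothstep {1}/flat ltNge t0 mul0r. Qed.

Lemma smoothstep1 t : 1 <= t -> smoothstep t = 1.
Proof.
move=> t1; rewrite /smoothstep {3}/flat subr_gt0 ltNge t1 addr0 divff// gt_eqF//.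
by rewrite flat_gt0// (lt_le_trans _ t1).
Qed.

Lemma smoothstep_ge0 t : 0 <= smoothstep t.
Proof. by rewrite divr_ge0 ?flat_ge0// ltW. Qed.

Lemma smoothstep_le1 t : smoothstep t <= 1.
Proof. by rewrite ler_pdivrMr// mul1r lerDl flat_ge0. Qed.

Lemma smoothstep_derive : exists (f' : R -> R) (C : R), [/\ 0 < C,
  forall t, is_derive t (1 : R) smoothstep (f' t), continuous f',
  forall t, `|f' t| <= C & forall t, t < 0 \/ 1 < t -> f' t = 0].
Proof.
have [f' df [f'' df' _]] := cn_smoothstep 2.
have f'0 t : t < 0 \/ 1 < t -> f' t = 0.
  move=> t01; have [_ <-] := df t; apply: derive_val.
  case: t01 => t01; apply: (near_eq_is_derive _ (is_derive_cst (smoothstep t) t (1 : R))).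
  - near=> s; rewrite !smoothstep0 ?(ltW t01)//.
    by near: s; move: (lt_nbhsl t01); apply: filterS => x; exact: ltW.
  - near=> s; rewrite !smoothstep1 ?(ltW t01)//.
    by near: s; move: (lt_nbhsr t01); apply: filterS => x; exact: ltW.
have cf' : continuous f' by move=> t; exact: is_derive_cont (df' t).
have cnf' : {within `[0, 1], continuous (fun t => `|f' t|)}.
  by apply: continuous_subspaceT => t; apply: cvg_norm; exact: cf'.
have [c _ fc] := EVT_max (ler01 : 0 <= 1 :> R) cnf'.
exists f', (`|f' c| + 1); split => //.
move=> t; have [t0|t0] := ltP t 0; first by rewrite f'0 ?normr0 ?addr_ge0//; left.
have [t1|t1] := ltP 1 t; first by rewrite f'0 ?normr0 ?addr_ge0//; right.
by rewrite ler_wpDr// fc// in_itv/= t0.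
Unshelve. all: by end_near. Qed.

End SmoothFunctions.

(** * From the weak derivative to increments at Lebesgue points *)

Section WeakDerivative.
Variable R : realType.
Local Notation mu := (@lebesgue_measure R).
Implicit Types (s t : R).

Lemma Rintegral_support (D : set R) (f : R -> R) :
  (forall t, ~ D t -> f t = 0) -> \int[mu]_t f t = \int[mu]_(t in D) f t.
Proof.
move=> f0; rewrite [RHS]Rintegral_mkcond; congr (Rintegral _ _ _).
apply/funext => t; rewrite patchE; case: ifPn => // /negP Dt.
by apply: f0 => Dt'; apply: Dt; rewrite inE.
Qed.

Lemma continuous_measurable (f : R -> R) : continuous f -> measurable_fun setT f.
Proof. exact: continuous_measurable_fun. Qed.

Lemma Rintegral_derive_itv (F f : R -> R) a b : a < b ->
  (forall t, is_derive t (1 : R) F (f t)) -> continuous f ->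
  \int[mu]_(t in `[a, b]) f t = F b - F a.
Proof.
move=> ab dF cf; rewrite /Rintegral (@continuous_FTC2 R f F a b ab).
- by rewrite -EFinB.
- exact: continuous_subspaceT.
- have cF : continuous F by move=> t; exact: is_derive_cont (dF t).
  split; first by move=> t _; case: (dF t).
  + by apply: cvg_at_right_filter; exact: cF.
  + by apply: cvg_at_left_filter; exact: cF.
- by move=> t _; rewrite derive1E; case: (dF t).
Qed.

Lemma is_derive_affine (f f' : R -> R) (m s : R) :
  (forall t, is_derive t (1 : R) f (f' t)) ->
  forall t, is_derive t (1 : R) (fun x => f (m * (x - s))) (m * f' (m * (t - s))).
Proof.
move=> df t.
have da : is_derive t (1 : R) (fun x => m * (x - s)) m.
  apply: (is_derive_conv (is_deriveZ m (is_deriveB (is_derive_id t 1) (is_derive_cst s t 1)))).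
  by rewrite subr0 -[LHS]/(_ * _) mulr1.
by apply: (is_derive_conv (is_derive1_comp (df _) da)); rewrite mulrC.
Qed.

(** The kernels have integral 1 by the fundamental theorem of calculus, are at most of order n, and
    live in [s, s + 1 / (n + 1)]. The error is thus dominated by the mean of |f - f s| over a
    shrinking ball, which tends to 0 at a Lebesgue point. *)
Lemma lebesgue_pt_mollify (f : R -> R) (C : R) (th th' : R -> R) (Cth : R) s :
  measurable_fun setT f -> (forall t, `|f t| <= C) -> lebesgue_pt f s ->
  0 < Cth -> (forall t, is_derive t (1 : R) th (th' t)) -> continuous th' ->
  (forall t, `|th' t| <= Cth) -> (forall t, t < 0 \/ 1 < t -> th' t = 0) ->
  (forall t, t <= 0 -> th t = 0) -> (forall t, 1 <= t -> th t = 1) ->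
  \int[mu]_t (f t * (n.+1%:R * th' (n.+1%:R * (t - s)))) @[n --> \oo] --> f s.
Proof.
move=> mf fC fs C0 dth cth thC th0 th_0 th_1.
pose k (n : nat) t := n.+1%:R * th' (n.+1%:R * (t - s)).
have ck n : continuous (k n).
  move=> t; apply: cvgM; first exact: cvg_cst.
  apply: (@continuous_cvg _ _ _ _ _ _ th'); first exact: cth.
  by apply: cvgM; [exact: cvg_cst|apply: cvgB; [exact: cvg_id|exact: cvg_cst]].
have m0 (n : nat) : 0 < n.+1%:R :> R by rewrite ltr0n.
have k0 n t : ~ (s <= t <= s + n.+1%:R^-1) -> k n t = 0.
  move=> st; rewrite /k th0 ?mulr0//; have [ts|ts] := ltP t s.
    by left; rewrite pmulr_rlt0// subr_lt0.
  right; rewrite mulrC -ltr_pdivrMr// div1r ltrBrDl ltNge.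
  by apply/negP => ts'; apply: st; rewrite ts.
have kC n t : `|k n t| <= n.+1%:R * Cth.
  by rewrite normrM gtr0_norm// ler_wpM2l// ltW.
have mle1 (n : nat) : n.+1%:R^-1 <= 1 :> R by rewrite invf_le1// ler1n.
have k1 n t : ~ (s - 1 <= t <= s + 1) -> k n t = 0.
  move=> st; apply: k0 => /andP[a b]; apply: st; move: (mle1 n) a b.
  by set r := _^-1; clearbody r => ? ? ?; apply/andP; split; lra.
have i1 n : \int[mu]_t k n t = 1.
  rewrite (Rintegral_support (D := `[s - 1, s + 1]%classic)).
    rewrite (Rintegral_derive_itv _ (is_derive_affine (n.+1%:R) s dth) (ck n)).
      have m1 : 1 <= n.+1%:R :> R by rewrite ler1n.
      by rewrite th_1 ?th_0 ?subr0//; nra.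
    lra.
  by move=> t /= st; apply: k1 => ts; apply: st; rewrite in_itv /=.
have mk n : measurable_fun setT (k n) := continuous_measurable (ck n).
have kint n : mu.-integrable setT (EFin \o k n).
  apply: (@integrable_bounded R _ (s - 1) (s + 1) (n.+1%:R * Cth)) => // t.
  rewrite indicE; case: (boolP (t \in `[s - 1, s + 1]%classic)) => h; first by rewrite mulr1.
  by rewrite mulr0 k1 ?normr0// => ts; move/negP : h; apply; rewrite inE /= in_itv/=.
have fkint n : mu.-integrable setT (EFin \o (fun t => f t * k n t)).
  apply: (@integrable_bounded R _ (s - 1) (s + 1) (C * (n.+1%:R * Cth))).
    exact: measurable_funM.
  move=> t.
  rewrite indicE; case: (boolP (t \in `[s - 1, s + 1]%classic)) => h.
    by rewrite mulr1 normrM ler_pM.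
  by rewrite mulr0 k1 ?mulr0 ?normr0// => ts; move/negP : h; apply; rewrite inE /= in_itv/=.
(* Twice the width of the support, so that the open ball contains the closed support. The ball has
   measure 4 / (n + 1), whence the factor 4 * Cth against the height (n + 1) * Cth of the kernel. *)
pose rho (n : nat) : R := n.+1%:R^-1 *+ 2.
have key n : ((`|\int[mu]_t (f t * k n t) - f s|)%:E <= (4 * Cth)%:E * davg f s (rho n))%E.
  have -> : \int[mu]_t (f t * k n t) - f s = \int[mu]_t ((f t - f s) * k n t).
    under [RHS]eq_Rintegral do rewrite mulrBl.
    rewrite RintegralB//; last exact: (integrableZl measurableT (f s) (kint n)).
    by rewrite RintegralZl// i1 mulr1.
  have dkint : mu.-integrable setT (EFin \o (fun t => (f t - f s) * k n t)).
    apply: eq_integrable (integrableB measurableT (fkint n)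
      (integrableZl measurableT (f s) (kint n))) => // t _ /=.
    by rewrite mulrBl.
  rewrite EFin_normr_Rintegral//; apply: le_trans (le_abse_integral _ _ _) _ => //.
    by case/integrableP : dkint.
  have r0 : 0 <= rho n by rewrite mulrn_wge0// invr_ge0.
  rewrite /davg /iavg (lebesgue_measure_ball _ r0) inver ifF; last first.
    by rewrite /rho -mulrnA mulrn_eq0/= invr_eq0 gt_eqF.
  rewrite muleA -EFinM -ge0_integralZl//; first last.
  - by rewrite lee_fin !mulr_ge0// ?invr_ge0 ?mulrn_wge0// ltW.
  - apply/measurable_EFinP/measurable_funTS; apply: measurableT_comp => //.
    by apply: measurable_funB.
  - exact: measurable_ball.
  rewrite [leRHS]integral_mkcond; apply: ge0_le_integral => //.
  - by apply/measurable_EFinP/measurableT_comp => //; case/integrableP : dkint => /measurable_EFinP.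
  - apply/(measurable_restrictT _ _).1; first exact: measurable_ball.
    apply/measurable_EFinP/measurable_funTS/measurable_funM => //.
    by apply: measurableT_comp => //; exact: measurable_funB.
  move=> t _; rewrite patchE /=; case: ifPn => tb; last first.
    rewrite k0 ?mulr0 ?normr0// => st; move/negP: tb; apply; rewrite inE ball_itv /= in_itv/=.
    have : 0 < n.+1%:R^-1 :> R by rewrite invr_gt0.
    by move: st; rewrite /rho; set r := _^-1; rewrite mulr2n; lra.
  rewrite -EFinM lee_fin normrM mulrC ler_wpM2r//.
  rewrite (le_trans (kC n t))// /rho -mulrnA -[_ *+ (2 * 2)]mulr_natl invfM invrK.
  by apply: eq_imp_le; field.
have davg0 : forall e : R, 0 < e -> \forall n \near \oo, (davg f s (rho n) <= e%:E)%E.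
  move=> e e0; have := fs => /fine_cvgP[fin fs0].
  have rho0 : rho n @[n --> \oo] --> (0 : R)^'+.
    have h0 : rho n @[n --> \oo] --> (0 : R).
      by rewrite -(mul0rn R 2); apply: cvgMn; exact: cvg_harmonic.
    move=> A [d /= d0 dA]; have h1 : \forall n \near \oo, ball 0 d (rho n) := h0 _ (nbhsx_ballx _ _ d0).
    rewrite /nbhs /= /fmap /=; apply: filterS h1 => n nd; apply: dA => //.
    by rewrite /rho mulrn_wgt0// invr_gt0.
  move/cvgrPdist_le : fs0 => /(_ e e0) fs0.
  have h1 : \forall n \near \oo, davg f s (rho n) \is a fin_num := rho0 _ fin.
  have h2 : \forall n \near \oo, `|0 - fine (davg f s (rho n))| <= e := rho0 _ fs0.
  apply: filterS2 h1 h2 => n h2; rewrite sub0r normrN => h1.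
  by rewrite -(fineK h2) lee_fin (le_trans (ler_norm _) h1).
apply/cvgrPdist_le => e e0.
have c4 : 0 < e / (4 * Cth) by rewrite divr_gt0 ?mulr_gt0.
have := davg0 _ c4; apply: filterS => n h; rewrite distrC -lee_fin.
apply: le_trans (key n) _.
apply: le_trans (lee_wpmul2l _ h) _; first by rewrite lee_fin mulr_ge0// ltW.
by rewrite -EFinM lee_fin mulrC divfK// gt_eqF// mulr_gt0.
Unshelve. all: by end_near. Qed.

Lemma mollifier_le (th' : R -> R) (Cth : R) s n t :
  (forall t, `|th' t| <= Cth) -> (forall t, t < 0 \/ 1 < t -> th' t = 0) ->
  `|n.+1%:R * th' (n.+1%:R * (t - s))| <= n.+1%:R * Cth * \1_`[s, (s + 1)] t.
Proof.
move=> thC th0; have m0 : 0 < n.+1%:R :> R by rewrite ltr0n.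
rewrite indicE; case: (boolP (t \in `[s, s + 1]%classic)) => h.
  by rewrite mulr1 normrM gtr0_norm// ler_wpM2l// ltW.
rewrite th0 ?mulr0 ?normr0//; have [ts|ts] := ltP t s.
  by left; rewrite pmulr_rlt0// subr_lt0.
right; rewrite mulrC -ltr_pdivrMr// div1r ltrBrDl ltNge.
apply/negP => ts'; move/negP : h; apply; rewrite inE /= in_itv/= ts/=.
by rewrite (le_trans ts')// lerD2l invf_le1// ler1n.
Qed.

(* Tested against smooth approximations of the indicator of [s, t]. *)
Lemma weak_derivative_pt (f g : R -> R) (C : R) s t :
  measurable_fun setT f -> measurable_fun setT g ->
  (forall x, `|f x| <= C) -> (forall x, `|g x| <= C) ->
  (forall psi psi' : R -> R, (forall n, cn n psi) ->
    (forall x, is_derive x (1 : R) psi (psi' x)) ->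
    (exists a b, 0 < a /\ forall x, x < a \/ b < x -> psi x = 0) ->
    \int[mu]_(x in `]0, +oo[) (f x * psi' x) = - \int[mu]_(x in `]0, +oo[) (g x * psi x)) ->
  0 < s -> s <= t -> lebesgue_pt f s -> lebesgue_pt f t ->
  f t - f s = prim g t - prim g s.
Proof.
move=> mf mg fC gC fg s0 st fs ft.
have [th' [Cth [Cth0 dth cth thC th0]]] := smoothstep_derive R.
pose th := @smoothstep R; have t0 := lt_le_trans s0 st.
pose psi (n : nat) x := th (n.+1%:R * (x - s)) - th (n.+1%:R * (x - t)).
pose psi' (n : nat) x := n.+1%:R * th' (n.+1%:R * (x - s)) - n.+1%:R * th' (n.+1%:R * (x - t)).
have m0 (n : nat) : 0 < n.+1%:R :> R by rewrite ltr0n.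
have psi0 n x : x < s \/ t + 1 < x -> psi n x = 0.
  rewrite /psi => -[xs|tx].
    by rewrite /th !smoothstep0 ?subr0// pmulr_rle0// subr_le0 ltW// (lt_le_trans xs).
  have m1 : 1 <= n.+1%:R :> R by rewrite ler1n.
  by rewrite /th !smoothstep1 ?subrr//; nra.
have cpsi n m : cn m (psi n).
  have aff (a : R) : cn m (fun x => th (n.+1%:R * (x - a))).
    rewrite (_ : (fun _ => _) = (fun x => th (n.+1%:R * x + (- (n.+1%:R * a))))).
      by apply: cn_affine; exact: cn_smoothstep.
    by apply/funext => x; rewrite mulrBr.
  apply: cnD => //.
  rewrite (_ : (fun _ => _) = (fun x => -1 * th (n.+1%:R * (x - t)))).
    by apply: cnZ.
  by apply/funext => x; rewrite mulN1r.
have dpsi n x : is_derive x (1 : R) (psi n) (psi' n x).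
  by apply: is_deriveB; exact: is_derive_affine.
have psi'0 n x : x <= 0 -> psi' n x = 0.
  move=> x0; rewrite /psi' !th0 ?mulr0 ?subrr//; left; rewrite pmulr_rlt0// subr_lt0;
  by rewrite (le_lt_trans x0).
have fint (a : R) n : mu.-integrable setT (EFin \o (fun x => f x * (n.+1%:R * th' (n.+1%:R * (x - a))))).
  apply: (@integrable_bounded R _ a (a + 1) (C * (n.+1%:R * Cth))).
    apply: measurable_funM => //; apply: continuous_measurable => x.
    apply: cvgM; first exact: cvg_cst.
    apply: (@continuous_cvg _ _ _ _ _ _ th'); first exact: cth.
    by apply: cvgM; [exact: cvg_cst|apply: cvgB; [exact: cvg_id|exact: cvg_cst]].
  move=> x; rewrite normrM -mulrA ler_pM//; exact: mollifier_le.
(* The derivative of the test function is a mollifier at s minus a mollifier at t, and both points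
   are Lebesgue points of [f]. *)
have lhs : \int[mu]_x (f x * psi' n x) @[n --> \oo] --> f s - f t.
  under eq_fun => n.
    under eq_Rintegral do rewrite mulrBr.
    rewrite RintegralB//.
    over.
  by apply: cvgB; apply: (lebesgue_pt_mollify mf fC _ Cth0 dth cth thC th0 (@smoothstep0 R) (@smoothstep1 R)).
have mpsi n : measurable_fun setT (psi n).
  by apply: continuous_measurable => x; exact: is_derive_cont (dpsi n x).
have rhs : \int[mu]_x (g x * psi n x) @[n --> \oo] --> \int[mu]_x (g x * \1_`]s, t] x).
  apply: (@Rintegral_dominated R _ _ s (t + 1) C).
  - by move=> n; exact: measurable_funM.
  - by apply: measurable_funM => //; exact: measurable_indic.
  - apply: lebesgue_aeW => x; apply: cvgM; first exact: cvg_cst.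
    have thl (a : R) : th (n.+1%:R * (x - a)) @[n --> \oo] --> (if a < x then 1 else 0 : R).
      have [ax|ax] := ltP a x; last first.
        apply: cvg_near_cst; apply: nearW => n; rewrite /th smoothstep0//.
        by rewrite pmulr_rle0// subr_le0.
      apply: cvg_near_cst; near=> n; rewrite /th smoothstep1// -ler_pdivrMr ?subr_gt0// div1r.
      rewrite (@le_trans _ _ n%:R)//; last by rewrite ler_nat.
      by near: n; exact: nbhs_infty_ger.
    have -> : \1_`]s, t] x = (if s < x then 1 else 0) - (if t < x then 1 else 0) :> R.
      rewrite indicE mem_setE in_itv/=; have [sx|sx] := ltP s x.
        by case: (ltP t x) => //=; rewrite ?subrr ?subr0.
      by rewrite ltNge (le_trans sx st) subrr.
    by apply: cvgB; exact: thl.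
  - apply: lebesgue_aeW => x n; rewrite normrM ler_pM// indicE mem_setE in_itv/=.
    have [xs|xs] := ltP x s; first by rewrite psi0 ?normr0//; left.
    have [xt|xt] := ltP (t + 1) x; first by rewrite psi0 ?normr0//; right.
    rewrite /psi ler_norml; have := smoothstep_ge0 (n.+1%:R * (x - s)).
    have := smoothstep_ge0 (n.+1%:R * (x - t)).
    have := smoothstep_le1 (n.+1%:R * (x - s)); have := smoothstep_le1 (n.+1%:R * (x - t)).
    by rewrite -/th /=; lra.
have E n : \int[mu]_x (f x * psi' n x) = - \int[mu]_x (g x * psi n x).
  rewrite !(Rintegral_support (D := `]0, +oo[%classic)).
  - apply: fg => //; exists s, (t + 1); split => // x; exact: psi0.
  - move=> x /= /negP; rewrite in_itv/= andbT -leNgt => x0.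
    by rewrite psi0 ?mulr0//; left; exact: le_lt_trans s0.
  - move=> x /= /negP; rewrite in_itv/= andbT -leNgt => x0.
    by rewrite psi'0 ?mulr0.
have {}lhs : (fun n => - \int[mu]_x (g x * psi n x)) @ \oo --> f s - f t.
  by under eq_fun do rewrite -E.
have Eq : f s - f t = - \int[mu]_x (g x * \1_`]s, t] x).
  by apply: (cvg_unique _ lhs); [exact: Rhausdorff|exact: cvgN].
rewrite -[LHS]opprB Eq opprK (primB mg gC) ?(ltW s0)// [RHS]Rintegral_mkcond.
congr (Rintegral _ _ _); apply/funext => x; rewrite patchE indicE.
by case: ifP => _; rewrite ?mulr1 ?mulr0.
Unshelve. all: by end_near. Qed.

End WeakDerivative.

Lemma lebesgue_ae_exists (R : realType) (P : R -> Prop) (a b : R) :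
  {ae @lebesgue_measure R, forall t, P t} -> a < b ->
  exists2 t, a < t < b & P t.
Proof.
move=> [B [mB B0 BP]] ab; apply: contrapT => noP.
have : (lebesgue_measure (`]a, b[%classic : set R) <= lebesgue_measure B)%E.
  apply: le_measure; rewrite ?inE//.
  move=> t /=; rewrite in_itv/= => tab; apply: BP => Pt; apply: noP.
  by exists t.
rewrite [X in (_ <= X)%E]B0 lebesgue_measure_itv/= lte_fin ab -EFinB lee_fin subr_le0.
by rewrite leNgt ab.
Qed.

(** * A bounded representative solving the integrated equation *)

Section Representative.
Variables (R : realType) (H : completeNormedModType R).
Local Notation mu := (@lebesgue_measure R).
Variable ip : {dot H for (idfun : R -> R)}.
Hypothesis hip : hilbert_inner ip.
Hypothesis sepH : separable_space H.
Variable A : {linear H -> H}.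
Hypothesis contA : continuous A.

Lemma opnorm_le h : `|A h| <= fine (opnorm A) * `|h|.
Proof.
have [C [C0 AC]] : exists C : R, 0 < C /\ forall h, `|A h| <= C * `|h|.
  have /linear_boundedP [M [_ AM]] : bounded_near A (nbhs (0 : H)).
    exact/continuous_linear_bounded/contA.
  exists (`|M| + 1); split; first by rewrite ltr_wpDl.
  by apply: AM; rewrite (le_lt_trans (ler_norm _))// ltrDl.
have ub z : `|z| <= 1 -> (`|A z|%:E <= opnorm A)%E.
  by move=> z1; apply: ereal_sup_ubound; exists z.
have fin : opnorm A \is a fin_num.
  rewrite fin_numE; apply/andP; split.
    by rewrite gt_eqF// (lt_le_trans (ltNyr _) (ub 0 _))// normr0.
  rewrite lt_eqF// (@le_lt_trans _ _ C%:E) ?ltry//.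
  apply: ge_ereal_sup => _ [z /= z1 <-]; rewrite lee_fin (le_trans (AC z))//.
  by rewrite ler_piMr// ltW.
have [->|h0] := eqVneq h 0; first by rewrite linear0 !normr0 mulr0.
have ph : 0 < `|h| by rewrite normr_gt0.
have := ub (`|h|^-1 *: h); rewrite linearZ /= !normrZ normfV normr_id.
rewrite mulVf ?gt_eqF// => /(_ (lexx _)); rewrite -{1}(fineK fin) lee_fin.
by rewrite ler_pdivrMl// mulrC.
Qed.

Lemma opnorm_ge0 : 0 <= fine (opnorm A).
Proof.
rewrite fine_ge0//; apply: (@le_trans _ _ (`|A 0|%:E)) => //.
by apply: ereal_sup_ubound; exists 0 => //=; rewrite normr0.
Qed.

(** Pairing with vectors avoids integrals of vector-valued functions. The exceptional set is a
    parameter because it grows when differences are taken, and it becomes empty once a continuous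
    representative is available. *)
Definition weak_sol (N : set R) (u w : R -> H) := forall s t q,
  0 < s -> 0 < t -> ~ N s -> ~ N t ->
  ip (A (u t)) q - ip (A (u s)) q =
    prim (fun x => ip (w x) q) t - prim (fun x => ip (w x) q) s.

Variable G : H -> H.
Hypothesis lipG : forall u v, `|G u - G v| <= 4^-1 * `|u - v|.
Hypothesis G0 : G 0 = 0.

Lemma lip_continuous : continuous G.
Proof.
move=> z; apply/cvgrPdist_le => /= e e0; near=> y.
rewrite (le_trans (lipG _ _))//.
have : `|z - y| <= e by near: y; apply: cvgr_dist_le; [exact: cvg_id|].
by have := normr_ge0 (z - y); lra.
Unshelve. all: by end_near. Qed.

Definition rhs (u : H) := - u + G u.

Lemma rhs_le u : `|rhs u| <= 2 * `|u|.
Proof.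
rewrite (le_trans (ler_normD _ _))// normrN.
have := lipG u 0; rewrite G0 !subr0; have := normr_ge0 u; lra.
Qed.

Lemma rhs_continuous : continuous rhs.
Proof. by move=> u; apply: cvgD; [apply: cvgN; exact: cvg_id|exact: lip_continuous]. Qed.

Lemma hmeas_rhs u : hmeas u -> hmeas (fun t => rhs (u t)).
Proof. by move=> mu; apply: (hmeas_comp (phi := rhs)) => //; exact: rhs_continuous. Qed.

Lemma hmeasurable_patch (x : R -> H) (E : set R) : hmeasurable x ->
  measurable E -> E `<=` `]0, +oo[ -> hmeas (fun t => if t \in E then x t else 0).
Proof.
move=> mx mE E0 U oU; rewrite (_ : _ @^-1` _ =
    (E `&` (`]0, +oo[ `&` x @^-1` U)) `|` (~` E `&` (fun=> 0) @^-1` U)).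
  apply: measurableU; apply: measurableI => //; last exact: hmeas_cst.
    by apply: mx => //; apply: sub_gen_smallest.
  exact: measurableC.
apply/seteqP; split => t /=.
  case: ifPn => [/set_mem Et Ut|nE U0]; last by right; split => // Et; rewrite mem_set in nE.
  by left; split => //; split => //; exact: E0.
move=> [[Et [_ Ut]]|[nE U0]]; first by rewrite mem_set.
by rewrite memNset.
Qed.

Lemma Linf_norm_ae (x : R -> H) : Linf x ->
  {ae mu, forall t, 0 < t -> `|x t| <= fine (Linf_norm x)}.
Proof.
move=> [mx]; rewrite /Linf_norm; set m := mrestr _ _.
have := @ess_sup_ge _ _ R m (fun t => (`|x t|)%:E).
move=> [B [mB B0 BP]] fin; exists (B `&` `]0, +oo[); split.
- exact: measurableI.
- exact: B0.
- move=> t /= /not_implyP[t0 xt]; split; last by rewrite in_itv/= andbT.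
  apply: BP => /= h; apply: xt; rewrite -lee_fin (le_trans h)//.
  move: fin h; case: (ess_sup _ _) => //=; by rewrite leeNy_eq.
Qed.

(** [X] is 0 wherever |x| exceeds its essential supremum, so it is bounded at every point. Test
    functions of the form psi *: d k, with [d] dense, reduce the equation to countably many scalar
    ones, and [N] collects the points that fail to be Lebesgue points for one of them. *)
Lemma solution_representative (x : R -> H) :
  weak_L2loc_solution ip A G x -> Linf x ->
  exists X N, [/\ hmeas X, forall t, `|X t| <= fine (Linf_norm x),
    mu.-negligible N, {ae mu, forall t, 0 < t -> X t = x t} &
    weak_sol N X (fun t => rhs (X t))].
Proof.
move=> [[mx _] _ [v [[mv _] wd vx]]] xoo; have [_ xfin] := xoo.
set M := fine (Linf_norm x).
pose D : set R := `]0, +oo[%classic.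
have mD : measurable D by exact: measurable_itv.
pose x0 t := if t \in D then x t else 0.
pose v0 t := if t \in D then v t else 0.
have mx0 : hmeas x0 by exact: hmeasurable_patch.
have mv0 : hmeas v0 by exact: hmeasurable_patch.
pose E := D `&` [set t | `|x0 t| <= M].
have mE : measurable E.
  apply: measurableI => //.
  have mn := hmeas_norm mx0.
  have := mn measurableT `]-oo, M]%classic (measurable_itv _).
  by rewrite setTI; congr measurable; apply/seteqP; split => t /=; rewrite in_itv.
have M0 : 0 <= M.
  have [t /andP[t0 _]] := lebesgue_ae_exists (Linf_norm_ae xoo) (ltr01 : 0 < 1 :> R).
  by move=> /(_ t0); exact: le_trans.
pose X t := if t \in E then x0 t else 0.
have mX : hmeas X by exact: hmeas_patch.
have XM t : `|X t| <= M.
  by rewrite /X; case: ifPn => [/set_mem[]//|_]; rewrite normr0.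
have Xx0 : {ae mu, forall t, X t = x0 t}.
  apply: lebesgue_aeS (Linf_norm_ae xoo) => t xM; rewrite /X.
  case: ifPn => // /negP nE; rewrite /x0; case: ifPn => // tD.
  case: nE; rewrite inE; split; first exact/set_mem.
  by rewrite /= /x0 tD; apply: xM; move/set_mem : tD; rewrite /D /= in_itv/= andbT.
have inD t : 0 < t -> t \in D by move=> t0; rewrite inE /D /= in_itv/= t0.
have Xx : {ae mu, forall t, 0 < t -> X t = x t}.
  by apply: lebesgue_aeS Xx0 => t -> t0; rewrite /x0 inD.
pose W t := rhs (X t).
have mW : hmeas W by exact: hmeas_rhs.
have WM t : `|W t| <= 2 * M by rewrite (le_trans (rhs_le _))// ler_pM2l.
have Wv0 : {ae mu, forall t, D t -> W t = v0 t}.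
  apply: lebesgue_aeS (lebesgue_aeI Xx vx) => t [Xt vt] Dt.
  have t0 : 0 < t by move: Dt; rewrite /D /= in_itv/= andbT.
  by rewrite /v0 inD// vt// /W /rhs Xt.
have [d dd] := dense_seq sepH.
pose a := fine (opnorm A); have a0 : 0 <= a by exact: opnorm_ge0.
have mAX : hmeas (A \o X) by apply: hmeas_comp.
have mf q : measurable_fun setT (fun t => ip (A (X t)) q).
  by apply: (hmeas_ip sepH hip mAX (hmeas_cst q)).
have mg q : measurable_fun setT (fun t => ip (W t) q).
  by apply: (hmeas_ip sepH hip mW (hmeas_cst q)).
(* A single constant serves both pairings, as |A X| <= a M and |W| <= 2 M. *)
have fC q t : `|ip (A (X t)) q| <= (a + 2) * M * `|q|.
  rewrite (le_trans (ip_norm hip _ _))// ler_wpM2r// (le_trans (opnorm_le _))//.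
  rewrite -/a (@le_trans _ _ (a * M))//; first by rewrite ler_wpM2l.
  by rewrite ler_wpM2r// lerDl.
have gC q t : `|ip (W t) q| <= (a + 2) * M * `|q|.
  rewrite (le_trans (ip_norm hip _ _))// ler_wpM2r// (le_trans (WM _))//.
  by rewrite ler_wpM2r// lerDr.
pose N := ~` [set t | forall k, lebesgue_pt (fun t => ip (A (X t)) (d k)) t].
have N0 : mu.-negligible N.
  have : {ae mu, forall t, forall k, [set: nat] k -> lebesgue_pt (fun t => ip (A (X t)) (d k)) t}.
    apply: lebesgue_ae_countable => [|k _]; first exact: countableP.
    exact: ae_lebesgue_pt (mf (d k)) (fC (d k)).
  by apply: lebesgue_aeS => t h k; exact: h.
have test k (psi psi' : R -> R) : (forall n, cn n psi) ->
    (forall x, is_derive x (1 : R) psi (psi' x)) ->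
    (exists a b, 0 < a /\ forall x, x < a \/ b < x -> psi x = 0) ->
    \int[mu]_(x in D) (ip (A (X x)) (d k) * psi' x) =
    - \int[mu]_(x in D) (ip (W x) (d k) * psi x).
  move=> cpsi dpsi [b [c [b0 psi0]]].
  have dphi t : is_derive t (1 : R) (fun t => psi t *: d k) (psi' t *: d k).
    exact: is_derive_scalel.
  have mpsi : measurable_fun setT psi.
    by apply: continuous_measurable => t; exact: is_derive_cont (dpsi t).
  have mpsi' : measurable_fun setT psi'.
    have [f' df' [f'' df'' _]] := cpsi 2; apply: continuous_measurable => t.
    suff -> : psi' = f' by exact: is_derive_cont (df'' t).
    by apply/funext => y; case: (dpsi y) => _ <-; case: (df' y).
  have := wd (fun t => psi t *: d k); rewrite (cn_derive1 dphi) => wd'.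
  have {}wd' := wd' _.
  have aeX (f h : R -> R) : measurable_fun setT f -> measurable_fun setT h ->
      {ae mu, forall t, D t -> f t = h t} -> \int[mu]_(x in D) f x = \int[mu]_(x in D) h x.
    move=> mf' mh fh; congr fine; apply: ae_eq_integral => //.
    - by apply/measurable_EFinP/measurable_funTS.
    - by apply/measurable_EFinP/measurable_funTS.
    - by apply: lebesgue_aeS fh => t fh Dt /=; rewrite fh.
  have mAx0 : hmeas (A \o x0) by apply: hmeas_comp.
  have -> : \int[mu]_(x in D) (ip (A (X x)) (d k) * psi' x) =
      \int[mu]_(x in D) (ip (A (x0 x)) (d k) * psi' x).
    apply: aeX; first exact: measurable_funM.
      by apply: measurable_funM => //; exact: (hmeas_ip sepH hip mAx0 (hmeas_cst (d k))).
    by apply: lebesgue_aeS Xx0 => t -> _.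
  have -> : \int[mu]_(x in D) (ip (W x) (d k) * psi x) =
      \int[mu]_(x in D) (ip (v0 x) (d k) * psi x).
    apply: aeX; first exact: measurable_funM.
      by apply: measurable_funM => //; exact: (hmeas_ip sepH hip mv0 (hmeas_cst (d k))).
    by apply: lebesgue_aeS Wv0 => t h Dt; rewrite h.
  transitivity (\int[mu]_(t in D) ip ((A \o x) t) (psi' t *: d k)).
    by apply: eq_Rintegral => t tD; rewrite /x0 tD ipZr mulrC.
  rewrite wd'; last first.
    split; first by move=> m t _; apply: cn_derivable; exact: cn_scalel.
    exists `[b, c]%classic; split; first exact: segment_compact.
      by move=> t /=; rewrite !in_itv/= => /andP[bt _]; rewrite (lt_le_trans b0 bt).
    move=> t /= /negP; rewrite in_itv/= negb_and -!ltNge => bc.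
    by rewrite psi0 ?scale0r//; apply/orP.
  by congr (- _); apply: eq_Rintegral => t tD; rewrite /v0 tD ipZr mulrC.
have ptk s t k : 0 < s -> s <= t -> ~ N s -> ~ N t ->
    ip (A (X t)) (d k) - ip (A (X s)) (d k) =
    prim (fun x => ip (W x) (d k)) t - prim (fun x => ip (W x) (d k)) s.
  move=> s0 st /contrapT Ns /contrapT Nt.
  exact: (weak_derivative_pt (mf (d k)) (mg (d k)) (fC (d k)) (gC (d k)) (@test k)).
exists X, N; split => // s t q s0 t0; wlog st : s t s0 t0 / s <= t.
  move=> wl Ns Nt; case/orP: (le_total s t) => st; first exact: wl.
  by apply: oppr_inj; rewrite !opprB; exact: wl.
move=> Ns Nt; apply/eqP; rewrite -subr_eq0 -normr_le0; apply/ler_addgt0Pl => e e0.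
(* Replacing [q] by [d k] changes the left side by at most 2 c |q - d k| and the primitives by at
   most c |t - s| |q - d k|. The summand 1 keeps [L] positive. *)
rewrite addr0; pose c := (a + 2) * M; pose L := 2 * c + c * `|t - s| + 1.
have c0 : 0 <= c by rewrite mulr_ge0// addr_ge0.
have L0 : 0 < L.
  have h := mulr_ge0 c0 (normr_ge0 (t - s)).
  by rewrite /L; clearbody c; lra.
have [k qk] := dd q (e / L) (divr_gt0 e0 L0).
have primBq z : prim (fun x => ip (W x) q) z - prim (fun x => ip (W x) (d k)) z =
    prim (fun x => ip (W x) (q - d k)) z.
  rewrite /prim -RintegralB//.
  - by apply: eq_Rintegral => y _; rewrite ipBr.
  - exact: integrable_bounded_itv (mg q) (gC q).
  - exact: integrable_bounded_itv (mg (d k)) (gC (d k)).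
rewrite -[prim _ t]/(prim (fun x => ip (W x) q) t) -[prim _ s]/(prim (fun x => ip (W x) q) s).
rewrite -[X in `|X|]subr0 -(subrr (ip (A (X t)) (d k) - ip (A (X s)) (d k))).
rewrite {2}(ptk _ _ _ s0 st Ns Nt).
rewrite (_ : _ - _ = (ip (A (X t)) (q - d k) - ip (A (X s)) (q - d k))
   - (prim (fun x => ip (W x) (q - d k)) t - prim (fun x => ip (W x) (q - d k)) s)); last first.
  by rewrite -!primBq// !ipBr; ring.
rewrite (le_trans (ler_normB _ _))// (@le_trans _ _ (L * `|q - d k|))//; last first.
  by rewrite mulrC -ler_pdivlMr// ltW.
rewrite /L !mulrDl mul1r -addrA lerD//.
  by rewrite (le_trans (ler_normB _ _))// lerD.
rewrite ler_wpDr ?mul1r// mulrAC; apply: (prim_lipschitz (mg _) (gC _)); exact: ltW.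
Qed.

End Representative.

Lemma cvg0_norm_lt (R : realType) (h : nat -> R) (t : R) :
  h n @[n --> \oo] --> 0 -> 0 < t -> \forall n \near \oo, `|h n| < t.
Proof.
move=> /cvgrPdist_lt h0 /h0; apply: filterS => n.
by rewrite sub0r normrN.
Qed.

(** * Energy estimates *)

Section EnergyIdentity.
Variables (R : realType) (H : completeNormedModType R).
Local Notation mu := (@lebesgue_measure R).
Variable ip : {dot H for (idfun : R -> R)}.
Hypothesis hip : hilbert_inner ip.
Hypothesis sepH : separable_space H.
Variable A : {linear H -> H}.
Hypothesis contA : continuous A.
Hypothesis symA : self_adjoint ip A.
Implicit Types (u w : R -> H).

Lemma hmeas_ip_cst u q : hmeas u -> measurable_fun setT (fun t => ip (u t) q).
Proof. by move=> mu'; exact: (hmeas_ip sepH hip mu' (hmeas_cst q)). Qed.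

Lemma ip_bound u (V : R) q : (forall t, `|u t| <= V) ->
  forall t, `|ip (u t) q| <= V * `|q|.
Proof.
by move=> uV t; rewrite (le_trans (ip_norm hip _ _))// ler_wpM2r.
Qed.

Lemma primBr w V p q t : hmeas w -> (forall t, `|w t| <= V) ->
  prim (fun x => ip (w x) p) t - prim (fun x => ip (w x) q) t =
  prim (fun x => ip (w x) (p - q)) t.
Proof.
move=> mw wV; rewrite /prim -RintegralB//.
- by apply: eq_Rintegral => y _; rewrite ipBr.
- exact: integrable_bounded_itv (hmeas_ip_cst p mw) (ip_bound p wV).
- exact: integrable_bounded_itv (hmeas_ip_cst q mw) (ip_bound q wV).
Qed.

Lemma prim_ip_lipschitz w V q s t : hmeas w -> (forall t, `|w t| <= V) ->
  0 <= s -> 0 <= t ->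
  `|prim (fun x => ip (w x) q) t - prim (fun x => ip (w x) q) s| <= V * `|q| * `|t - s|.
Proof.
by move=> mw wV; exact: prim_lipschitz (hmeas_ip_cst q mw) (ip_bound q wV).
Qed.

(** The quotients are Lipschitz in [q] with constant [V], uniformly in [n], so Lebesgue points for
    the countably many [d k] serve every [q]. This allows a [q] that depends on [t], such as
    [u t]. *)
Lemma weak_quotient w V (d : nat -> H) t (h : nat -> R) q :
  hmeas w -> (forall t, `|w t| <= V) ->
  (forall (z : H) (e : R), 0 < e -> exists k, `|z - d k| < e) ->
  0 < t -> (forall k, lebesgue_pt (fun x => ip (w x) (d k)) t) ->
  (forall n, h n != 0) -> h n @[n --> \oo] --> 0 ->
  (h n)^-1 * (prim (fun x => ip (w x) q) (t + h n) - prim (fun x => ip (w x) q) t)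
    @[n --> \oo] --> ip (w t) q.
Proof.
move=> mw wV dd t0 tL hn0 h0; apply/cvgrPdist_le => e e0.
have V0 : 0 <= V := le_trans (normr_ge0 _) (wV 0).
have e4 : 0 < e / (2 * V + 1) / 2 by rewrite !divr_gt0// ltr_wpDl// mulr_ge0.
have [k qk] := dd q _ e4.
have := lebesgue_pt_quotient (hmeas_ip_cst (d k) mw) (ip_bound (d k) wV) t0 (tL k) hn0 h0.
have e2 : 0 < e / 2 by rewrite divr_gt0.
move=> /cvgrPdist_le /(_ _ e2) hk.
near=> n.
have tn : 0 <= t + h n.
  have : `|h n| < t by near: n; exact: cvg0_norm_lt.
  by rewrite ltr_norml => /andP[? _]; lra.
have hk' : `|ip (w t) (d k) - (h n)^-1 *
   (prim (fun x => ip (w x) (d k)) (t + h n) - prim (fun x => ip (w x) (d k)) t)| <= e / 2.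
  by near: n.
have E : ip (w t) q - (h n)^-1 * (prim (fun x => ip (w x) q) (t + h n) - prim (fun x => ip (w x) q) t)
   = ip (w t) (q - d k) - (h n)^-1 * (prim (fun x => ip (w x) (q - d k)) (t + h n)
       - prim (fun x => ip (w x) (q - d k)) t) +
    (ip (w t) (d k) - (h n)^-1 *
   (prim (fun x => ip (w x) (d k)) (t + h n) - prim (fun x => ip (w x) (d k)) t)).
  by rewrite -!(primBr _ _ _ mw wV) ipBr; ring.
rewrite E (le_trans (ler_normD _ _))// (splitr e) lerD//.
rewrite (le_trans (ler_normB _ _))//.
rewrite (@le_trans _ _ ((2 * V) * `|q - d k|))//.
  rewrite (_ : 2 * V * _ = V * `|q - d k| + V * `|q - d k|); last by ring.
  rewrite lerD ?ip_bound// normrM normfV ler_pdivrMl ?normr_gt0//.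
  rewrite (le_trans (prim_ip_lipschitz _ mw wV _ _)) ?(ltW t0)//.
  by rewrite [leLHS]mulrC (addrC t) addrK.
rewrite (@le_trans _ _ ((2 * V + 1) * `|q - d k|))//; first by rewrite ler_wpM2r// lerDl.
rewrite mulrC -ler_pdivlMr ?ltr_wpDl ?mulr_ge0//.
by rewrite ltW// mulrAC.
Unshelve. all: by end_near. Qed.

Lemma weight_lipschitz (f f' : R -> R) (L : R) s t :
  (forall x, is_derive x (1 : R) f (f' x)) -> (forall x, `|f' x| <= L) ->
  `|f t - f s| <= L * `|t - s|.
Proof.
move=> df fL; wlog st : s t / s <= t.
  move=> W; case/orP: (le_total s t) => st; first exact: W.
  by rewrite distrC (distrC t); exact: W.
have [|x _ ->] := @MVT_segment R f f' s t st (fun x _ => df x).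
  by apply: continuous_subspaceT => x; exact: is_derive_cont (df x).
by rewrite normrM ler_wpM2r.
Qed.

(** Formally this is integration by parts of k <Au, u>, but only A u has a weak derivative. Symmetry
    of [A] gives, for u' = u (t + h), the exact identity <Au', u'> - <Au, u> = <Au' - Au, u> + <Au'
    - Au, u'>, in which difference quotients fall on A u alone. *)
Lemma energy_identity N u w (U V : R) (k k' : R -> R) (al be L : R) :
  hmeas u -> hmeas w -> (forall t, `|u t| <= U) -> (forall t, `|w t| <= V) ->
  mu.-negligible N -> weak_sol ip A N u w ->
  0 < al -> (forall t, is_derive t (1 : R) k (k' t)) -> continuous k' ->
  (forall t, `|k' t| <= L) -> (forall t, t < al \/ be < t -> k t = 0) ->
  \int[mu]_t (k' t * ip (A (u t)) (u t)) = - 2 * \int[mu]_t (k t * ip (w t) (u t)).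
Proof.
move=> mu' mw uU wV N0 sol al0 dk ck' kL k0.
have U0 : 0 <= U := le_trans (normr_ge0 _) (uU 0).
have V0 : 0 <= V := le_trans (normr_ge0 _) (wV 0).
have L0 : 0 <= L := le_trans (normr_ge0 _) (kL 0).
pose h (n : nat) : R := n.+1%:R^-1.
have h0 n : 0 < h n by rewrite invr_gt0.
have h1 n : h n <= 1 by rewrite invf_le1// ler1n.
have hcv : h n @[n --> \oo] --> (0 : R) by exact: cvg_harmonic.
have hNcv : - h n @[n --> \oo] --> (0 : R) by rewrite -[X in _ --> X]oppr0; exact: cvgN.
have ck : continuous k by move=> t; exact: is_derive_cont (dk t).
have mk : measurable_fun setT k := continuous_measurable ck.
have mk' : measurable_fun setT k' := continuous_measurable ck'.
have mshift (f : R -> R) (b : R) : measurable_fun setT f ->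
    measurable_fun setT (fun t : R => f (t + b)).
  by move=> mf; exact: (measurableT_comp mf (measurable_shift b)).
have mAu : hmeas (A \o u) by apply: hmeas_comp.
have m_e : measurable_fun setT (fun t => ip (A (u t)) (u t)) := hmeas_ip sepH hip mAu mu'.
pose e t := ip (A (u t)) (u t).
pose a := fine (opnorm A).
have a0 : 0 <= a := opnorm_ge0 A.
have eE t : `|e t| <= a * U * U.
  rewrite (le_trans (ip_norm hip _ _))// ler_pM// (le_trans (opnorm_le contA _))//.
  by rewrite ler_wpM2l.
have kM : exists Mk : R, forall t, `|k t| <= Mk.
  (* The weight vanishes at al - 1 and has slope at most [L]. *)
  exists (L * (`|be - al| + 1)) => t.
  have [tal|tal] := ltP t al; first by rewrite k0 ?normr0 ?mulr_ge0 ?addr_ge0//; left.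
  have [tbe|tbe] := ltP be t; first by rewrite k0 ?normr0 ?mulr_ge0 ?addr_ge0//; right.
  have := weight_lipschitz (al - 1) t dk kL; rewrite (k0 (al - 1)) ?subr0; last by left; lra.
  move=> /le_trans; apply; rewrite ler_wpM2l// !ger0_norm; lra.
have [Mk kMk] := kM.
have Mk0 : 0 <= Mk := le_trans (normr_ge0 _) (kMk 0).
pose z n t := (h n)^-1 *: (A (u (t + h n)) - A (u t)).
have mz n : hmeas (z n).
  apply: hmeasZ; apply: (hmeasD sepH); first exact: (hmeas_shift (h n) mAu).
  exact: hmeasN.
pose X n := fun t => k t * ip (z n t) (u t).
(* The term paired with u (t + h) is translated by h: nothing is known about u (t + h) tending to u
   t, whereas after translation the fixed vector u t is paired with a quotient that converges weakly
   to w t. *)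
pose Y n := fun t => k (t - h n) * ip (z n (t - h n)) (u t).
have [d dd] := dense_seq sepH.
pose good t := (forall i, lebesgue_pt (fun x => ip (w x) (d i)) t) /\
  (~ N t /\ forall n, ~ N (t + h n) /\ ~ N (t - h n)).
have aegood : {ae mu, forall t, good t}.
  apply: lebesgue_aeI.
    have : {ae mu, forall t, forall i, [set: nat] i -> lebesgue_pt (fun x => ip (w x) (d i)) t}.
      apply: lebesgue_ae_countable => [|i _]; first exact: countableP.
      exact: ae_lebesgue_pt (hmeas_ip_cst (d i) mw) (ip_bound (d i) wV).
    by apply: lebesgue_aeS => t tL i; exact: tL.
  have aeN : {ae mu, forall t, ~ N t}.
    by apply: negligibleS N0 => t /= /contrapT.
  apply: lebesgue_aeI => //.
  have : {ae mu, forall t, forall n, [set: nat] n -> ~ N (t + h n) /\ ~ N (t - h n)}.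
    apply: lebesgue_ae_countable => [|n _]; first exact: countableP.
    by apply: lebesgue_aeI; [exact: (lebesgue_ae_shift (h n) aeN)|exact: (lebesgue_ae_shift (- h n) aeN)].
  by apply: lebesgue_aeS => t tN n; exact: tN.
have zE n t q : 0 < t -> ~ N t -> ~ N (t + h n) -> ip (z n t) q =
   (h n)^-1 * (prim (fun x => ip (w x) q) (t + h n) - prim (fun x => ip (w x) q) t).
  move=> t0 Nt Nth; rewrite ipZl ipBl; congr (_ * _); apply: sol => //.
  by rewrite addr_gt0.
have zV n t q : 0 < t -> ~ N t -> ~ N (t + h n) -> `|ip (z n t) q| <= V * `|q|.
  move=> t0 Nt Nth; rewrite zE// normrM gtr0_norm ?invr_gt0// ler_pdivrMl//.
  rewrite (le_trans (prim_ip_lipschitz _ mw wV (ltW t0) (ltW (addr_gt0 t0 (h0 n)))))//.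
  by rewrite [t + h n]addrC addrK gtr0_norm// mulrC.
have cvX : \int[mu]_t X n t @[n --> \oo] --> \int[mu]_t (k t * ip (w t) (u t)).
  apply: (@Rintegral_dominated R _ _ al be (Mk * (V * U))).
  - by move=> n; apply: measurable_funM => //; exact: (hmeas_ip sepH hip (mz n) mu').
  - by apply: measurable_funM => //; exact: (hmeas_ip sepH hip mw mu').
  - apply: lebesgue_aeS aegood => t [tL [Nt Nth]].
    have [t0|t0] := ltP t al.
      rewrite k0 ?mul0r; last by left.
      by apply: cvg_near_cst; apply: nearW => n; rewrite /X k0 ?mul0r//; left.
    apply: cvgM; first exact: cvg_cst.
    have tp := lt_le_trans al0 t0.
    have hn0 n : h n != 0 by rewrite gt_eqF.
    have := @weak_quotient w V d t h (u t) mw wV dd tp tL hn0 hcv.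
    apply: cvg_trans; apply: near_eq_cvg; apply: nearW => n.
    by rewrite zE//; case: (Nth n).
  - apply: lebesgue_aeS aegood => t [tL [Nt Nth]] n; rewrite /X normrM indicE.
    rewrite mem_setE in_itv/=; have [t0|t0] := ltP t al.
      by rewrite k0 ?normr0 ?mul0r ?mulr0//; left.
    have [t1|t1] := ltP be t; first by rewrite k0 ?normr0 ?mul0r ?mulr0//; right.
    rewrite mulr1 ler_pM// (le_trans (zV _ _ _ _ _ _)) ?(lt_le_trans al0)//.
      by case: (Nth n).
    by rewrite ler_wpM2l.
have cvY : \int[mu]_t Y n t @[n --> \oo] --> \int[mu]_t (k t * ip (w t) (u t)).
  apply: (@Rintegral_dominated R _ _ al (be + 1) (Mk * (V * U))).
  - move=> n; apply: measurable_funM; first exact: (mshift k (- h n)).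
    exact: (hmeas_ip sepH hip (hmeas_shift (- h n) (mz n)) mu').
  - by apply: measurable_funM => //; exact: (hmeas_ip sepH hip mw mu').
  - apply: lebesgue_aeS aegood => t [tL [Nt Nth]].
    have [t0|t0] := ltP t al.
      rewrite k0 ?mul0r; last by left.
      apply: cvg_near_cst; apply: nearW => n; rewrite /Y k0 ?mul0r//; left.
      by rewrite (le_lt_trans _ t0)// gerBl ltW.
    have tp := lt_le_trans al0 t0.
    apply: cvgM.
      apply: (@continuous_cvg _ _ _ _ _ _ k); first exact: ck.
      by rewrite -[X in _ --> X]subr0; apply: cvgB => //; exact: cvg_cst.
    have := @weak_quotient w V d t (fun n => - h n) (u t) mw wV dd tp tL _ hNcv.
    have hNn0 n : - h n != 0 by rewrite oppr_eq0 gt_eqF.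
    move=> /(_ hNn0); apply: cvg_trans; apply: near_eq_cvg; near=> n.
    have tn : 0 < t - h n.
      have : `|h n| < t by near: n; exact: cvg0_norm_lt.
      by rewrite ltr_norml => /andP[_ ?]; lra.
    rewrite zE ?subrK//; last by case: (Nth n).
    by rewrite invrN mulNr -mulrN opprB.
  - apply: lebesgue_aeS aegood => t [tL [Nt Nth]] n; rewrite /Y normrM indicE.
    rewrite mem_setE in_itv/=; have [t0|t0] := ltP (t - h n) al.
      by rewrite k0 ?normr0 ?mul0r ?mulr_ge0//; left.
    have [t1|t1] := ltP be (t - h n).
      by rewrite k0 ?normr0 ?mul0r ?mulr_ge0//; right.
    have -> /= : al <= t by rewrite (le_trans t0)// gerBl ltW.
    have -> /= : t <= be + 1 by move: (h1 n); lra.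
    rewrite mulr1 ler_pM// (le_trans (zV _ _ _ _ _ _)) ?subrK ?(lt_le_trans al0)//.
      by case: (Nth n).
    by rewrite ler_wpM2l.
pose D n := fun t => (h n)^-1 * (k (t - h n) - k t) * e t.
have cvD : \int[mu]_t D n t @[n --> \oo] --> \int[mu]_t (- k' t * e t).
  apply: (@Rintegral_dominated R _ _ al (be + 1) (L * (a * U * U))).
  - move=> n; apply: measurable_funM => //; apply: measurable_funM => //.
    by apply: measurable_funB => //; exact: (mshift k (- h n)).
  - by apply: measurable_funM => //; exact: measurable_funN.
  - apply: lebesgue_aeW => t; apply: cvgM; last exact: cvg_cst.
    have /is_deriveP /cvgr_dnbhsP /(_ (fun n => - h n)) := dk t.
    have hNn0 n : - h n != 0 by rewrite oppr_eq0 gt_eqF.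
    move=> /(_ (conj hNn0 hNcv)) /cvgN; apply: cvg_trans; apply: near_eq_cvg.
    apply: nearW => n; transitivity (- ((- h n)^-1 * (k (- h n + t) - k t))) => //.
    by rewrite invrN mulNr opprK (addrC _ t).
  - apply: lebesgue_aeW => t n; rewrite /D normrM indicE mem_setE in_itv/=.
    have [tl|tl] := ltP t al.
      rewrite !k0 ?subrr ?mulr0 ?normr0 ?mul0r ?mulr0//; left => //.
      by rewrite (le_lt_trans _ tl)// gerBl ltW.
    have [tr|tr] := ltP (be + 1) t.
      rewrite !k0 ?subrr ?mulr0 ?normr0 ?mul0r ?mulr0//; right => //; move: (h1 n); lra.
    rewrite mulr1 ler_pM// normrM gtr0_norm ?invr_gt0// ler_pdivrMl//.
    rewrite (le_trans (weight_lipschitz _ _ dk kL))//.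
    by rewrite (addrC t) addrK normrN gtr0_norm// mulrC.
have E n : \int[mu]_t D n t = \int[mu]_t X n t + \int[mu]_t Y n t.
  have zU m t : `|z m t| <= (h m)^-1 * (2 * (a * U)).
    rewrite normrZ gtr0_norm ?invr_gt0// ler_wpM2l ?invr_ge0 ?(ltW (h0 m))//.
    rewrite (le_trans (ler_normB _ _))// (_ : 2 * (a * U) = a * U + a * U); last by ring.
    by rewrite lerD// (le_trans (opnorm_le contA _))// ler_wpM2l.
  have k0' (f : R -> R) (b C : R) : 0 <= b <= 1 -> measurable_fun setT f -> (forall t, `|f t| <= C) ->
      mu.-integrable setT (EFin \o (fun t => k (t - b) * f t)).
    move=> b01 mf fC; apply: (@integrable_bounded R _ al (be + 1) (Mk * C)).
      by apply: measurable_funM => //; exact: (mshift k (- b)).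
    move=> t; rewrite normrM indicE mem_setE in_itv/=.
    have C0 : 0 <= C := le_trans (normr_ge0 _) (fC 0).
    have [tl|tl] := ltP (t - b) al; first by rewrite k0 ?normr0 ?mul0r ?mulr_ge0//; left.
    have [tr|tr] := ltP be (t - b); first by rewrite k0 ?normr0 ?mul0r ?mulr_ge0//; right.
    have -> /= : al <= t by lra.
    have -> /= : t <= be + 1 by lra.
    by rewrite mulr1 ler_pM.
  pose P t := k (t - h n) * ((h n)^-1 * e t).
  pose Q t := k t * ((h n)^-1 * e t).
  have he t : `|(h n)^-1 * e t| <= (h n)^-1 * (a * U * U).
    by rewrite normrM gtr0_norm ?invr_gt0// ler_wpM2l ?invr_ge0// ltW.
  have mhe : measurable_fun setT (fun t => (h n)^-1 * e t) by exact: measurable_funM.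
  have h01 : 0 <= h n <= 1 by rewrite ltW/=.
  have iP : mu.-integrable setT (EFin \o P) by exact: k0' he.
  have iQ : mu.-integrable setT (EFin \o Q).
    have /= := k0' _ 0 _ _ mhe he; rewrite lexx ler01 => /(_ isT).
    by apply: eq_integrable => // t _ /=; rewrite subr0.
  have iX : mu.-integrable setT (EFin \o X n).
    have mzu := hmeas_ip sepH hip (mz n) mu'.
    have zu t : `|ip (z n t) (u t)| <= (h n)^-1 * (2 * (a * U)) * U.
      by rewrite (le_trans (ip_norm hip _ _))// ler_pM.
    have /= := k0' _ 0 _ _ mzu zu; rewrite lexx ler01 => /(_ isT).
    by apply: eq_integrable => // t _ /=; rewrite subr0.
  have iY : mu.-integrable setT (EFin \o Y n).
    have mzu := hmeas_ip sepH hip (hmeas_shift (- h n) (mz n)) mu'.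
    apply: (k0' _ _ ((h n)^-1 * (2 * (a * U)) * U) h01 mzu) => t.
    by rewrite (le_trans (ip_norm hip _ _))// ler_pM.
  rewrite -[X in _ = _ + X](Rintegral_shift (h n) iY).
  rewrite -RintegralD//; last exact: (integrable_shift (h n) iY).
  transitivity (\int[mu]_t P t - \int[mu]_t Q t).
    rewrite -RintegralB//; apply: eq_Rintegral => t _.
    by rewrite /D /P /Q; ring.
  rewrite -(Rintegral_shift (h n) iP) -RintegralB//; last exact: (integrable_shift (h n) iP).
  apply: eq_Rintegral => t _; rewrite /P /Q /X /Y !addrK /e /z !ipZl !ipBl.
  have -> : ip (A (u (t + h n))) (u t) = ip (A (u t)) (u (t + h n)) by rewrite symA ipC.
  ring.
have cvE : \int[mu]_t D n t @[n --> \oo] -->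
    \int[mu]_t (k t * ip (w t) (u t)) + \int[mu]_t (k t * ip (w t) (u t)).
  by under eq_fun do rewrite E; exact: cvgD.
have Eq := cvg_unique (@Rhausdorff R) cvD cvE.
rewrite mulNr mulrDl mul1r -Eq.
have k'0 t : t < al \/ be < t -> k' t = 0.
  move=> tab; have dk0 : is_derive t (1 : R) k 0.
    apply: (near_eq_is_derive _ (is_derive_cst (0 : R) t (1 : R))).
    case: tab => tab; near=> x; rewrite k0//; [left|right].
      by near: x; exact: lt_nbhsl.
    by near: x; exact: lt_nbhsr.
  by have [_ <-] := dk t; case: dk0.
have ike : mu.-integrable setT (EFin \o (fun t => k' t * e t)).
  apply: (@integrable_bounded R _ al be (L * (a * U * U))); first exact: measurable_funM.
  move=> t; rewrite normrM indicE mem_setE in_itv/=.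
  have [tl|tl] := ltP t al; first by rewrite k'0 ?normr0 ?mul0r ?mulr0//; left.
  have [tr|tr] := ltP be t; first by rewrite k'0 ?normr0 ?mul0r ?mulr0//; right.
  by rewrite mulr1 ler_pM.
rewrite -mulN1r -RintegralZl//; last first.
  by apply: eq_integrable (integrableZl measurableT (- 1) ike) => // t _; rewrite /= -EFinM mulN1r mulNr.
by apply: eq_Rintegral => t _; rewrite mulN1r mulNr opprK.
Unshelve. all: by end_near. Qed.

End EnergyIdentity.

Lemma norm_le_sqr (R : realDomainType) (x c : R) : `|x| <= c -> x ^+ 2 <= c ^+ 2.
Proof.
by move=> xc; rewrite -real_normK ?num_real// lerXn2r ?nnegrE// (le_trans _ xc).
Qed.

Lemma integrable_support (R : realType) (f : R -> R) (a b C : R) :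
  measurable_fun setT f -> (forall t, `|f t| <= C) ->
  (forall t, t < a \/ b < t -> f t = 0) ->
  (@lebesgue_measure R).-integrable setT (EFin \o f).
Proof.
move=> mf fC f0; apply: (@integrable_bounded R f a b C) => // t.
rewrite indicE mem_setE in_itv/=; have [ta|ta] := ltP t a.
  by rewrite f0 ?normr0 ?mulr0//; left.
have [tb|tb] := ltP b t; first by rewrite f0 ?normr0 ?mulr0//; right.
by rewrite mulr1.
Qed.

Lemma EFin_Rintegral (R : realType) (f : R -> R) :
  (@lebesgue_measure R).-integrable setT (EFin \o f) ->
  (\int[@lebesgue_measure R]_t f t)%:E = (\int[@lebesgue_measure R]_t (f t)%:E)%E.
Proof. by move=> fi; rewrite fineK//; exact: integrable_fin_num. Qed.

Lemma tail_le_itv (R : realType) (s : R) (F : R -> R) (B : \bar R) :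
  measurable_fun setT F -> (forall t, s < t -> 0 <= F t) ->
  (forall T : R, \int[@lebesgue_measure R]_(t in `]s, T[) (F t)%:E <= B)%E ->
  (tail s F <= B)%E.
Proof.
move=> mF F0 FB; rewrite /tail.
have -> : `]s, +oo[%classic = \bigcup_n `]s, n%:R[%classic :> set R.
  apply/seteqP; split => t /=.
    rewrite in_itv/= andbT => st; exists (Num.truncn `|t|).+1 => //=.
    by rewrite in_itv/= st (le_lt_trans (ler_norm t))// truncnS_gt.
  by case=> n _ /=; rewrite !in_itv/= andbT => /andP[].
have := @ge0_nondecreasing_set_cvg_integral _ (measurableTypeR R) R
  (fun n => `]s, n%:R[%classic) (fun t => (F t)%:E) (@lebesgue_measure R).
have F1 : {homo (fun n : nat => `]s, n%:R[%classic : set R) : n m / (n <= m)%N >-> (n <= m)%O}.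
  move=> n m nm; apply/subsetPset => t /=; rewrite !in_itv/= => /andP[-> /= tn].
  by rewrite (lt_le_trans tn)// ler_nat.
move=> /(_ F1) cv; rewrite -(cvg_lim _ (cv _ _ _))//.
- apply: lime_le; last by apply: nearW => n; exact: FB.
  apply: cvgP; apply: cv => // i; last by move=> t /=; rewrite in_itv/= => /andP[/F0].
  by apply/measurable_EFinP; exact: measurable_funTS.
- by move=> i; apply/measurable_EFinP; exact: measurable_funTS.
- by move=> i t /=; rewrite in_itv/= => /andP[/F0].
Qed.

Lemma integral_support (R : realType) (D : set R) (f : R -> \bar R) :
  (forall t, ~ D t -> f t = 0%E) ->
  (\int[@lebesgue_measure R]_t f t = \int[@lebesgue_measure R]_(t in D) f t)%E.
Proof.
move=> f0; rewrite [RHS]integral_mkcond; apply: eq_integral => t _.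
rewrite patchE; case: ifPn => // /negP Dt.
by apply: f0 => Dt'; apply: Dt; rewrite inE.
Qed.

Definition ramp (R : realType) (s r t : R) := smoothstep (r^-1 * (t - s)).

Section EnergyEstimate.
Variables (R : realType) (H : completeNormedModType R).
Local Notation mu := (@lebesgue_measure R).
Variable ip : {dot H for (idfun : R -> R)}.
Hypothesis hip : hilbert_inner ip.
Hypothesis sepH : separable_space H.
Variable A : {linear H -> H}.
Hypothesis contA : continuous A.
Hypothesis symA : self_adjoint ip A.
Implicit Types (u w : R -> H).

(** The least admissible source at each time. It is bounded along with [u] and [w], while a majorant
    [F] is controlled only after time s and may be unbounded. *)
Definition defect u w t := Num.max 0 (`|w t + u t| - 4^-1 * `|u t|).

Lemma defect_ge0 u w t : 0 <= defect u w t.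
Proof. by rewrite le_max lexx. Qed.

Lemma defect_bound u w t : `|w t + u t| <= 4^-1 * `|u t| + defect u w t.
Proof. by rewrite -lerBlDl /defect le_max lexx orbT. Qed.

Lemma defect_le u w t F : 0 <= F -> `|w t + u t| <= 4^-1 * `|u t| + F -> defect u w t <= F.
Proof. by move=> F0 wF; rewrite ge_max F0 lerBlDl. Qed.

Lemma measurable_defect u w : hmeas u -> hmeas w -> measurable_fun setT (defect u w).
Proof.
move=> mu' mw; apply: measurable_maxr; first exact: measurable_cst.
apply: measurable_funB; first exact: hmeas_norm (hmeasD sepH mw mu').
by apply: measurable_funM => //; exact: hmeas_norm.
Qed.

(** Contraction by 1/4 gives 4 q^2 <w, u> <= q^2 (-3 |u|^2 + 4 f |u|). The three negative squares
    are spent exactly: one on the left side, one on 4 q q' <Au, u> and one on 4 f |u|, the last two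
    by Young. Writing the weight as q^2 avoids a division by q in the first Young inequality. *)
Lemma energy_pointwise (q q' f : R) (u0 w0 : H) : 0 <= f ->
  `|w0 + u0| <= 4^-1 * `|u0| + f ->
  q ^+ 2 * `|u0| ^+ 2 + 2 * (2 * (q * q') * ip (A u0) u0 + 2 * (q ^+ 2 * ip w0 u0)) <=
  4 * (q' ^+ 2 * `|A u0| ^+ 2) + 4 * (q ^+ 2 * f ^+ 2).
Proof.
move=> f0 gf.
have e1 : ip w0 u0 <= (4^-1 * `|u0| + f) * `|u0| - `|u0| ^+ 2.
  rewrite lerBrDr -(hip u0) -ipDl (le_trans (ip_le hip _ _))//.
  by rewrite ler_wpM2r.
have e2 : q * q' * ip (A u0) u0 <= `|q * q'| * (`|A u0| * `|u0|).
  by rewrite (le_trans (ler_norm _))// normrM ler_wpM2l// ip_norm.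
rewrite normrM in e2.
have e3 : q ^+ 2 * ip w0 u0 <= q ^+ 2 * ((4^-1 * `|u0| + f) * `|u0| - `|u0| ^+ 2).
  by rewrite ler_wpM2l// sqr_ge0.
have q2 (x : R) : x ^+ 2 = `|x| ^+ 2 by rewrite real_normK ?num_real.
rewrite (q2 q') !(q2 q) in e3 *.
have s1 := sqr_ge0 (`|q| * `|u0| - 2 * (`|q'| * `|A u0|)).
have s2 := sqr_ge0 (`|q| * (`|u0| - 2 * f)).
rewrite -(mulrA 2) -normrM in e2 *.
move: e2 e3 s1 s2; rewrite (normrM q).
move: (ip (A u0) u0) (ip w0 u0) `|q| `|q'| `|u0| `|A u0| => x y a b c d.
move: (q * q' * x) => z.
lra.
Qed.

Lemma weighted_energy N u w (U V : R) (q q' : R -> R) (al be L : R) :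
  hmeas u -> hmeas w -> (forall t, `|u t| <= U) -> (forall t, `|w t| <= V) ->
  mu.-negligible N -> weak_sol ip A N u w ->
  0 < al -> (forall t, is_derive t (1 : R) q (q' t)) -> continuous q' ->
  (forall t, `|q t| <= 1) -> (forall t, `|q' t| <= L) ->
  (forall t, t < al \/ be < t -> q t = 0) -> (forall t, t < al \/ be < t -> q' t = 0) ->
  (\int[mu]_t (q t ^+ 2 * `|u t| ^+ 2)%:E <=
   \int[mu]_t (4 * (q' t ^+ 2 * `|A (u t)| ^+ 2) + 4 * (q t ^+ 2 * defect u w t ^+ 2))%:E)%E.
Proof.
move=> mu' mw uU wV N0 sol al0 dq cq' q1 qL q0 q'0.
have U0 : 0 <= U := le_trans (normr_ge0 _) (uU 0).
have L0 : 0 <= L := le_trans (normr_ge0 _) (qL 0).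
have cq : continuous q by move=> t; exact: is_derive_cont (dq t).
have mq := continuous_measurable cq; have mq' := continuous_measurable cq'.
have mAu : hmeas (A \o u) by apply: hmeas_comp.
have mnu := hmeas_norm mu'; have mnA := hmeas_norm mAu.
have mf := measurable_defect mu' mw.
have mdefect : measurable_fun setT (fun t : R => 4 * (q' t ^+ 2 * `|A (u t)| ^+ 2) + 4 * (q t ^+ 2 * defect u w t ^+ 2)).
  apply: measurable_funD; apply: measurable_funM => //; apply: measurable_funM;
  exact: measurable_funX.
have q2 t : `|q t ^+ 2| <= 1 by rewrite normrX exprn_ile1.
have q'2 t : `|q' t ^+ 2| <= L ^+ 2 by rewrite normrX lerXn2r ?nnegrE.
have AU t : `|A (u t)| <= fine (opnorm A) * U.
  by rewrite (le_trans (opnorm_le contA _))// ler_wpM2l// opnorm_ge0.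
have fb t : defect u w t <= U + V.
  rewrite ge_max addr_ge0 ?(le_trans (normr_ge0 _) (wV 0))//= lerBlDr.
  rewrite (le_trans (ler_normD _ _))// addrC ler_wpDr ?lerD//.
have i1 : mu.-integrable setT (EFin \o (fun t => q t ^+ 2 * `|u t| ^+ 2)).
  apply: (@integrable_support R _ al be (U ^+ 2)).
  - by apply: measurable_funM; exact: measurable_funX.
  - move=> t; rewrite normrM -[leRHS]mul1r ler_pM// normrX normr_id.
    by rewrite lerXn2r ?nnegrE.
  - by move=> t /q0 ->; rewrite expr0n mul0r.
have i2 : mu.-integrable setT (EFin \o (fun t : R => 4 * (q' t ^+ 2 * `|A (u t)| ^+ 2) + 4 * (q t ^+ 2 * defect u w t ^+ 2))).
  apply: (@integrable_support R _ al be (4 * (L ^+ 2 * (fine (opnorm A) * U) ^+ 2) + 4 * (U + V) ^+ 2)) => //.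
  - move=> t; rewrite (le_trans (ler_normD _ _))// lerD// normrM ger0_norm// ler_wpM2l//.
      by rewrite normrM ler_pM// normrX normr_id lerXn2r ?nnegrE// (le_trans _ (AU t)).
    rewrite normrM -[leRHS]mul1r ler_pM// normrX ger0_norm ?defect_ge0//.
    by rewrite lerXn2r ?nnegrE ?defect_ge0// (le_trans _ (fb t)) ?defect_ge0.
  - by move=> t t0; rewrite q0// q'0// !expr0n !mul0r mulr0 addr0.
have dq2 t : is_derive t (1 : R) (fun t => q t ^+ 2) (2 * (q t * q' t)).
  rewrite (_ : (fun t => q t ^+ 2) = q * q); last by apply/funext => z; rewrite expr2.
  by apply: is_derive_conv (is_deriveM (dq t) (dq t)) _; rewrite /GRing.scale/=; ring.
have ccq' : continuous (fun t => 2 * (q t * q' t)).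
  by move=> t; apply: cvgM; [exact: cvg_cst|apply: cvgM; [exact: cq|exact: cq']].
have En := @energy_identity R H ip hip sepH A contA symA N u w U V _ _ al be (2 * L)
  mu' mw uU wV N0 sol al0 dq2 ccq'.
have {}En : \int[mu]_t (2 * (q t * q' t) * ip (A (u t)) (u t)) = - 2 * \int[mu]_t (q t ^+ 2 * ip (w t) (u t)).
  apply: En => t; last by move=> /q0 ->; rewrite expr0n.
  by rewrite normrM ger0_norm// ler_wpM2l// normrM -[leRHS]mul1r ler_pM.
have i3 : mu.-integrable setT (EFin \o (fun t => 2 * (q t * q' t) * ip (A (u t)) (u t))).
  apply: (@integrable_support R _ al be (2 * L * (fine (opnorm A) * U * U))).
  - apply: measurable_funM; last exact: (hmeas_ip sepH hip mAu mu').
    by apply: measurable_funM => //; exact: measurable_funM.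
  - move=> t; rewrite normrM ler_pM//.
      by rewrite normrM ger0_norm// ler_wpM2l// normrM -[leRHS]mul1r ler_pM.
    by rewrite (le_trans (ip_norm hip _ _))// ler_pM.
  - by move=> t /q0 ->; rewrite mul0r mulr0 mul0r.
have i4 : mu.-integrable setT (EFin \o (fun t => q t ^+ 2 * ip (w t) (u t))).
  apply: (@integrable_support R _ al be (V * U)).
  - apply: measurable_funM; last exact: (hmeas_ip sepH hip mw mu').
    exact: measurable_funX.
  - move=> t; rewrite normrM -[leRHS]mul1r ler_pM//.
    by rewrite (le_trans (ip_norm hip _ _))// ler_pM.
  - by move=> t /q0 ->; rewrite expr0n mul0r.
have i5 : mu.-integrable setT (EFin \o (fun t => 2 * (2 * (q t * q' t) * ip (A (u t)) (u t)))).
  by apply: eq_integrable (integrableZl measurableT 2 i3) => // t _.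
have i6 : mu.-integrable setT (EFin \o (fun t => 4 * (q t ^+ 2 * ip (w t) (u t)))).
  by apply: eq_integrable (integrableZl measurableT 4 i4) => // t _.
have i56 := integrableD measurableT i5 i6.
have i156 := integrableD measurableT i1 i56.
rewrite -(EFin_Rintegral i1) -(EFin_Rintegral i2) lee_fin.
(* The added bracket integrates to 0 by the energy identity for the weight q^2; with it the
   integrand obeys the pointwise inequality. *)
rewrite (_ : \int[mu]_t (q t ^+ 2 * `|u t| ^+ 2) = \int[mu]_t (q t ^+ 2 * `|u t| ^+ 2 +
   (2 * (2 * (q t * q' t) * ip (A (u t)) (u t)) + 4 * (q t ^+ 2 * ip (w t) (u t))))); last first.
  rewrite RintegralD// RintegralD// RintegralZl// RintegralZl// En.
  by ring.
apply: le_Rintegral => // t _.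
apply: le_trans (energy_pointwise (q t) (q' t) (defect_ge0 u w t) (defect_bound u w t)).
 by rewrite lerD2l mulrDr lerD2l !mulrA (_ : 2 * 2 = 4) // -natrM.
Qed.

Variables (th' : R -> R) (C : R).
Hypothesis C0 : 0 < C.
Hypothesis dth : forall t, is_derive t (1 : R) (@smoothstep R) (th' t).
Hypothesis cth' : continuous th'.
Hypothesis thC : forall t, `|th' t| <= C.
Hypothesis th0 : forall t, t < 0 \/ 1 < t -> th' t = 0.

(** The ramp is not compactly supported, so it is multiplied by a cut-off descending from 1 to 0 on
    [T, 2T], whose contribution vanishes for large T. The ramp has slope at most C / r, on
    [s, s + r] only, which gives 8 C^2 / r^2 = 4 * 2 * (C / r)^2, the 2 coming from squaring a
    sum. *)
Lemma energy_estimate_const N u w (U V : R) (F : R -> R) (s r : R) (B : \bar R) :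
  hmeas u -> hmeas w -> (forall t, `|u t| <= U) -> (forall t, `|w t| <= V) ->
  mu.-negligible N -> weak_sol ip A N u w -> 0 < s -> 0 < r ->
  measurable_fun setT F -> (forall t, s < t -> 0 <= F t) ->
  (forall t, s < t -> `|w t + u t| <= 4^-1 * `|u t| + F t) ->
  (tail s (fun t => ramp s r t ^+ 2 * F t ^+ 2)%R <= B)%E ->
  (tail s (fun t => ramp s r t ^+ 2 * `|u t| ^+ 2)%R <=
   (8 * C ^+ 2 / r ^+ 2)%:E * \int[mu]_(t in `[s, (s + r)%R]) (`|A (u t)| ^+ 2)%:E + 4%:E * B)%E.
Proof.
move=> mu' mw uU wV N0 sol s0 r0 mF F0 uwF FB.
have U0 : 0 <= U := le_trans (normr_ge0 _) (uU 0).
pose a := fine (opnorm A).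
have AU t : `|A (u t)| <= a * U.
  by rewrite (le_trans (opnorm_le contA _))// ler_wpM2l// opnorm_ge0.
have dramp s1 m (t : R) : is_derive t (1 : R) (fun t => smoothstep (m * (t - s1))) (m * th' (m * (t - s1))).
  exact: is_derive_affine.
have cramp s1 m : continuous (fun t : R => m * th' (m * (t - s1))).
  move=> t; apply: cvgM; first exact: cvg_cst.
  apply: (@continuous_cvg _ _ _ _ _ _ th'); first exact: cth'.
  apply: cvgM; first exact: cvg_cst.
  by apply: cvgB; [exact: cvg_id|exact: cvg_cst].
have mramp : measurable_fun setT (ramp s r).
  by apply: continuous_measurable => t; exact: is_derive_cont (dramp s r^-1 t).
have mnu := hmeas_norm mu'.
have mnA : measurable_fun setT (fun t => `|A (u t)|) by apply: hmeas_norm; apply: hmeas_comp.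
have mru : measurable_fun setT (fun t => ramp s r t ^+ 2 * `|u t| ^+ 2).
  by apply: measurable_funM; exact: measurable_funX.
have th_norm (x : R) : `|smoothstep x| <= 1 by rewrite ger0_norm ?smoothstep_ge0 ?smoothstep_le1.
apply: tail_le_itv => // [t _|T1]; first by rewrite mulr_ge0 ?sqr_ge0.
apply/lee_addgt0Pr => e e0.
(* The cut-off costs at most E0 / T^2 on an interval of length T, hence E0 / T, and [T] is chosen to
   make this at most [e]. *)
pose E0 := 8 * C ^+ 2 * (a * U) ^+ 2.
have E00 : 0 <= E0 by rewrite mulr_ge0 ?sqr_ge0// mulr_ge0 ?sqr_ge0.
pose T := Num.max (Num.max T1 (s + r)) (Num.max 1 (E0 / e)).
have [TT1 Tsr T_1 Te] : [/\ T1 <= T, s + r <= T, 1 <= T & E0 / e <= T].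
  by rewrite /T !le_max !lexx !orbT.
clearbody T.
have T0 : 0 < T by rewrite (lt_le_trans _ T_1).
pose chi (t : R) := smoothstep (- T^-1 * (t - (T + T))).
pose chi' t := - T^-1 * th' (- T^-1 * (t - (T + T))).
pose rho' t := r^-1 * th' (r^-1 * (t - s)).
pose Q t := ramp s r t * chi t.
pose Q' t := rho' t * chi t + ramp s r t * chi' t.
have dchi (t : R) : is_derive t (1 : R) chi (chi' t) by exact: dramp.
have drho (t : R) : is_derive t (1 : R) (ramp s r) (rho' t) by exact: dramp.
have dQ (t : R) : is_derive t (1 : R) Q (Q' t).
  apply: is_derive_conv (is_deriveM (drho t) (dchi t)) _.
  by rewrite /Q' /GRing.scale/= addrC mulrC.
have cchi : continuous chi by move=> t; exact: is_derive_cont (dchi t).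
have crho : continuous (ramp s r) by move=> t; exact: is_derive_cont (drho t).
have cchi' : continuous chi' by exact: cramp.
have crho' : continuous rho' by exact: cramp.
have cQ' : continuous Q'.
  by move=> t; apply: cvgD; apply: cvgM; [exact: crho'|exact: cchi|exact: crho|exact: cchi'].
have chi'C t : `|chi' t| <= C / T.
  by rewrite /chi' normrM normrN [`|T^-1|]gtr0_norm ?invr_gt0// mulrC ler_wpM2r// invr_ge0 ltW.
have rho'C t : `|rho' t| <= C / r.
  by rewrite /rho' normrM [`|r^-1|]gtr0_norm ?invr_gt0// mulrC ler_wpM2r// invr_ge0 ltW.
have chi'0 t : t < T \/ T + T < t -> chi' t = 0.
  move=> Tt; rewrite /chi' th0 ?mulr0//.
  case: Tt => Tt; [right|left]; rewrite mulNr.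
    by rewrite -mulrN opprB -(ltr_pM2l T0) mulrA divff ?gt_eqF// mul1r mulr1; lra.
  by rewrite oppr_lt0 mulr_gt0 ?invr_gt0// subr_gt0.
have chi0 t : T + T < t -> chi t = 0.
  move=> Tt; rewrite /chi smoothstep0// mulNr oppr_le0 mulr_ge0 ?invr_ge0 ?(ltW T0)//.
  by rewrite subr_ge0 ltW.
have chi1 t : t <= T -> chi t = 1.
  move=> Tt; rewrite /chi smoothstep1// mulNr -mulrN opprB -(ler_pM2l T0) mulrA divff ?gt_eqF//.
  by rewrite mul1r mulr1; lra.
have rho'0 t : t < s \/ s + r < t -> rho' t = 0.
  move=> st; rewrite /rho' th0 ?mulr0//; case: st => st; [left|right].
    by rewrite -(ltr_pM2l r0) mulrA divff ?gt_eqF// mul1r mulr0; lra.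
  by rewrite -(ltr_pM2l r0) mulrA divff ?gt_eqF// mul1r mulr1; lra.
have rho0 t : t <= s -> ramp s r t = 0.
  move=> st; rewrite /ramp smoothstep0//.
  by rewrite -(ler_pM2l r0) mulrA divff ?gt_eqF// mul1r mulr0; lra.
have ET t : (s < t < T1)%R -> ramp s r t = Q t.
  by move=> /andP[st tT]; rewrite /Q chi1 ?mulr1// (le_trans _ TT1)// ltW.
have Q1 t : `|Q t| <= 1 by rewrite normrM mulr_ile1//; exact: th_norm.
have Q'L t : `|Q' t| <= C / r + C / T.
  rewrite (le_trans (ler_normD _ _))// lerD// normrM.
    by rewrite -[leRHS]mulr1 ler_pM//; exact: th_norm.
  by rewrite -[leRHS]mul1r ler_pM//; exact: th_norm.
have Q0 t : t < s \/ T + T < t -> Q t = 0.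
  by rewrite /Q => -[/ltW/rho0 ->|/chi0 ->]; rewrite ?mul0r ?mulr0.
have Q'0 t : t < s \/ T + T < t -> Q' t = 0.
  move=> st; rewrite /Q' [chi' t]chi'0 ?[rho' t]rho'0 ?mul0r ?mulr0 ?addr0//.
    by case: st => st; [left|right]; lra.
  by case: st => st; [left|right]; lra.
have WE := weighted_energy mu' mw uU wV N0 sol s0 dQ cQ' Q1 Q'L Q0 Q'0.
have mQ : measurable_fun setT Q by apply: continuous_measurable => t; exact: is_derive_cont (dQ t).
have mQ' := continuous_measurable cQ'.
have mrho' := continuous_measurable crho'.
have mQu : measurable_fun setT (fun t => (Q t ^+ 2 * `|u t| ^+ 2)%:E).
  by apply/measurable_EFinP; apply: measurable_funM; exact: measurable_funX.
apply: (@le_trans _ _ (\int[mu]_t (Q t ^+ 2 * `|u t| ^+ 2)%:E)%E).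
  have -> : (\int[mu]_(t in `]s, T1[) (ramp s r t ^+ 2 * `|u t| ^+ 2)%:E =
      \int[mu]_(t in `]s, T1[) (Q t ^+ 2 * `|u t| ^+ 2)%:E)%E.
    by apply: eq_integral => t; rewrite inE/= in_itv/= => /ET ->.
  by apply: ge0_subset_integral => // t _; rewrite lee_fin mulr_ge0 ?sqr_ge0.
apply: (le_trans WE).
(* The majorant splits into the slope of the ramp, the slope of the cut-off and the source. *)
pose g1 t := 8 * rho' t ^+ 2 * `|A (u t)| ^+ 2.
pose g2 t := (E0 / T ^+ 2) * \1_`[T, T + T] t : R.
pose g3 t := 4 * ((ramp s r t ^+ 2 * F t ^+ 2) * \1_`]s, +oo[ t).
have mg1 : measurable_fun setT (fun t => (g1 t)%:E).
  apply/measurable_EFinP; apply: measurable_funM; last exact: measurable_funX.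
  by apply: measurable_funM => //; exact: measurable_funX.
have mg2 : measurable_fun setT (fun t => (g2 t)%:E).
  by apply/measurable_EFinP; apply: measurable_funM => //; exact: measurable_indic.
have mg3 : measurable_fun setT (fun t => (g3 t)%:E).
  apply/measurable_EFinP; apply: measurable_funM => //; apply: measurable_funM.
    by apply: measurable_funM; exact: measurable_funX.
  exact: measurable_indic.
have g10 t : (0 <= (g1 t)%:E)%E by rewrite lee_fin /g1 mulr_ge0 ?sqr_ge0// mulr_ge0 ?sqr_ge0.
have g20 t : (0 <= (g2 t)%:E)%E by rewrite lee_fin /g2 mulr_ge0// divr_ge0 ?sqr_ge0.
have g30 t : (0 <= (g3 t)%:E)%E by rewrite lee_fin /g3 mulr_ge0// mulr_ge0// mulr_ge0 ?sqr_ge0.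
apply: (@le_trans _ _ (\int[mu]_t ((g1 t)%:E + ((g2 t)%:E + (g3 t)%:E)))%E).
  apply: ge0_le_integral => //.
  - by move=> t _; rewrite lee_fin addr_ge0// mulr_ge0// mulr_ge0 ?sqr_ge0.
  - apply/measurable_EFinP; apply: measurable_funD; apply: measurable_funM => //;
    apply: measurable_funM; apply: measurable_funX => //; exact: measurable_defect.
  - by apply: emeasurable_funD => //; exact: emeasurable_funD.
  move=> t _; rewrite -!EFinD lee_fin /g1 /g2 /g3 addrA lerD//.
    have Q'2 : Q' t ^+ 2 <= 2 * rho' t ^+ 2 + 2 * chi' t ^+ 2.
      have x1 : (rho' t * chi t) ^+ 2 <= rho' t ^+ 2.
        rewrite exprMn -[leRHS]mulr1 ler_wpM2l ?sqr_ge0//.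
        by rewrite exprn_ile1 ?smoothstep_ge0 ?smoothstep_le1.
      have x2 : (ramp s r t * chi' t) ^+ 2 <= chi' t ^+ 2.
        rewrite exprMn -[leRHS]mul1r ler_wpM2r ?sqr_ge0//.
        by rewrite exprn_ile1 ?smoothstep_ge0 ?smoothstep_le1.
      rewrite /Q'; move: x1 x2 (sqr_ge0 (rho' t * chi t - ramp s r t * chi' t)).
      by move: (rho' t * chi t) (ramp s r t * chi' t) => x y; lra.
    apply: (@le_trans _ _ (8 * rho' t ^+ 2 * `|A (u t)| ^+ 2 + 8 * (chi' t ^+ 2 * `|A (u t)| ^+ 2))).
      rewrite (_ : _ + _ = 4 * ((2 * rho' t ^+ 2 + 2 * chi' t ^+ 2) * `|A (u t)| ^+ 2)); last by ring.
      by rewrite ler_wpM2l// ler_wpM2r// sqr_ge0.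
    rewrite lerD2l indicE mem_setE in_itv/=.
    have [tT|tT] := ltP t T; first by rewrite chi'0 ?expr0n ?mul0r ?mulr0//; left.
    have [tT2|tT2] := ltP (T + T) t; first by rewrite chi'0 ?expr0n ?mul0r ?mulr0//; right.
    rewrite mulr1 (_ : E0 / T ^+ 2 = 8 * ((C / T) ^+ 2 * (a * U) ^+ 2)); last first.
      by rewrite /E0 expr_div_n; ring.
    by rewrite ler_wpM2l// ler_pM ?sqr_ge0// norm_le_sqr// normr_id.
  rewrite ler_wpM2l// indicE mem_setE in_itv/= andbT.
  have [st|st] := ltP s t; last first.
    by rewrite /Q rho0// mul0r expr0n !mul0r.
  rewrite mulr1 ler_pM ?sqr_ge0//.
    rewrite /Q exprMn -[leRHS]mulr1 ler_wpM2l ?sqr_ge0//.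
    by rewrite exprn_ile1 ?smoothstep_ge0 ?smoothstep_le1.
  by rewrite lerXn2r ?nnegrE ?defect_ge0 ?F0// defect_le ?F0 ?uwF.
rewrite ge0_integralD//; last 2 first.
  by move=> t _; rewrite adde_ge0.
  exact: emeasurable_funD.
rewrite ge0_integralD//.
rewrite -[leRHS]addeA leeD//.
  rewrite (@integral_support _ `[s, s + r]%classic); last first.
    move=> t /=; rewrite in_itv/= => /negP; rewrite negb_and -!ltNge => st.
    by rewrite /g1 rho'0 ?expr0n ?mulr0 ?mul0r//; apply/orP.
  rewrite -ge0_integralZl//; last 2 first.
    by apply/measurable_EFinP; apply: measurable_funTS; exact: measurable_funX.
    by rewrite lee_fin divr_ge0 ?sqr_ge0// mulr_ge0 ?sqr_ge0.
  apply: ge0_le_integral => //.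
  - exact: measurable_funTS.
  - apply: measurable_funTS; apply: emeasurable_funM => //.
    by apply/measurable_EFinP; exact: measurable_funX.
  move=> t _; rewrite -EFinM lee_fin /g1 ler_wpM2r ?sqr_ge0// -mulrA ler_wpM2l//.
  by rewrite -expr_div_n norm_le_sqr.
rewrite addeC leeD//.
  rewrite (@integral_support _ `]s, +oo[%classic); last first.
    move=> t /= st; rewrite /g3 indicE memNset ?mulr0//.
  rewrite (@le_trans _ _ (4%:E * tail s (fun t => ramp s r t ^+ 2 * F t ^+ 2)%R)%E)//.
    rewrite /tail -ge0_integralZl//.
    + rewrite le_eqVlt; apply/orP; left; apply/eqP; apply: eq_integral => t st.
      by rewrite /g3 indicE st mulr1.
    + by apply/measurable_EFinP; apply: measurable_funTS; apply: measurable_funM; exact: measurable_funX.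
    + by move=> t _; rewrite lee_fin mulr_ge0 ?sqr_ge0.
  by rewrite lee_wpmul2l.
under eq_integral do rewrite /g2 EFinM.
rewrite ge0_integralZl//; last 2 first.
  by apply/measurable_EFinP; exact: measurable_indic.
  by rewrite lee_fin divr_ge0 ?sqr_ge0.
rewrite integral_indic// setIT [X in (_ * X)%E]lebesgue_measure_itv /= lte_fin ltrDl T0.
rewrite -EFinB -EFinM lee_fin addrK (_ : _ * T = E0 / T); last by field; rewrite gt_eqF.
by rewrite ler_pdivrMr// mulrC -ler_pdivrMr.
Qed.

End EnergyEstimate.

Lemma smoothstep_derive_bound (R : realType) : exists C : R, 0 < C /\ exists f' : R -> R,
  [/\ forall t, is_derive t (1 : R) (@smoothstep R) (f' t), continuous f',
    forall t, `|f' t| <= C & forall t, t < 0 \/ 1 < t -> f' t = 0].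
Proof. by have [f' [C [C0 df cf fC f0]]] := smoothstep_derive R; exists C; split=> //; exists f'. Qed.

(** A slope bound for [smoothstep] is chosen once and for all, so that later constants are genuine
    functions of the data. *)
Definition ramp_const (R : realType) : R := 8 * sval (cid (smoothstep_derive_bound R)) ^+ 2.

Lemma ramp_const_ge0 (R : realType) : 0 <= ramp_const R.
Proof. by rewrite mulr_ge0 ?sqr_ge0. Qed.

Section EnergyEstimateRamp.
Variables (R : realType) (H : completeNormedModType R).
Local Notation mu := (@lebesgue_measure R).
Variable ip : {dot H for (idfun : R -> R)}.
Hypothesis hip : hilbert_inner ip.
Hypothesis sepH : separable_space H.
Variable A : {linear H -> H}.
Hypothesis contA : continuous A.
Hypothesis symA : self_adjoint ip A.
Implicit Types (u w : R -> H).

Lemma energy_estimate N u w (U V : R) (F : R -> R) (s r : R) (B : \bar R) :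
  hmeas u -> hmeas w -> (forall t, `|u t| <= U) -> (forall t, `|w t| <= V) ->
  mu.-negligible N -> weak_sol ip A N u w -> 0 < s -> 0 < r ->
  measurable_fun setT F -> (forall t, s < t -> 0 <= F t) ->
  (forall t, s < t -> `|w t + u t| <= 4^-1 * `|u t| + F t) ->
  (tail s (fun t => ramp s r t ^+ 2 * F t ^+ 2)%R <= B)%E ->
  (tail s (fun t => ramp s r t ^+ 2 * `|u t| ^+ 2)%R <=
   (ramp_const R / r ^+ 2)%:E * \int[mu]_(t in `[s, (s + r)%R]) (`|A (u t)| ^+ 2)%:E + 4%:E * B)%E.
Proof.
rewrite /ramp_const; case: cid => C /= [C0 [f' [df cf fC f0]]].
exact: energy_estimate_const.
Qed.

Lemma ramp1 (s r t : R) : 0 < r -> s + r <= t -> ramp s r t = 1.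
Proof.
move=> r0 st; rewrite /ramp smoothstep1// -(ler_pM2l r0) mulrA divff ?gt_eqF//.
by rewrite mul1r mulr1; lra.
Qed.

Lemma ramp_ge0 (s r t : R) : 0 <= ramp s r t.
Proof. exact: smoothstep_ge0. Qed.

Lemma ramp_le1 (s r t : R) : ramp s r t <= 1.
Proof. exact: smoothstep_le1. Qed.

Lemma ramp_continuous (s r : R) : continuous (ramp s r).
Proof.
have [f' [C [_ df _ _ _]]] := smoothstep_derive R.
by move=> t; exact: is_derive_cont (is_derive_affine _ _ df t).
Qed.

Lemma measurable_ramp (s r : R) : measurable_fun setT (ramp s r).
Proof. by apply: continuous_measurable; exact: ramp_continuous. Qed.

Lemma tail_ramp (s r : R) (f : R -> R) : 0 < r -> measurable_fun setT f ->
  (forall t, s < t -> 0 <= f t) ->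
  (tail (s + r)%R f <= tail s (fun t => ramp s r t ^+ 2 * f t)%R)%E.
Proof.
move=> r0 mf f0.
have mrf : measurable_fun setT (fun t => ramp s r t ^+ 2 * f t).
  by apply: measurable_funM => //; apply: measurable_funX; exact: measurable_ramp.
have ssr : s <= s + r by rewrite lerDl ltW.
apply: (@le_trans _ _ (tail (s + r)%R (fun t => ramp s r t ^+ 2 * f t)%R)).
  apply: le_tail => // t st; rewrite ramp1 ?(ltW st)// expr1n mul1r lexx andbT.
  by apply: f0; exact: le_lt_trans st.
by apply: tail_anti => // t st; rewrite mulr_ge0 ?sqr_ge0 ?f0.
Qed.

Lemma tail_split (s h : R) (f : R -> R) : 0 <= h -> measurable_fun setT f ->
  (forall t, s < t -> 0 <= f t) ->
  (tail s f = \int[mu]_(t in `]s, (s + h)%R]) (f t)%:E + tail (s + h)%R f)%E.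
Proof.
move=> h0 mf f0; rewrite /tail -ge0_integral_setU//.
- congr (integral _ _ _); apply/seteqP; split => t /=; rewrite !in_itv/= !andbT.
    by move=> st; have [ht|ht] := leP t (s + h); [left; rewrite st|right].
  by case=> [/andP[]//|]; apply: le_lt_trans; rewrite lerDl.
- by apply/measurable_EFinP; exact: measurable_funTS.
- move=> t [] /=; rewrite !in_itv/= ?andbT lee_fin; first by case/andP => /f0.
  by move=> st; apply: f0; apply: le_lt_trans st; rewrite lerDl.
- apply/disj_setPS => t [] /=; rewrite !in_itv/= andbT => /andP[_ ts] st.
  by move: (le_lt_trans ts st); rewrite ltxx.
Qed.

End EnergyEstimateRamp.

(** * Decay of the L^2 tails and L^2 bound on first differences *)

Section BaseDecay.
Variables (R : realType) (H : completeNormedModType R).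
Local Notation mu := (@lebesgue_measure R).
Variable ip : {dot H for (idfun : R -> R)}.
Hypothesis hip : hilbert_inner ip.
Hypothesis sepH : separable_space H.
Variable A : {linear H -> H}.
Hypothesis contA : continuous A.
Hypothesis symA : self_adjoint ip A.
Implicit Types (u w : R -> H).

(** The global bound [C] gives integrability; the estimate itself uses the bound [V] valid on the
    interval only. *)
Lemma Rintegral_itv_le_local (f : R -> R) (C V s t : R) : measurable_fun setT f ->
  (forall x, `|f x| <= C) -> (forall x, s < x <= t -> `|f x| <= V) -> s <= t ->
  `|\int[mu]_(x in `]s, t]) f x| <= V * (t - s).
Proof.
move=> mf fC fV st; have fi : mu.-integrable `]s, t] (EFin \o f).
  by apply: integrableS (integrable_bounded_itv s t mf fC) => //; exact: subset_itv_oc_cc.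
rewrite (le_trans (le_normr_Rintegral _ fi))//.
have -> : V * (t - s) = \int[mu]_(x in `]s, t]) V.
  rewrite Rintegral_cst//= lebesgue_measure_itv/= lte_fin.
  by move: st; rewrite le_eqVlt => /predU1P[->|->]//=; rewrite ltxx subrr.
have Vi : mu.-integrable `]s, t] (EFin \o (fun=> V)).
  apply: integrableS (integrable_bounded_itv s t (measurable_cst V) (C := `|V|) _) => //.
  exact: subset_itv_oc_cc.
apply: (le_Rintegral _ _ Vi) => [//||x]; last by rewrite /= in_itv/=; exact: fV.
exact: integrable_norm.
Qed.

Lemma weak_sol_increment N u w (C V s t : R) : hmeas w -> (forall x, `|w x| <= C) ->
  0 < s -> s <= t -> ~ N s -> ~ N t -> (forall x, s < x <= t -> `|w x| <= V) ->
  0 <= V -> weak_sol ip A N u w -> `|A (u t) - A (u s)| <= V * (t - s).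
Proof.
move=> mw wC s0 st Ns Nt wV V0 sol; apply: (norm_le_ip hip).
  by rewrite mulr_ge0// subr_ge0.
move=> q; rewrite ipBl sol ?(lt_le_trans s0)//.
have mwq := hmeas_ip_cst hip sepH q mw.
rewrite (primB mwq (ip_bound hip q wC)) ?(ltW s0)//.
apply: le_trans (ler_norm _) _; rewrite mulrAC.
apply: (Rintegral_itv_le_local mwq (ip_bound hip q wC) _ st) => x /wV wx.
by rewrite (le_trans (ip_norm hip _ _))// ler_wpM2r.
Qed.

Lemma prim_increment_shift (f : R -> R) (C h s t : R) : measurable_fun setT f ->
  (forall x, `|f x| <= C) -> 0 <= h -> 0 <= s <= t ->
  prim (fun x => f (x + h)) t - prim (fun x => f (x + h)) s =
  prim f (t + h) - prim f (s + h).
Proof.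
move=> mf fC h0 /andP[s0 st].
have mfh : measurable_fun setT (fun x : R => f (x + h)).
  exact: (measurableT_comp mf (measurable_shift h)).
rewrite (primB mf fC); last by rewrite addr_ge0//= lerD2r.
rewrite (primB mfh (fun x => fC _)) ?s0//.
rewrite [LHS]Rintegral_mkcond [RHS]Rintegral_mkcond.
have gi : mu.-integrable setT (EFin \o (f \_ `](s + h), (t + h)])).
  have gi : mu.-integrable `](s + h), (t + h)] (EFin \o f).
    apply: integrableS (integrable_bounded_itv (s + h) (t + h) mf fC) => //.
    exact: subset_itv_oc_cc.
  by move: gi; rewrite integrable_mkcond// -restrict_EFin.
rewrite -(Rintegral_shift h gi); apply: eq_Rintegral => x _.
by rewrite !patchE !mem_setE !in_itv/= lerD2r ltrD2r.
Qed.

Lemma weak_sol_dif N u w (C h : R) : hmeas w -> (forall x, `|w x| <= C) -> 0 <= h ->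
  weak_sol ip A N u w ->
  weak_sol ip A (N `|` [set t | N (t + h)]) (dif h u) (dif h w).
Proof.
move=> mw wC h0 sol s t q s0 t0 /not_orP[Ns Nsh] /not_orP[Nt Nth].
wlog st : s t s0 t0 Ns Nsh Nt Nth / s <= t.
  move=> W; case/orP: (le_total s t) => st; first exact: W.
  by apply: oppr_inj; rewrite !opprB W.
have mwq := hmeas_ip_cst hip sepH q mw.
have mwhq := hmeas_ip_cst hip sepH q (hmeas_shift h mw).
have -> : prim (fun x => ip (dif h w x) q) t - prim (fun x => ip (dif h w x) q) s =
  (prim (fun x => ip (w (x + h)) q) t - prim (fun x => ip (w (x + h)) q) s) -
  (prim (fun x => ip (w x) q) t - prim (fun x => ip (w x) q) s).
  have pD v : prim (fun x => ip (dif h w x) q) v =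
      prim (fun x => ip (w (x + h)) q) v - prim (fun x => ip (w x) q) v.
    rewrite /prim -RintegralB//.
    - by apply: eq_Rintegral => x _; rewrite ipBl.
    - exact: integrable_bounded_itv mwhq (ip_bound hip q (fun x => wC (x + h))).
    - exact: integrable_bounded_itv mwq (ip_bound hip q wC).
  by rewrite !pD; ring.
rewrite (prim_increment_shift mwq (ip_bound hip q wC)) ?(ltW s0)//.
rewrite -(sol (s + h) (t + h) q) ?ltr_pwDl// -(sol s t q)//.
by rewrite /dif !linearB/= !ipBl; ring.
Qed.

(** With D = ramp_const a^2, a tail y bounded by D x, x being the mass on the preceding unit
    interval, contracts by D / (1 + D). The slightly larger ratio (1 + D) / (2 + D) stays positive
    when D = 0, so that its logarithm is meaningful. *)
Definition decay_ratio (a : R) : R := (1 + ramp_const R * a ^+ 2) / (2 + ramp_const R * a ^+ 2).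

(** The tails of |X|^2 decay at rate 4 c, their square roots at rate 2 c. Agmon multiplies such a
    square root by an L^2 bound on differences without decay and takes a root again, which leaves
    c. *)
Definition decay_rate (a : R) : R := - ln (decay_ratio a) / 4.

Lemma decay_ratio_itv a : 0 < decay_ratio a < 1.
Proof.
have D0 : 0 <= ramp_const R * a ^+ 2 by rewrite mulr_ge0 ?sqr_ge0 ?ramp_const_ge0.
by rewrite divr_gt0 ?ltr_pdivrMr ?mul1r ?ltrD2r ?ltr1n ?ltr_wpDr.
Qed.

Lemma decay_rate_gt0 a : 0 < decay_rate a.
Proof. by rewrite divr_gt0// oppr_gt0 ln_lt0// decay_ratio_itv. Qed.

Lemma expR_decay_rate a n : expR (- (4 * decay_rate a) * n%:R) = decay_ratio a ^+ n.
Proof.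
have /andP[k0 _] := decay_ratio_itv a.
by rewrite mulrC expRM_natl /decay_rate mulrC divfK// opprK lnK.
Qed.

Variable G : H -> H.

Lemma rhs_addK (z : H) : rhs G z + z = G z.
Proof. by rewrite /rhs addrAC addNr add0r. Qed.

Hypothesis G0 : G 0 = 0.
Hypothesis G4 : forall u v : H, `|G u - G v| <= 4^-1 * `|u - v|.
Variables (X : R -> H) (M : R) (N : set R).
Hypothesis mX : hmeas X.
Hypothesis XM : forall t, `|X t| <= M.
Hypothesis N0 : mu.-negligible N.
Hypothesis solX : weak_sol ip A N X (fun t => rhs G (X t)).

Let a := fine (opnorm A).
Let D := ramp_const R * a ^+ 2.

Let D0 : 0 <= D.
Proof. by rewrite mulr_ge0 ?sqr_ge0 ?ramp_const_ge0. Qed.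

Let M0 : 0 <= M := le_trans (normr_ge0 _) (XM 0).

Let rhsM t : `|rhs G (X t)| <= 2 * M.
Proof. by rewrite (le_trans (rhs_le G4 G0 _))// ler_wpM2l. Qed.

Let mX2 : measurable_fun setT (fun t => `|X t| ^+ 2).
Proof. by apply: measurable_funX; exact: hmeas_norm. Qed.

Let tail_step s : 0 < s -> (tail (s + 1)%R (fun t => `|X t| ^+ 2)%R <=
  D%:E * \int[mu]_(t in `]s, (s + 1)%R]) (`|X t| ^+ 2)%:E)%E.
Proof.
move=> s0; apply: (@le_trans _ _ _ _ _ (tail_ramp (@ltr01 R) mX2 _)) => //.
have := @energy_estimate R H ip hip sepH A contA symA N X _ M (2 * M) (cst 0) s 1 0%E
  mX (hmeas_rhs G4 mX) XM rhsM N0 solX s0 ltr01.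
rewrite expr1n divr1 mule0 adde0 => /(_ (measurable_cst _) (fun _ _ => lexx _)) En.
apply: le_trans (En _ _) _.
- move=> t _; rewrite addr0 rhs_addK.
  by have := G4 (X t) 0; rewrite G0 !subr0.
- rewrite /tail integral0_eq// => t _; by rewrite expr0n mulr0.
have -> : D%:E = ((ramp_const R)%:E * (a ^+ 2)%:E)%E by [].
rewrite -muleA lee_wpmul2l ?lee_fin ?ramp_const_ge0//.
have mAX : measurable_fun setT (fun t => `|A (X t)| ^+ 2).
  by apply: measurable_funX; apply: hmeas_norm; apply: hmeas_comp.
rewrite -integral_itv_obnd_cbnd; last first.
  by apply/measurable_EFinP; exact: measurable_funTS.
rewrite -ge0_integralZl//.
- apply: ge0_le_integral => //.
  + by apply/measurable_EFinP; exact: measurable_funTS.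
  + by apply/measurable_EFinP; apply: measurable_funTS; exact: measurable_funM.
  + by move=> t _; rewrite -EFinM lee_fin -exprMn norm_le_sqr// normr_id opnorm_le.
- by apply/measurable_EFinP; exact: measurable_funTS.
- by rewrite lee_fin sqr_ge0.
Qed.

Let mass s : (\int[mu]_(t in `]s, (s + 1)%R]) (`|X t| ^+ 2)%:E <= (M ^+ 2)%:E)%E.
Proof.
apply: (@le_trans _ _ (\int[mu]_(t in `]s, (s + 1)%R]) (M ^+ 2)%:E)%E).
  apply: ge0_le_integral => //.
  - by apply/measurable_EFinP; exact: measurable_funTS.
  - by move=> t _; rewrite lee_fin norm_le_sqr// normr_id.
rewrite integral_cst// [X in (_ * X)%E]lebesgue_measure_itv /= lte_fin ltrDl ltr01.
by rewrite -EFinB addrAC subrr add0r mule1.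
Qed.

Let tail_fin s : 0 < s -> exists x y : R, [/\ 0 <= x <= M ^+ 2, 0 <= y <= D * x,
  tail (s + 1) (fun t => `|X t| ^+ 2) = y%:E & tail s (fun t => `|X t| ^+ 2) = (x + y)%:E].
Proof.
move=> s0; have := tail_step s0; have := mass s.
have X20 t : s < t -> 0 <= `|X t| ^+ 2 by rewrite sqr_ge0.
have X21 t : s + 1 < t -> 0 <= `|X t| ^+ 2 by rewrite sqr_ge0.
rewrite (tail_split (@ler01 R) mX2 X20).
have : (0 <= \int[mu]_(t in `]s, (s + 1)%R]) (`|X t| ^+ 2)%:E)%E.
  by apply: integral_ge0 => t _; rewrite lee_fin sqr_ge0.
case: integral => [x||]; rewrite ?leNye ?leye_eq//.
rewrite !lee_fin => x0 xM; have := tail_ge0 X21; rewrite -EFinM.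
case: tail => [y||]; rewrite ?leNye ?leye_eq// !lee_fin => y0 yD.
by exists x, y; rewrite x0 y0 yD xM EFinD.
Qed.

Lemma tail_contraction s : 0 < s ->
  (tail (s + 1)%R (fun t => `|X t| ^+ 2)%R <= (decay_ratio a)%:E * tail s (fun t => `|X t| ^+ 2)%R)%E.
Proof.
move=> /tail_fin[x [y [/andP[x0 _] /andP[y0 yD] -> ->]]]; rewrite -EFinM lee_fin.
rewrite /decay_ratio -/D mulrAC ler_pdivlMr ?ltr_wpDr//.
move: (mulr_ge0 D0 x0) (mulr_ge0 D0 y0) => Dx Dy; nra.
Qed.

Lemma tail_iter n s : 0 < s ->
  (tail (s + n%:R)%R (fun t => `|X t| ^+ 2)%R <= (decay_ratio a ^+ n * (M ^+ 2 * (1 + D)))%:E)%E.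
Proof.
have /andP[k0 _] := decay_ratio_itv a.
move=> s0; elim: n => [|n IH].
  rewrite addr0 expr0 mul1r; have [x [y [/andP[x0 xM] /andP[_ yD] _ ->]]] := tail_fin s0.
  by rewrite lee_fin mulrDr mulr1 lerD// (le_trans yD)// mulrC ler_wpM2r.
rewrite -natr1 addrA (le_trans (tail_contraction _)) ?ltr_wpDr//.
by rewrite exprS -mulrA (EFinM (decay_ratio a)) lee_wpmul2l// lee_fin ltW.
Qed.

Lemma tail_decay t : 0 < t -> (tail t (fun t => `|X t| ^+ 2)%R <=
  (M ^+ 2 * (1 + D) * expR (8 * decay_rate a) * expR (- (4 * decay_rate a) * t))%:E)%E.
Proof.
(* The predecessor keeps t - n positive, as the iteration must start at a positive time. Since n >=
   t - 2, at most the factor exp(8 c) is lost. *)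
move=> t0; pose n := (Num.truncn t).-1.
have [nt tn] : n%:R < t /\ t - 2 <= n%:R.
  have := truncn_itv (ltW t0); rewrite /n; case: Num.truncn => [|m] /=.
    by rewrite t0 => /andP[_ ?]; split => //; lra.
  move=> /andP[mt tm]; split; first by rewrite (lt_le_trans _ mt)// ltr_nat.
  by move: tm; rewrite -!natr1; lra.
have := @tail_iter n (t - n%:R); rewrite subr_gt0 subrK => /(_ nt) /le_trans; apply.
rewrite lee_fin mulrC -mulrA ler_wpM2l//.
  by rewrite mulr_ge0 ?sqr_ge0 ?addr_ge0.
rewrite -expR_decay_rate -expRD ler_expR.
have := decay_rate_gt0 a; nra.
Qed.

(** The energy estimate is applied on [t/2, t] without source, [G] being 1/4-Lipschitz. There |A
    (dif h X)| <= 2 M h almost everywhere, and 4 / t^2 times (2 M h)^2 times t / 2 is 8 M^2 h^2 /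
    t. *)
Lemma tail_dif_bound t h : 0 < t -> 0 <= h -> (tail t (fun t => `|dif h X t| ^+ 2)%R <=
  (8 * ramp_const R * M ^+ 2 / t * h ^+ 2)%:E)%E.
Proof.
move=> t0 h0; have r0 : 0 < t / 2 by rewrite divr_gt0.
have mdX := hmeas_dif sepH h mX.
have mdX2 : measurable_fun setT (fun t => `|dif h X t| ^+ 2)%R.
  by apply: measurable_funX; exact: hmeas_norm.
have dX x : `|dif h X x| <= 2 * M.
  by rewrite (le_trans (ler_normB _ _))// (_ : 2 * M = M + M) ?lerD//; ring.
have mw := hmeas_rhs G4 mX.
have dw x : `|dif h (fun t => rhs G (X t)) x| <= 2 * (2 * M).
  by rewrite (le_trans (ler_normB _ _))// (_ : 2 * (2 * M) = 2 * M + 2 * M) ?lerD//; ring.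
have Nh := negligibleU N0 (negligible_shift h N0).
have sold := weak_sol_dif mw rhsM h0 solX.
rewrite {1}(splitr t); apply: le_trans (tail_ramp r0 mdX2 _) _ => //.
have := @energy_estimate R H ip hip sepH A contA symA _ _ _ _ _ (cst 0) (t / 2) (t / 2) 0%E
  mdX (hmeas_dif sepH h mw) dX dw Nh sold r0 r0.
rewrite mule0 adde0 => /(_ (measurable_cst _) (fun _ _ => lexx _)) En.
apply: le_trans (En _ _) _.
- by move=> x _; rewrite addr0 /dif addrACA -opprD !rhs_addK; exact: G4.
- by rewrite /tail integral0_eq// => x _; rewrite expr0n mulr0.
apply: (@le_trans _ _ ((ramp_const R / (t / 2) ^+ 2)%:E *
    \int[mu]_(x in `[(t / 2)%R, (t / 2 + t / 2)%R]) ((2 * M * h) ^+ 2)%:E)%E).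
  rewrite lee_wpmul2l ?lee_fin ?divr_ge0 ?sqr_ge0 ?ramp_const_ge0//.
  apply: ae_ge0_le_integral => //.
  - apply/measurable_EFinP; apply: measurable_funTS; apply: measurable_funX.
    by apply: hmeas_norm; apply: hmeas_comp.
  - by move=> x _; rewrite lee_fin sqr_ge0.
  - apply: negligibleS Nh => x /= xN; apply: contrapT => /not_orP[Nx Nxh]; apply: xN.
    rewrite /= in_itv/= => /andP[x0 _]; rewrite lee_fin norm_le_sqr// normr_id.
    have xp := lt_le_trans r0 x0.
    have := weak_sol_increment mw rhsM xp _ Nx Nxh (fun y _ => rhsM y) _ solX.
    rewrite /dif linearB/= addrAC subrr add0r; apply; rewrite ?lerDl ?mulr_ge0//.
rewrite integral_cst//= [X in (_ * (_ * X))%E]lebesgue_measure_itv /= lte_fin ltrDl r0.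
rewrite -EFinB addrK -!EFinM lee_fin; apply: eq_imp_le; field.
by rewrite gt_eqF.
Qed.

End BaseDecay.

(** * Pointwise bounds and continuity *)

Section Agmon.
Variables (R : realType) (H : completeNormedModType R).
Local Notation mu := (@lebesgue_measure R).
Hypothesis sepH : separable_space H.
Implicit Types (F : R -> H).

Lemma measurable_norm2 F : hmeas F -> measurable_fun setT (fun t => `|F t| ^+ 2).
Proof. by move=> mF; apply: measurable_funX; exact: hmeas_norm. Qed.

(* [|F x|^2 - |F (x+l)|^2 <= |dif l F x| (|F x| + |F (x+l)|)], and AM-GM with the weight [2 be / (al l)]. *)
Lemma agmon_mean F (t l al be : R) : hmeas F -> 0 < l -> 0 < al -> 0 < be ->
  (tail t (fun x => `|F x| ^+ 2)%R <= (be ^+ 2)%:E)%E ->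
  (tail t (fun x => `|dif l F x| ^+ 2)%R <= ((al * l) ^+ 2)%:E)%E ->
  (\int[mu]_(x in `]t, (t + l)%R]) (`|F x| ^+ 2)%:E <= (2 * al * be * l)%:E)%E.
Proof.
move=> mF l0 al0 be0 Fb dFb.
have mF2 := measurable_norm2 mF.
have mFl := hmeas_shift l mF; have mFl2 := measurable_norm2 mFl.
have mdF2 := measurable_norm2 (hmeas_dif sepH l mF).
pose m := (2 * be) / (al * l).
have m0 : 0 < m by rewrite divr_gt0 ?mulr_gt0.
have mE : m = (2 * be) / (al * l) by [].
clearbody m.
have pw x : `|F x| ^+ 2 <= `|F (x + l)| ^+ 2 +
    (m / 2 * `|dif l F x| ^+ 2 + m^-1 * (`|F x| ^+ 2 + `|F (x + l)| ^+ 2)).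
  have nd : `|F x| <= `|F (x + l)| + `|dif l F x|.
    by rewrite -lerBlDl (le_trans (lerB_dist _ _))// distrC.
  have nd' : `|dif l F x| <= `|F x| + `|F (x + l)| by rewrite addrC ler_normB.
  move: nd nd' (normr_ge0 (F x)) (normr_ge0 (F (x + l))) (normr_ge0 (dif l F x)).
  move: `|F x| `|F (x + l)| `|dif l F x| => a b d ab abd a0 b0 d0.
  have am : d * (a + b) <= m / 2 * d ^+ 2 + m^-1 * (a ^+ 2 + b ^+ 2).
    rewrite -subr_ge0 (_ : _ - _ = m^-1 / 2 * ((m * d - (a + b)) ^+ 2 + (a - b) ^+ 2)); last first.
      by field; rewrite gt_eqF.
    by rewrite mulr_ge0 ?addr_ge0 ?sqr_ge0// divr_ge0// invr_ge0 ltW.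
  rewrite -lerBlDl; apply: le_trans am; nra.
have t_shift : tail t (fun x => `|F (x + l)| ^+ 2)%R = tail (t + l)%R (fun x => `|F x| ^+ 2)%R.
  by rewrite (tail_shift (F := fun x => `|F x| ^+ 2)).
have le1 : (tail (t + l)%R (fun x => `|F x| ^+ 2)%R <= (be ^+ 2)%:E)%E.
  by apply: le_trans Fb; apply: tail_anti => //; rewrite lerDl ltW.
(* After integration the shifted square becomes the tail from t + l; the two tails differ by the
   window ]t, t + l], the quantity to be bounded. *)
have : (tail t (fun x => `|F x| ^+ 2)%R <= tail (t + l)%R (fun x => `|F x| ^+ 2)%R +
   ((m / 2)%:E * tail t (fun x => `|dif l F x| ^+ 2)%R + (m^-1)%:E *
    (tail t (fun x => `|F x| ^+ 2)%R + tail (t + l)%R (fun x => `|F x| ^+ 2)%R)))%E.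
  have m1 : measurable_fun setT (fun x => `|F x| ^+ 2 + `|F (x + l)| ^+ 2) by exact: measurable_funD.
  have m2 : measurable_fun setT (fun x => m / 2 * `|dif l F x| ^+ 2) by exact: measurable_funM.
  have m3 : measurable_fun setT (fun x => m^-1 * (`|F x| ^+ 2 + `|F (x + l)| ^+ 2)) by exact: measurable_funM.
  have m4 : measurable_fun setT (fun x => m / 2 * `|dif l F x| ^+ 2 + m^-1 * (`|F x| ^+ 2 + `|F (x + l)| ^+ 2)) by exact: measurable_funD.
  have p1 x : 0 <= `|F x| ^+ 2 + `|F (x + l)| ^+ 2 by rewrite addr_ge0 ?sqr_ge0.
  have p2 x : 0 <= m / 2 * `|dif l F x| ^+ 2 by rewrite mulr_ge0 ?sqr_ge0 ?divr_ge0 ?(ltW m0).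
  have p3 x : 0 <= m^-1 * (`|F x| ^+ 2 + `|F (x + l)| ^+ 2).
    by rewrite mulr_ge0 ?p1// invr_ge0 ltW.
  rewrite -t_shift -tailD// -(@tailZ R t _ m^-1 m1)//; last by rewrite invr_ge0 ltW.
  rewrite -(@tailZ R t _ (m / 2) mdF2)//; last by rewrite divr_ge0 ?(ltW m0).
  rewrite -tailD// -tailD//; last by move=> x _; rewrite addr_ge0.
  apply: le_tail => //; first exact: measurable_funD.
  by move=> x _; rewrite sqr_ge0/=; exact: pw.
rewrite (@tail_split R t l _ (ltW l0) mF2)//.
have I0 : (0 <= \int[mu]_(x in `]t, (t + l)%R]) (`|F x| ^+ 2)%:E)%E.
  exact: integral_ge0.
have T0 : (0 <= tail (t + l)%R (fun x => `|F x| ^+ 2)%R)%E.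
  exact: tail_ge0.
have d0 : (0 <= tail t (fun x => `|dif l F x| ^+ 2)%R)%E.
  exact: tail_ge0.
move: Fb dFb le1; rewrite (@tail_split R t l _ (ltW l0) mF2)//.
move: I0 T0 d0; case: integral => [i||]; case: (tail (t + l) _) => [v||]; case: (tail t _) => [d||] //=;
rewrite ?leNye ?leye_eq//.
rewrite -!EFinD !lee_fin => i0 v0 d0 Fb dFb vb.
rewrite (addrC i) lerD2l -(addrC i) => /le_trans; apply.
have -> : 2 * al * be * l = m / 2 * (al * l) ^+ 2 + m^-1 * (be ^+ 2 + be ^+ 2).
  by rewrite mE; field; rewrite !gt_eqF.
rewrite lerD// ler_wpM2l ?lerD// ?invr_ge0 ?divr_ge0 ?(ltW m0)//.
Qed.

Lemma agmon F (t al be : R) : hmeas F -> {for t, continuous F} -> 0 < al -> 0 < be ->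
  (tail t (fun x => `|F x| ^+ 2)%R <= (be ^+ 2)%:E)%E ->
  (forall l : R, 0 < l <= 1 -> (tail t (fun x => `|dif l F x| ^+ 2)%R <= ((al * l) ^+ 2)%:E)%E) ->
  `|F t| ^+ 2 <= 2 * al * be.
Proof.
move=> mF cF al0 be0 Fb dFb; rewrite leNgt; apply/negP => lt.
pose g := (2 * al * be + `|F t| ^+ 2) / 2.
have : \forall x \near t, g < `|F x| ^+ 2.
  have cn : (fun x => `|F x| ^+ 2) x @[x --> t] --> `|F t| ^+ 2.
    by apply: cvgM; apply: cvg_norm; exact: cF.
  by apply: cvgr_gt cn _ _; rewrite /g; lra.
move=> /nbhs_ballP[e /= e0 eg].
pose l := Num.min (e / 2) 1.
have l0 : 0 < l by rewrite lt_min divr_gt0/=.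
have le : l <= e / 2 by rewrite ge_min lexx.
have l1 : l <= 1 by rewrite ge_min lexx orbT.
have := agmon_mean mF l0 al0 be0 Fb (dFb l _); rewrite l0 l1 => /(_ isT).
apply/negP; rewrite -ltNge.
apply: (@lt_le_trans _ _ (\int[mu]_(x in `]t, (t + l)%R]) g%:E)%E).
  rewrite integral_cst//= [X in (_ * X)%E]lebesgue_measure_itv /= lte_fin ltrDl l0.
  by rewrite -EFinB addrAC subrr add0r -EFinM lte_fin ltr_pM2r// /g; lra.
apply: ge0_le_integral => //.
- by move=> x _; rewrite lee_fin /g divr_ge0// addr_ge0 ?sqr_ge0// !mulr_ge0// ltW.
- by apply/measurable_EFinP; apply: measurable_funTS; exact: measurable_norm2.
move=> x /=; rewrite in_itv/= => /andP[tx xl]; rewrite lee_fin ltW//; apply: eg.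
by rewrite /ball/= ltr_norml; apply/andP; split; lra.
Qed.

End Agmon.

Lemma sqr_normB_le (R : realType) (V : normedModType R) (u v : V) :
  `|u - v| ^+ 2 <= 2 * `|u| ^+ 2 + 2 * `|v| ^+ 2.
Proof.
apply: (@le_trans _ _ ((`|u| + `|v|) ^+ 2)).
  by rewrite norm_le_sqr// normr_id ler_normB.
have := sqr_ge0 (`|u| - `|v|); lra.
Qed.

Section ContinuousRepresentative.
Variables (R : realType) (H : completeNormedModType R).
Local Notation mu := (@lebesgue_measure R).
Variable ip : {dot H for (idfun : R -> R)}.
Hypothesis hip : hilbert_inner ip.
Hypothesis sepH : separable_space H.
Implicit Types (X : R -> H).

Lemma dense_ip_norm (d : nat -> H) (v : H) (c : R) : 0 <= c ->
  (forall (z : H) (e : R), 0 < e -> exists k, `|z - d k| < e) ->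
  (forall k, ip v (d k) <= c * `|d k|) -> `|v| <= c.
Proof.
move=> c0 dd vd; apply: (norm_le_ip hip c0) => q; apply/ler_addgt0Pr => e e0.
have e1 : 0 < e / (`|v| + c + 1) by rewrite divr_gt0// ltr_wpDl// addr_ge0.
have [k qk] := dd q _ e1.
rewrite -[q in ip v q](subrK (d k)) ipDr//.
have h1 : ip v (q - d k) <= `|v| * `|q - d k| by exact: (ip_le hip).
have h2 : `|d k| <= `|q| + `|q - d k|.
  by rewrite -lerBlDl (le_trans (lerB_dist _ _))// distrC.
have h3 : (`|v| + c) * `|q - d k| <= e.
  apply: (@le_trans _ _ ((`|v| + c + 1) * `|q - d k|)); first by rewrite ler_wpM2r// lerDl.
  by rewrite mulrC -ler_pdivlMr ?ltW// ltr_wpDl// addr_ge0.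
have h4 := vd k.
have h5 : c * `|d k| <= c * (`|q| + `|q - d k|) by rewrite ler_wpM2l.
move: h1 h3 h4 h5; move: (ip v _) (ip v _) => i j; nra.
Qed.

Variables (X : R -> H) (M K : R).
Hypothesis mX : hmeas X.
Hypothesis XM : forall t, `|X t| <= M.
Hypothesis K0 : 0 < K.
Hypothesis dX : forall t h : R, 0 < t -> 0 <= h ->
  (tail t (fun x => `|dif h X x| ^+ 2)%R <= (K / t * h ^+ 2)%:E)%E.

Let mean_dif (t h l : R) : 0 < t -> 0 < h -> 0 < l ->
  (\int[mu]_(x in `]t, (t + l)%R]) (`|dif h X x| ^+ 2)%:E <= (4 * (K / t) * h * l)%:E)%E.
Proof.
move=> t0 h0 l0; pose b := Num.sqrt (K / t).
have Kt : 0 < K / t by rewrite divr_gt0.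
have b0 : 0 < b by rewrite sqrtr_gt0.
have b2 : K / t = b ^+ 2 by rewrite sqr_sqrtr// ltW.
have -> : 4 * (K / t) * h * l = 2 * (2 * b) * (b * h) * l by rewrite b2; ring.
have mdl := hmeas_dif sepH l mX; have mdl2 := measurable_norm2 mdl.
have mdlh := hmeas_shift h mdl; have mdlh2 := measurable_norm2 mdlh.
apply: (agmon_mean sepH (hmeas_dif sepH h mX)) => //; rewrite ?mulr_gt0//.
  by rewrite exprMn -b2; exact: dX (ltW h0).
have -> : ((2 * b * l) ^+ 2)%:E = (2%:E * (K / t * l ^+ 2)%:E + 2%:E * (K / t * l ^+ 2)%:E)%E.
  by rewrite b2 -!EFinM -EFinD; congr _%:E; ring.
apply: (@le_trans _ _ (2%:E * tail t (fun x => `|dif l X (x + h)| ^+ 2)%R +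
   2%:E * tail t (fun x => `|dif l X x| ^+ 2)%R)%E).
  rewrite -!tailZ// -tailD//; do ?[exact: measurable_funM|by move=> x _; rewrite mulr_ge0 ?sqr_ge0].
  apply: le_tail.
  - exact: measurable_norm2 (hmeas_dif sepH l (hmeas_dif sepH h mX)).
  - by apply: measurable_funD; exact: measurable_funM.
  move=> x _; rewrite sqr_ge0/=.
  have -> : dif l (dif h X) x = dif l X (x + h) - dif l X x.
    by rewrite -[LHS]/(difs [:: h; l] X x) difs_consE.
  exact: sqr_normB_le.
rewrite leeD// lee_wpmul2l//; last exact: dX (ltW l0).
rewrite (tail_shift (F := fun x => `|dif l X x| ^+ 2))//.
apply: le_trans (tail_anti _ _ _) (dX t0 (ltW l0)) => //.
by rewrite lerDl ltW.
Qed.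

Let good_holder (d : nat -> H) s t :
  (forall (z : H) (e : R), 0 < e -> exists k, `|z - d k| < e) ->
  0 < s -> s <= t -> (forall k, lebesgue_pt (fun x => ip (X x) (d k)) s) ->
  (forall k, lebesgue_pt (fun x => ip (X x) (d k)) t) ->
  `|X t - X s| <= 2 * Num.sqrt (K / s * (t - s)).
Proof.
move=> dd s0; rewrite le_eqVlt => /predU1P[->|st] sL tL.
  by rewrite subrr normr0 mulr_ge0 ?sqrtr_ge0.
pose h := t - s; have h0 : 0 < h by rewrite subr_gt0.
pose b := Num.sqrt (K / s * h).
have Ksh : 0 < K / s * h by rewrite mulr_gt0// divr_gt0.
have b0 : 0 < b by rewrite sqrtr_gt0.
have b2 : K / s * h = b ^+ 2 by rewrite sqr_sqrtr// ltW.
rewrite -/b; apply: (dense_ip_norm _ dd); first by rewrite mulr_ge0 ?ltW.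
move=> k; pose f x := ip (X x) (d k).
have mf : measurable_fun setT f := hmeas_ip_cst hip sepH (d k) mX.
have fC : forall x, `|f x| <= M * `|d k| := ip_bound hip (d k) XM.
pose l n : R := n.+1%:R^-1.
have l0 n : 0 < l n by rewrite invr_gt0.
have ln0 n : l n != 0 by rewrite gt_eqF.
have lcv : l n @[n --> \oo] --> (0 : R) by exact: cvg_harmonic.
have t0 := lt_trans s0 st.
have cvs := lebesgue_pt_quotient mf fC s0 (sL k) ln0 lcv.
have cvt := lebesgue_pt_quotient mf fC t0 (tL k) ln0 lcv.
have cv : (l n)^-1 * (prim f (t + l n) - prim f t) - (l n)^-1 * (prim f (s + l n) - prim f s)
    @[n --> \oo] --> f t - f s by exact: cvgB.
have cc : (2 * b * `|d k|) @[n --> \oo] --> 2 * b * `|d k| by exact: cvg_cst.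
rewrite ipBl; apply: (ler_cvg_to cv cc); apply: nearW => n /=.
rewrite -mulrBr ler_pdivrMl//.
have -> : prim f (t + l n) = prim f (s + l n + h) by congr (prim f _); rewrite /h; ring.
have -> : prim f t = prim f (s + h) by congr (prim f _); rewrite /h; ring.
rewrite (_ : _ - _ - _ = (prim f (s + l n + h) - prim f (s + h)) - (prim f (s + l n) - prim f s)); last by ring.
have sl : 0 <= s <= s + l n by rewrite (ltW s0) lerDl ltW.
rewrite -(prim_increment_shift mf fC (ltW h0) sl).
have mfh : measurable_fun setT (fun x : R => f (x + h)).
  exact: (measurableT_comp mf (measurable_shift h)).
rewrite (primB mf fC sl) (primB mfh (fun x => fC _) sl).
have I (g : R -> R) : measurable_fun setT g -> (forall x, `|g x| <= M * `|d k|) ->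
    mu.-integrable `]s, s + l n] (EFin \o g).
  move=> mg gC; apply: integrableS (integrable_bounded_itv s (s + l n) mg gC) => //.
  exact: subset_itv_oc_cc.
rewrite -RintegralB//; [|exact: I..].
have mdX2 : measurable_fun setT (fun x => `|dif h X x| ^+ 2).
  exact: measurable_norm2 (hmeas_dif sepH h mX).
have := mean_dif s0 h0 (l0 n).
pose D x := `|d k| * (b + (4 * b)^-1 * `|dif h X x| ^+ 2).
have mD : measurable_fun setT D.
  by apply: measurable_funM => //; apply: measurable_funD => //; exact: measurable_funM.
have D0 x : 0 <= D x by rewrite mulr_ge0// addr_ge0 ?(ltW b0)// mulr_ge0 ?sqr_ge0// invr_ge0 mulr_ge0 ?(ltW b0).
have fD x : f (x + h) - f x <= D x.
  rewrite /f -ipBl// (le_trans (ip_le hip _ _))// mulrC ler_wpM2l//.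
  rewrite -/(dif h X x) -subr_ge0 (_ : _ - _ = (4 * b)^-1 * (`|dif h X x| - 2 * b) ^+ 2); last first.
    by field; rewrite gt_eqF.
  by rewrite mulr_ge0 ?sqr_ge0// invr_ge0 mulr_ge0 ?(ltW b0).
move=> Iint.
have ID : (\int[mu]_(x in `]s, (s + l n)%R]) (D x)%:E <= (2 * b * `|d k| * l n)%:E)%E.
  apply: (@le_trans _ _ ((`|d k|)%:E * (b%:E * (l n)%:E + ((4 * b)^-1)%:E *
     \int[mu]_(x in `]s, (s + l n)%R]) (`|dif h X x| ^+ 2)%:E))%E).
    rewrite /D; under eq_integral do rewrite EFinM.
    rewrite ge0_integralZl//; last 2 first.
      by apply/measurable_EFinP; apply: measurable_funTS; apply: measurable_funD => //; exact: measurable_funM.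
      by move=> x _; rewrite lee_fin addr_ge0 ?(ltW b0)// mulr_ge0 ?sqr_ge0// invr_ge0 mulr_ge0 ?(ltW b0).
    rewrite lee_wpmul2l//; under eq_integral do rewrite EFinD.
    rewrite ge0_integralD//; last 3 first.
      by move=> x _; rewrite lee_fin ltW.
      by move=> x _; rewrite lee_fin mulr_ge0 ?sqr_ge0// invr_ge0 mulr_ge0 ?(ltW b0).
      by apply/measurable_EFinP; apply: measurable_funTS; exact: measurable_funM.
    rewrite integral_cst//= [X in (_ * X + _)%E]lebesgue_measure_itv /= lte_fin ltrDl l0.
    rewrite -EFinB addrAC subrr add0r leeD2l//.
    under eq_integral do rewrite EFinM.
    rewrite ge0_integralZl//.
      by apply/measurable_EFinP; exact: measurable_funTS.
    by rewrite lee_fin invr_ge0 mulr_ge0 ?(ltW b0).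
  have -> : 2 * b * `|d k| * l n = `|d k| * (b * l n + (4 * b)^-1 * (4 * (K / s) * h * l n)).
    rewrite -(mulrA 4) b2; move: (`|d k|) (l n) => x y.
    by field; rewrite gt_eqF.
  rewrite [leRHS]EFinM lee_wpmul2l// [leRHS]EFinD leeD2l// [leRHS]EFinM lee_wpmul2l//.
  by rewrite lee_fin invr_ge0 mulr_ge0 ?(ltW b0).
have iD : mu.-integrable `]s, (s + l n)] (EFin \o D).
  apply/integrableP; split; first by apply/measurable_EFinP; exact: measurable_funTS.
  apply: le_lt_trans (ltry (2 * b * `|d k| * l n)); apply: le_trans ID.
  rewrite le_eqVlt; apply/orP; left; apply/eqP; apply: eq_integral => x _.
  by rewrite /= ger0_norm.
apply: (@le_trans _ _ (\int[mu]_(x in `]s, (s + l n)%R]) D x)).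
  apply: le_Rintegral => //.
  have := @integrableB _ _ _ mu _ (measurable_itv _) _ _ (I _ mfh (fun x => fC _)) (I _ mf fC).
  by apply: eq_integrable => // x _ /=; rewrite EFinB.
rewrite [leRHS]mulrC -lee_fin fineK//; exact: integrable_fin_num.
Qed.

Lemma sqrt_small (C e : R) : 0 < C -> 0 < e ->
  exists2 del : R, 0 < del & forall r, r < del -> 2 * Num.sqrt (C * r) < e.
Proof.
move=> C0 e0; exists ((e / 2) ^+ 2 / C) => [|r]; first by rewrite divr_gt0// exprn_gt0// divr_gt0.
rewrite ltr_pdivlMr// mulrC => Cr.
rewrite mulrC -ltr_pdivlMr// -[ltRHS]ger0_norm ?divr_ge0 ?ltW// -sqrtr_sqr.
by rewrite ltr_sqrt// exprn_gt0// divr_gt0.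
Qed.

Lemma within_ae_proper (P : R -> Prop) (t : R) : {ae mu, forall t, P t} ->
  ProperFilter (within P (nbhs t)).
Proof.
move=> aeP; apply: Build_ProperFilter_ex => A /nbhs_ballP[e /= e0 eA].
have [x /andP[tx xe] Px] : exists2 x, t < x < t + e & P x.
  by apply: lebesgue_ae_exists aeP _; rewrite ltrDl.
by exists x; apply: eA => //; rewrite /ball/= ltr_norml; apply/andP; split; lra.
Qed.

Lemma continuous_representative : exists y : R -> H, [/\ hmeas y,
  forall t, `|y t| <= M, {ae mu, forall t, 0 < t -> y t = X t} &
  forall t, 0 < t -> {for t, continuous y}].
Proof.
have [d dd] := dense_seq sepH.
pose P t := forall k, lebesgue_pt (fun x => ip (X x) (d k)) t.
have aeP : {ae mu, forall t, P t}.
  have : {ae mu, forall t, forall i, [set: nat] i -> lebesgue_pt (fun x => ip (X x) (d i)) t}.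
    apply: lebesgue_ae_countable => [|i _]; first exact: countableP.
    exact: ae_lebesgue_pt (hmeas_ip_cst hip sepH (d i) mX) (ip_bound hip (d i) XM).
  by apply: lebesgue_aeS => t tL i; exact: tL.
have holder (tau s t : R) : 0 < tau -> tau <= s -> tau <= t -> P s -> P t ->
    `|X t - X s| <= 2 * Num.sqrt (K / tau * `|t - s|).
  move=> tau0; wlog st : s t / s <= t.
    move=> W taus taut Ps Pt; case/orP: (le_total s t) => st; first exact: W.
    by rewrite distrC (distrC t); exact: W.
  move=> taus taut Ps Pt; have s0 := lt_le_trans tau0 taus.
  rewrite (le_trans (good_holder dd s0 st Ps Pt))// ler_wpM2l//.
  rewrite ger0_norm ?subr_ge0// ler_sqrt; last by rewrite mulr_ge0 ?subr_ge0// divr_ge0 ?ltW.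
  by rewrite ler_wpM2r ?subr_ge0// ler_pM2l// lef_pV2.
have FF (t : R) : ProperFilter (within P (nbhs t)) := within_ae_proper t aeP.
have cvX (t : R) : 0 < t -> cvg (X x @[x --> within P (nbhs t)]).
  move=> t0; apply: cauchy_cvg; apply: cauchy_exP => e e0.
  have t2 : 0 < t / 2 by rewrite divr_gt0.
  have Kt : 0 < K / (t / 2) by rewrite divr_gt0.
  have [del del0 small] := sqrt_small Kt e0.
  pose m := Num.min (del / 2) (t / 2).
  have m0 : 0 < m by rewrite lt_min t2 divr_gt0.
  have m1 : m <= del / 2 by rewrite ge_min lexx.
  have m2 : m <= t / 2 by rewrite ge_min lexx orbT.
  have [s /andP[ts st] Ps] : exists2 s, t < s < t + m & P s.
    by apply: lebesgue_ae_exists aeP _; rewrite ltrDl.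
  exists (X s); apply/nbhs_ballP; exists m => //= x tx Px.
  rewrite -ball_normE/= distrC; move: tx; rewrite /ball/= ltr_norml => /andP[x1 x2].
  have sh : t / 2 <= s by lra.
  have xh : t / 2 <= x by lra.
  apply: le_lt_trans (holder (t / 2) s x t2 sh xh Ps Px) _.
  by apply: small; rewrite ltr_norml; apply/andP; split; lra.
pose y0 (t : R) := lim (X x @[x --> within P (nbhs t)]).
have y0cv (t : R) : 0 < t -> X x @[x --> within P (nbhs t)] --> y0 t by move=> /cvX.
have holderA (tau s t : R) : 0 < tau -> tau <= s -> tau < t -> P s ->
    `|y0 t - X s| <= 2 * Num.sqrt (K / tau * `|t - s|).
  move=> tau0 taus taut Ps; have t0 := lt_trans tau0 taut.
  have c1 : `|X x - X s| @[x --> within P (nbhs t)] --> `|y0 t - X s|.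
    by apply: cvg_norm; apply: cvgB; [exact: y0cv|exact: cvg_cst].
  have c2 : 2 * Num.sqrt (K / tau * `|x - s|) @[x --> within P (nbhs t)] -->
      2 * Num.sqrt (K / tau * `|t - s|).
    apply: cvg_within_filter; apply: cvgM; first exact: cvg_cst.
    apply: (@continuous_cvg _ _ _ _ _ _ Num.sqrt); first exact: sqrt_continuous.
    apply: cvgM; first exact: cvg_cst.
    by apply: cvg_norm; apply: cvgB; [exact: cvg_id|exact: cvg_cst].
  apply: (ler_cvg_to c1 c2); rewrite near_withinE; near=> x => Px.
  by apply: holder => //; near: x; move: (lt_nbhsr taut); apply: filterS => z; exact: ltW.
have holderB (tau s t : R) : 0 < tau -> tau < s -> tau < t ->
    `|y0 t - y0 s| <= 2 * Num.sqrt (K / tau * `|t - s|).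
  move=> tau0 taus taut; have s0 := lt_trans tau0 taus.
  have c1 : `|y0 t - X x| @[x --> within P (nbhs s)] --> `|y0 t - y0 s|.
    by apply: cvg_norm; apply: cvgB; [exact: cvg_cst|exact: y0cv].
  have c2 : 2 * Num.sqrt (K / tau * `|t - x|) @[x --> within P (nbhs s)] -->
      2 * Num.sqrt (K / tau * `|t - s|).
    apply: cvg_within_filter; apply: cvgM; first exact: cvg_cst.
    apply: (@continuous_cvg _ _ _ _ _ _ Num.sqrt); first exact: sqrt_continuous.
    apply: cvgM; first exact: cvg_cst.
    by apply: cvg_norm; apply: cvgB; [exact: cvg_cst|exact: cvg_id].
  apply: (ler_cvg_to c1 c2); rewrite near_withinE; near=> x => Px.
  by apply: holderA => //; near: x; move: (lt_nbhsr taus); apply: filterS => z; exact: ltW.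
pose y (t : R) := if 0 < t then y0 t else 0.
have cy (t : R) : 0 < t -> {for t, continuous y}.
  move=> t0; apply/cvgrPdist_lt => e e0.
  have t2 : 0 < t / 2 by rewrite divr_gt0.
  have Kt : 0 < K / (t / 2) by rewrite divr_gt0.
  have [del del0 small] := sqrt_small Kt e0.
  near=> x.
  have tx : t / 2 < x by near: x; apply: lt_nbhsr; lra.
  rewrite /y t0 (lt_trans t2 tx) (le_lt_trans (holderB (t / 2) x t _ _ _))//; first lra.
  by apply: small; near: x; apply: cvgr_dist_lt => //; exact: cvg_id.
have M0 : 0 <= M := le_trans (normr_ge0 _) (XM 0).
exists y; split => //.
- move=> U oU.
  rewrite (_ : y @^-1` U = [set t | 0 < t /\ U (y t)] `|` (`]-oo, 0] `&` [set t | U 0])); last first.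
    apply/seteqP; split => t /=; rewrite /y.
      by case: ltP => t0 Uy; [left|right; rewrite in_itv/=].
    by case=> [[]//|]; rewrite in_itv/= => -[t0]; rewrite ltNge t0.
  apply: measurableU; last first.
    by apply: measurableI => //; have [U0|U0] := pselect (U 0); [rewrite (_ : [set _ | _] = setT)//|rewrite (_ : [set _ | _] = set0)//]; apply/seteqP; split.
  apply: open_measurable; rewrite openE => t [t0 Uy].
  rewrite /interior/=; near=> x; split; first by near: x; exact: lt_nbhsr.
  near: x; apply: cy => //; exact: open_nbhs_nbhs.
- move=> t; rewrite /y; case: ltP => t0; last by rewrite normr0.
  have c1 : `|X x| @[x --> within P (nbhs t)] --> `|y0 t| by apply: cvg_norm; exact: y0cv.
  have c2 : M @[x --> within P (nbhs t)] --> M by exact: cvg_cst.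
  by apply: (ler_cvg_to c1 c2); apply: nearW => x.
- apply: lebesgue_aeS aeP => t Pt t0; rewrite /y t0; apply/eqP; rewrite -subr_eq0 -normr_le0.
  have t2 : 0 < t / 2 by rewrite divr_gt0.
  have th : t / 2 < t by lra.
  rewrite (le_trans (holderA (t / 2) t t t2 (ltW th) th Pt))//.
  by rewrite subrr normr0 mulr0 sqrtr0 mulr0.
Unshelve. all: by end_near. Qed.

End ContinuousRepresentative.

Lemma weak_sol_extend (R : realType) (H : completeNormedModType R)
  (ip : {dot H for (idfun : R -> R)}) (A : {linear H -> H}) (N : set R)
  (u v w z : R -> H) (W : R) :
  hilbert_inner ip -> separable_space H -> continuous A ->
  (@lebesgue_measure R).-negligible N -> hmeas w -> hmeas z ->
  (forall t, `|w t| <= W) -> (forall t, `|z t| <= W) ->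
  {ae @lebesgue_measure R, forall t, 0 < t -> v t = u t} ->
  {ae @lebesgue_measure R, forall t, 0 < t -> z t = w t} ->
  (forall t, 0 < t -> {for t, continuous v}) ->
  weak_sol ip A N u w -> weak_sol ip A set0 v z.
Proof.
move=> hip sepH contA N0 mw mz wW zW vu zw cv sol.
pose P t := ~ N t /\ (0 < t -> v t = u t).
have aeP : {ae @lebesgue_measure R, forall t, P t}.
  by apply: lebesgue_aeI => //; apply: negligibleS N0 => t /= /contrapT.
have primE q t : prim (fun x => ip (z x) q) t = prim (fun x => ip (w x) q) t.
  have mf (f : R -> H) : hmeas f -> measurable_fun `]0, t] (fun x => (ip (f x) q)%:E).
    by move=> mf'; apply/measurable_EFinP; apply: measurable_funTS; exact: hmeas_ip_cst.
  congr fine; rewrite -(integral_itv_obnd_cbnd (mf _ mz)) -(integral_itv_obnd_cbnd (mf _ mw)).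
  apply: ae_eq_integral => //; [exact: mf|exact: mf|].
  apply: lebesgue_aeS zw => x zwx /=; rewrite in_itv/= => /andP[x0 _].
  by rewrite zwx.
have [s0 /andP[s00 _] [Ns0 vs0]] := lebesgue_ae_exists aeP (@ltr01 R).
suff fE t q : 0 < t -> ip (A (v t)) q - prim (fun x => ip (z x) q) t =
    ip (A (v s0)) q - prim (fun x => ip (z x) q) s0.
  move=> s t q sp tp _ _; have := fE t q tp; have := fE s q sp; lra.
move=> t0; have FF := within_ae_proper t aeP.
have c1 : ip (A (v x)) q - prim (fun x => ip (z x) q) x @[x --> within P (nbhs t)] -->
    ip (A (v t)) q - prim (fun x => ip (z x) q) t.
  apply: cvg_within_filter; apply: cvgB.
    apply: (@continuous_cvg _ _ _ _ _ _ (fun h => ip (A h) q)).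
      by move=> h; apply: (@continuous_cvg _ _ _ _ _ _ (ip^~ q)); [exact: ip_continuous|exact: contA].
    exact: cv.
  have W0 : 0 <= W := le_trans (normr_ge0 _) (wW 0).
  have W1 : 0 < W * `|q| + 1 by rewrite ltr_wpDl// mulr_ge0.
  apply/cvgrPdist_lt => e e0; near=> x.
  have x0 : 0 < x by near: x; exact: lt_nbhsr.
  rewrite distrC (le_lt_trans (prim_ip_lipschitz hip sepH q mz zW (ltW t0) (ltW x0)))//.
  rewrite (@le_lt_trans _ _ ((W * `|q| + 1) * `|x - t|))//; first by rewrite ler_wpM2r// lerDl.
  rewrite mulrC -ltr_pdivlMr// distrC; near: x.
  by apply: cvgr_dist_lt; [exact: cvg_id|exact: divr_gt0].
have c2 : ip (A (v x)) q - prim (fun x => ip (z x) q) x @[x --> within P (nbhs t)] -->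
    ip (A (v s0)) q - prim (fun x => ip (z x) q) s0.
  apply: cvg_near_cst; rewrite near_withinE; near=> x => -[Nx vx].
  have x0 : 0 < x by near: x; exact: lt_nbhsr.
  rewrite vx// vs0// !primE; have := sol s0 x q s00 x0 Ns0 Nx; lra.
exact: (cvg_unique (@Rhausdorff R) c1 c2).
Unshelve. all: by end_near. Qed.

Lemma measurable_inv (R : realType) : measurable_fun setT (fun x : R => x^-1).
Proof.
rewrite -(setUv [set (0 : R)]); apply/measurable_funU => //.
  exact: measurableC.
split; first exact: measurable_fun_set1.
apply: open_continuous_measurable_fun.
  by rewrite openC; apply: accessible_closed_set1; apply: hausdorff_accessible; exact: Rhausdorff.
by move=> x; rewrite inE/= => /eqP x0; exact: inv_continuous.
Qed.

(** * Difference bounds of all orders *)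

Section Weights.
Variable R : realType.
Local Notation mu := (@lebesgue_measure R).
Implicit Types (s t h : R) (hs : seq R).

Definition om t : R := Num.min t 1.

Lemma om_gt0 t : 0 < t -> 0 < om t.
Proof. by move=> t0; rewrite lt_min t0 ltr01. Qed.

Lemma om_le1 t : om t <= 1.
Proof. by rewrite ge_min lexx orbT. Qed.

Lemma om_le t : om t <= t.
Proof. by rewrite ge_min lexx. Qed.

Lemma om_homo s t : s <= t -> om s <= om t.
Proof. by move=> st; rewrite le_min !ge_min st lexx orbT. Qed.

Definition halfway t : R := t - om t / 2.

Lemma halfwayP t : 0 < t ->
  [/\ 0 < halfway t, halfway t <= t, om t / 2 <= om (halfway t) & t - 2^-1 <= halfway t].
Proof.
move=> t0; have := om_gt0 t0; have := om_le1 t; have := om_le t; rewrite /halfway => h1 h2 h3.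
split; try lra.
by rewrite le_min; apply/andP; split; lra.
Qed.

Definition eta hs t : R := \prod_(h <- hs) (`|h| / om t).

Lemma eta_ge0 hs t : 0 < t -> 0 <= eta hs t.
Proof.
by move=> t0; rewrite prodr_ge0// => h _; rewrite divr_ge0// ltW// om_gt0.
Qed.

Lemma eta_gt0 hs t : 0 < t -> all (fun h => 0 < h) hs -> 0 < eta hs t.
Proof.
move=> t0 /seq.allP hs0; rewrite /eta big_seq prodr_gt0// => h /hs0 h0.
by rewrite divr_gt0 ?om_gt0// normr_gt0 gt_eqF.
Qed.

Lemma eta_cons h hs t : eta (h :: hs) t = `|h| / om t * eta hs t.
Proof. by rewrite /eta big_cons. Qed.

Lemma eta_nil t : eta [::] t = 1.
Proof. by rewrite /eta big_nil. Qed.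

Lemma eta_anti hs s t : 0 < s -> s <= t -> eta hs t <= eta hs s.
Proof.
move=> s0 st; have t0 := lt_le_trans s0 st; elim: hs => [|h hs IH]; first by rewrite !eta_nil.
rewrite !eta_cons ler_pM ?eta_ge0 ?divr_ge0 ?(ltW (om_gt0 _))//.
by rewrite ler_wpM2l// lef_pV2 ?posrE ?om_gt0 ?om_homo.
Qed.

Lemma eta_halfway hs t : 0 < t -> eta hs (halfway t) <= 2 ^+ size hs * eta hs t.
Proof.
move=> t0; have [s0 _ os _] := halfwayP t0; elim: hs => [|h hs IH].
  by rewrite !eta_nil mulr1.
rewrite !eta_cons exprS mulrACA ler_pM ?eta_ge0 ?divr_ge0 ?(ltW (om_gt0 _))//.
rewrite mulrCA ler_wpM2l// -[leRHS]invrK lef_pV2 ?posrE ?om_gt0//; last first.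
  by rewrite invr_gt0 mulr_gt0 ?invr_gt0 ?om_gt0.
by rewrite invfM invrK mulrC.
Qed.

Variable c : R.
Hypothesis c0 : 0 < c.

Definition decay t : R := expR (- c * t).

Lemma decay_gt0 t : 0 < decay t.
Proof. exact: expR_gt0. Qed.

Lemma decay_le1 t : 0 <= t -> decay t <= 1.
Proof. by move=> t0; rewrite -expR0 ler_expR mulNr oppr_le0 mulr_ge0 ?(ltW c0). Qed.

Lemma decay_anti s t : s <= t -> decay t <= decay s.
Proof. by move=> st; rewrite ler_expR !mulNr lerN2 ler_pM2l. Qed.

Lemma decay_halfway t : 0 < t -> decay (halfway t) <= expR c * decay t.
Proof.
move=> t0; have [_ _ _ th] := halfwayP t0; rewrite -expRD ler_expR.
have : c * (t - 1) <= c * halfway t by rewrite ler_pM2l//; lra.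
lra.
Qed.

Lemma measurable_decay : measurable_fun setT decay.
Proof.
apply: continuous_measurable => t; apply: (@continuous_cvg _ _ _ _ _ _ expR); first exact: continuous_expR.
by apply: cvgM; [exact: cvg_cst|exact: cvg_id].
Qed.

Lemma measurable_om : measurable_fun setT om.
Proof. by apply: measurable_minr. Qed.

Lemma measurable_eta hs : measurable_fun setT (eta hs).
Proof.
elim: hs => [|h hs IH].
  rewrite (_ : eta [::] = cst 1); first exact: measurable_cst.
  by apply/funext => t; rewrite eta_nil.
rewrite (_ : eta (h :: hs) = (fun t => `|h| * (om t)^-1 * eta hs t)); last first.
  by apply/funext => t; rewrite eta_cons.
apply: measurable_funM => //; apply: measurable_funM => //.
by apply: measurableT_comp measurable_om; exact: measurable_inv.
Qed.

(* The primitive [- (1/x + 1/(2c)) e^{-2cx}] dominates [om(x)^{-2} e^{-2cx}]. *)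
Lemma tail_om s : 0 < s ->
  (tail s (fun t => ((om t)^-1 * decay t) ^+ 2)%R <= ((1 + (2 * c)^-1) * (om s)^-1 * decay s ^+ 2)%:E)%E.
Proof.
move=> s0; pose f (x : R) := (x ^- 2 + 2 * c * x^-1 + 1) * expR (- (2 * c) * x).
pose F (x : R) := - ((x^-1 + (2 * c)^-1) * expR (- (2 * c) * x)).
have d2 x : decay x ^+ 2 = expR (- (2 * c) * x).
  by rewrite -expRM_natl; congr expR; rewrite !mulNr mulrN mulrA.
have dF (x : R) : 0 < x -> is_derive x (1 : R) F (f x).
  move=> x0; have xn0 : x != 0 by rewrite gt_eqF.
  have d1 : is_derive x (1 : R) (fun x => x^-1 + (2 * c)^-1) (- x ^- 2).
    by apply: is_derive_conv (is_deriveD (is_deriveV xn0 (is_derive_id x 1)) (is_derive_cst _ x 1)) _;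
      rewrite addr0 /GRing.scale/= mulr1.
  have d3 : is_derive x (1 : R) (fun x => expR (- (2 * c) * x)) (- (2 * c) * expR (- (2 * c) * x)).
    have dl : is_derive x (1 : R) (fun x => - (2 * c) * x) (- (2 * c)).
      by apply: is_derive_conv (is_deriveZ (- (2 * c)) (is_derive_id x 1)) _; rewrite /GRing.scale/= mulr1.
    by apply: is_derive_conv (is_derive1_comp (is_derive_expR _) dl) _; rewrite mulrC.
  apply: is_derive_conv (is_deriveN (is_deriveM d1 d3)) _.
  rewrite /f /GRing.scale/=; move: (expR _) => y; field.
  by rewrite xn0 gt_eqF.
have cf (x : R) : 0 < x -> {for x, continuous f}.
  move=> x0; have xn0 : x != 0 by rewrite gt_eqF.
  have ci : {for x, continuous (fun x : R => x^-1)} by apply: inv_continuous.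
  apply: cvgM.
    apply: cvgD; last exact: cvg_cst.
    apply: cvgD; last by apply: cvgM; [exact: cvg_cst|exact: ci].
    have : (fun x : R => x^-1 * x^-1) y @[y --> x] --> x^-1 * x^-1 by apply: cvgM; exact: ci.
    rewrite -invfM -expr2; apply: cvg_trans; apply: near_eq_cvg; apply: nearW => y.
    by rewrite -invfM -expr2.
  apply: (@continuous_cvg _ _ _ _ _ _ expR); first exact: continuous_expR.
  by apply: cvgM; [exact: cvg_cst|exact: cvg_id].
have md : measurable_fun setT (fun t => ((om t)^-1 * decay t) ^+ 2).
  apply: measurable_funX; apply: measurable_funM; last exact: measurable_decay.
  by apply: measurableT_comp measurable_om; exact: measurable_inv.
apply: tail_le_itv => // [t _|T]; first by rewrite sqr_ge0.
have c20 : 0 <= (2 * c)^-1 by rewrite invr_ge0 mulr_ge0 ?ltW.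
have [sT|Ts] := ltP s T; last first.
  rewrite set_itv_ge; last by rewrite bnd_simp -leNgt.
  rewrite integral_set0 lee_fin mulr_ge0 ?sqr_ge0// mulr_ge0 ?addr_ge0//.
  by rewrite invr_ge0 ltW// om_gt0.
have fge x : s <= x -> ((om x)^-1 * decay x) ^+ 2 <= f x.
  move=> sx; have x0 := lt_le_trans s0 sx.
  rewrite exprMn d2 /f ler_wpM2r ?expR_ge0//.
  have xi : 0 <= 2 * c * x^-1 by rewrite !mulr_ge0 ?invr_ge0 ?ltW.
  have : (om x)^-1 ^+ 2 <= x ^- 2 + 1; last by lra.
  rewrite /om; have [x1|x1] := ltP x 1.
    by rewrite exprVn lerDl.
  by rewrite invr1 expr1n lerDr invr_ge0 sqr_ge0.
have cfw : {within `[s, T], continuous f}.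
  apply: continuous_in_subspaceT => x; rewrite inE/= in_itv/= => /andP[sx _].
  by apply: cf; exact: lt_le_trans sx.
have FTC : (\int[mu]_(x in `[s, T]) (f x)%:E = (F T)%:E - (F s)%:E)%E.
  apply: continuous_FTC2 => //.
    split.
    - by move=> x; rewrite in_itv/= => /andP[sx _]; case: (dF x (lt_trans s0 sx)).
    - by apply: cvg_at_right_filter; exact: is_derive_cont (dF s s0).
    - by apply: cvg_at_left_filter; exact: is_derive_cont (dF T (lt_trans s0 sT)).
  by move=> x; rewrite in_itv/= => /andP[sx _]; rewrite derive1E; case: (dF x (lt_trans s0 sx)).
have f0 x : s <= x -> 0 <= f x by move=> sx; apply: le_trans (fge x sx); rewrite sqr_ge0.
have mf : measurable_fun `[s, T] f by apply: subspace_continuous_measurable_fun.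
apply: (@le_trans _ _ (\int[mu]_(x in `[s, T]) (f x)%:E)%E).
  apply: (@le_trans _ _ (\int[mu]_(x in `]s, T[) (f x)%:E)%E).
    apply: ge0_le_integral => //.
    - by move=> x _; rewrite lee_fin sqr_ge0.
    - by apply/measurable_EFinP; exact: measurable_funTS.
    - by apply/measurable_EFinP; apply: measurable_funS mf => //; exact: subset_itv_oo_cc.
    - by move=> x /=; rewrite in_itv/= => /andP[/ltW sx _]; rewrite lee_fin fge.
  apply: ge0_subset_integral => //; first exact/measurable_EFinP.
    by move=> x /=; rewrite in_itv/= lee_fin => /andP[/f0].
  exact: subset_itv_oo_cc.
rewrite FTC -EFinB lee_fin /F opprK d2 addrC.
rewrite (@le_trans _ _ ((s^-1 + (2 * c)^-1) * expR (- (2 * c) * s)))//.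
  rewrite gerBl mulr_ge0 ?expR_ge0// addr_ge0 ?invr_ge0 ?(ltW (lt_trans s0 sT))//.
  by rewrite mulr_ge0 ?ltW.
rewrite ler_wpM2r ?expR_ge0// [leRHS]mulrDl mul1r lerD//.
  by rewrite lef_pV2 ?posrE ?om_gt0 ?om_le.
by rewrite ler_peMr ?invr_ge0 ?mulr_ge0 ?(ltW c0)// invf_ge1 ?om_gt0 ?om_le1.
Qed.

Lemma tail_sum_sqr (I : Type) (r : seq I) (f : I -> R -> R) (s B : R) :
  0 <= B -> (forall i, measurable_fun setT (f i)) ->
  (forall i, (tail s (fun t => f i t ^+ 2)%R <= B%:E)%E) ->
  (tail s (fun t => (\sum_(i <- r) f i t) ^+ 2)%R <= (4 ^+ size r * B)%:E)%E.
Proof.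
move=> B0 mf fB; elim: r => [|i r IH].
  rewrite /tail integral0_eq ?lee_fin ?mulr_ge0// => t _.
  by rewrite big_nil expr0n.
have ms : measurable_fun setT (fun t => \sum_(i <- r) f i t) by exact: measurable_sum.
have m1 : measurable_fun setT (fun t => f i t ^+ 2) by exact: measurable_funX.
have m2 : measurable_fun setT (fun t => (\sum_(i <- r) f i t) ^+ 2) by exact: measurable_funX.
apply: (@le_trans _ _ (2%:E * tail s (fun t => f i t ^+ 2)%R + 2%:E * tail s (fun t => (\sum_(i <- r) f i t) ^+ 2)%R)%E).
  rewrite -(@tailZ R s _ 2 m1 (fun t _ => sqr_ge0 _))// -(@tailZ R s _ 2 m2 (fun t _ => sqr_ge0 _))//.
  rewrite -tailD//; [|exact: measurable_funM|exact: measurable_funM|by move=> x _; rewrite mulr_ge0 ?sqr_ge0..].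
  apply: le_tail.
  - by apply: measurable_funX; exact: measurable_sum.
  - by apply: measurable_funD; exact: measurable_funM.
  move=> t _; rewrite sqr_ge0/= big_cons.
  have := sqr_ge0 (f i t - \sum_(j <- r) f j t); lra.
apply: (@le_trans _ _ (2%:E * B%:E + 2%:E * (4 ^+ size r * B)%:E)%E).
  by rewrite leeD// lee_wpmul2l.
rewrite -!EFinM -EFinD lee_fin/= exprS.
have : 1 <= (4 : R) ^+ size r by rewrite exprn_ege1// ler1n.
move: (4 ^+ size r) => y y1; nra.
Qed.

End Weights.

Section Subsequences.
Variable T : eqType.
Implicit Types s : seq T.

Definition subs s : seq (seq T) := [seq mask (val m) s | m <- enum {: (size s).-tuple bool}].

Lemma mem_subs s1 s : subseq s1 s -> s1 \in subs s.
Proof.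
move=> /subseqP[m sm ->]; apply/mapP; exists (Tuple (introT eqP sm)) => //.
by rewrite mem_enum.
Qed.

Lemma size_subs s : size (subs s) = (2 ^ size s)%N.
Proof. by rewrite size_map -cardE card_tuple card_bool. Qed.

Definition sub_pairs s := [seq (s1, s2) | s1 <- subs s, s2 <- subs s].

Lemma mem_sub_pairs s1 s2 s : subseq s1 s -> subseq s2 s -> (s1, s2) \in sub_pairs s.
Proof. by move=> /mem_subs m1 /mem_subs m2; exact: allpairs_f. Qed.

Lemma size_sub_pairs s : size (sub_pairs s) = (2 ^ size s * 2 ^ size s)%N.
Proof. by rewrite size_allpairs size_subs. Qed.

End Subsequences.

Section Regularity.
Variables (R : realType) (c B0 K : R) (N : nat).
Hypothesis c0 : 0 < c.
Hypothesis B00 : 0 <= B0.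
Hypothesis K0 : 0 <= K.
Local Notation mu := (@lebesgue_measure R).
Local Notation E := (decay c).

Record regular_data (H : completeNormedModType R) (ip : {dot H for (idfun : R -> R)})
    (A : {linear H -> H}) (G : H -> H) (y : R -> H) : Prop := RegularData {
  rd_hip : hilbert_inner ip;
  rd_sep : separable_space H;
  rd_cont : continuous A;
  rd_sym : self_adjoint ip A;
  rd_G0 : G 0 = 0;
  rd_lip : forall u v : H, `|G u - G v| <= 4^-1 * `|u - v|;
  rd_GK : forall bs z, (0 < size bs <= N)%N -> `|difs bs G z| <= K * \prod_(b <- bs) `|b|;
  rd_meas : hmeas y;
  rd_bounded : exists U, forall t, `|y t| <= U;
  rd_continuous : forall t, 0 < t -> {for t, continuous y};
  rd_sol : weak_sol ip A set0 y (fun t => rhs G (y t));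
  rd_decay : forall t, 0 < t -> `|y t| <= B0 * E t }.

Local Notation pos := (all (fun h : R => 0 < h)).

Section FixedData.
Variables (H : completeNormedModType R) (ip : {dot H for (idfun : R -> R)}).
Variables (A : {linear H -> H}) (G : H -> H) (y : R -> H).
Hypothesis D : regular_data ip A G y.
Implicit Types (hs T S : seq R) (h l t x : R).

Let g t := G (y t).
Let w t := rhs G (y t).

Lemma pos_subseq hs T : subseq T hs -> pos hs -> pos T.
Proof. by move=> Ths /seq.allP hs0; apply/seq.allP => h /(mem_subseq Ths)/hs0. Qed.

Lemma pos_sum_ge0 S : pos S -> 0 <= \sum_(h <- S) h.
Proof. by move=> /seq.allP S0; rewrite big_seq sumr_ge0// => h /S0/ltW. Qed.

Lemma difs_bounded (u : R -> H) U hs : (forall t, `|u t| <= U) ->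
  forall t, `|difs hs u t| <= 2 ^+ size hs * U.
Proof.
elim: hs u U => [|h hs IH] u U uU t; first by rewrite mul1r.
rewrite difs_consE exprS -mulrA (le_trans (ler_normB _ _))// mulrDl mul1r.
by rewrite lerD ?IH.
Qed.

Let hw : hmeas w.
Proof. by rewrite /w; have L := rd_lip D; exact: (hmeas_rhs L (rd_meas D)). Qed.

Let hdy hs : hmeas (difs hs y).
Proof. exact: (hmeas_difs (rd_sep D) hs (rd_meas D)). Qed.

Lemma w_bounded : exists U, forall t, `|w t| <= U.
Proof.
have [U yU] := rd_bounded D; exists (2 * U) => t.
by rewrite (le_trans (rhs_le (rd_lip D) (rd_G0 D) _))// ler_wpM2l.
Qed.

Lemma weak_sol_difs hs : pos hs -> weak_sol ip A set0 (difs hs y) (difs hs w).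
Proof.
elim: hs => [|h hs IH]; first by move=> _; exact: rd_sol D.
move=> /= /andP[h0 /IH sol]; rewrite !difs_dif; have [U wU] := w_bounded.
have sold := weak_sol_dif (rd_hip D) (rd_sep D) (hmeas_difs (rd_sep D) hs hw) (difs_bounded hs wU) (ltW h0) sol.
by move=> s t q s0 t0 _ _; apply: sold => //; case.
Qed.

Lemma difs_w hs t : difs hs w t = - difs hs y t + difs hs g t.
Proof. by rewrite -difsN -difsD. Qed.

Lemma energy_step h hs t W B (F : R -> R) : 0 < h -> pos hs -> 0 < t -> 0 <= W ->
  measurable_fun setT F -> (forall x, halfway t < x -> 0 <= F x) ->
  (forall x, halfway t <= x -> `|difs hs w x| <= W) ->
  (forall x, halfway t < x -> `|difs (h :: hs) g x| <= 4^-1 * `|difs (h :: hs) y x| + F x) ->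
  (tail (halfway t) (fun x => F x ^+ 2)%R <= B%:E)%E ->
  (tail t (fun x => `|difs (h :: hs) y x| ^+ 2)%R <=
    (2 * ramp_const R * W ^+ 2 * h ^+ 2 / om t + 4 * B)%:E)%E.
Proof.
move=> h0 hs0 t0 W0 mF F0 wW gF FB; set s := halfway t in F0 wW gF FB *.
have [s0 st _ _] := halfwayP t0; rewrite -/s in s0 st.
have r0 : 0 < om t / 2 by rewrite divr_gt0 ?om_gt0.
have srt : s + om t / 2 = t by rewrite /s /halfway subrK.
have [U yU] := rd_bounded D; have [V wV] := w_bounded.
have mu' := hdy (h :: hs); have mu2 := measurable_norm2 mu'.
rewrite -{1}srt; apply: le_trans (tail_ramp r0 mu2 _) _ => //.
have mrF : measurable_fun setT (fun x => ramp s (om t / 2) x ^+ 2 * F x ^+ 2).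
  by apply: measurable_funM; apply: measurable_funX => //; exact: measurable_ramp.
have hs'0 : pos (h :: hs) by rewrite /= h0.
have En := @energy_estimate R H ip (rd_hip D) (rd_sep D) A (rd_cont D) (rd_sym D) set0 _ _ _ _ F s (om t / 2) B%:E
  mu' (hmeas_difs (rd_sep D) (h :: hs) hw) (difs_bounded (h :: hs) yU) (difs_bounded (h :: hs) wV)
  (negligible_set0 mu) (weak_sol_difs hs'0) s0 r0 mF F0.
apply: le_trans (En _ _) _.
- by move=> x sx; rewrite difs_w addrAC addNr add0r; exact: gF.
- apply: le_trans FB; apply: le_tail => //; first exact: measurable_funX.
  move=> x sx; rewrite mulr_ge0 ?sqr_ge0//= -[leRHS]mul1r ler_wpM2r ?sqr_ge0//.
  by rewrite exprn_ile1 ?ramp_ge0 ?ramp_le1.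
rewrite [leRHS](_ : _ = (2 * ramp_const R * W ^+ 2 * h ^+ 2 / om t)%:E + 4%:E * B%:E)%E// leeD2r//.
apply: (@le_trans _ _ ((ramp_const R / (om t / 2) ^+ 2)%:E *
    \int[mu]_(x in `[s, (s + om t / 2)%R]) ((W * h) ^+ 2)%:E)%E).
  rewrite lee_wpmul2l ?lee_fin ?divr_ge0 ?sqr_ge0 ?ramp_const_ge0//.
  apply: ge0_le_integral => //.
  - apply/measurable_EFinP; apply: measurable_funTS; apply: measurable_funX.
    by apply: hmeas_norm; apply: hmeas_comp => //; exact: rd_cont D.
  - move=> x /=; rewrite in_itv/= => /andP[sx _]; rewrite lee_fin norm_le_sqr// normr_id.
    have xp := lt_le_trans s0 sx; rewrite difs_dif /dif linearB/=.
    have wz z : x < z <= x + h -> `|difs hs w z| <= W.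
      by move=> /andP[/ltW xz _]; apply: wW; exact: le_trans xz.
    have xh : x <= x + h by rewrite lerDl ltW.
    have := weak_sol_increment (rd_hip D) (rd_sep D) (hmeas_difs (rd_sep D) hs hw)
      (difs_bounded hs wV) xp xh (fun z => z) (fun z => z) wz W0 (weak_sol_difs hs0).
    by rewrite addrAC subrr add0r.
rewrite integral_cst//= [X in (_ * (_ * X))%E]lebesgue_measure_itv /= lte_fin ltrDl r0.
rewrite -EFinB addrAC subrr add0r -!EFinM lee_fin; apply: eq_imp_le; field.
by rewrite gt_eqF ?om_gt0.
Qed.

Lemma difs_comp_bound (e : R -> R) h hs x B b : (forall h, 0 <= e h) -> 0 <= B -> 0 <= b <= 1 ->
  (0 < size hs < N)%N ->
  (forall T S, (0 < size T <= size hs)%N -> subseq T (h :: hs) -> subseq S (h :: hs) ->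
    `|difs T y (x + \sum_(h <- S) h)| <= B * b * \prod_(h <- T) e h) ->
  `|difs (h :: hs) g x| <= 4^-1 * `|difs (h :: hs) y x| +
    lip_const R (size hs) * K * (B * b * e h) * (2 * B) * (1 + 2 * B) ^+ (size hs).-1 * \prod_(h <- hs) e h.
Proof.
move=> e0 B_0 /andP[b0 b1] hsN cube.
have Bb : B * b <= 2 * B by rewrite mulrC ler_wpM2r// (le_trans b1)// ler1n.
have BB : 0 <= B * b by rewrite mulr_ge0.
have E0 T : 0 <= \prod_(h <- T) e h by rewrite prodr_ge0.
have subS T : subseq T hs -> subseq T (h :: hs) by move/subseq_trans; apply; exact: subseq_cons.
have subC T : subseq T hs -> subseq (h :: T) (h :: hs) by rewrite /= eqxx.
have -> : difs (h :: hs) g x = difs hs (fun s => G (y s + dif h y s) - G (y s)) x.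
  by congr (difs hs _ x); apply/funext => s; rewrite /dif [y s + _]addrC subrK.
apply: (difs_increment_bound K0 (rd_GK D) e0) => //.
- exact: rd_lip D.
- by rewrite mulr_ge0.
- by rewrite mulr_ge0.
- move=> T S T0 Th Sh; rewrite (le_trans (cube _ _ _ (subS _ Th) (subS _ Sh)))//.
    by rewrite T0 size_subseq.
  by rewrite ler_wpM2r.
- move=> T S /andP[T0 Tn] Th Sh; rewrite difs_dif /dif (le_trans (ler_normB _ _))//.
  have T1 : (0 < size T <= size hs)%N by rewrite T0 ltnW.
  have c1 := cube _ (h :: S) T1 (subS _ Th) (subC _ Sh).
  have c2 := cube _ S T1 (subS _ Th) (subS _ Sh).
  rewrite big_cons (addrC h) addrA in c1.
  apply: le_trans (lerD c1 c2) _; rewrite -mulrDl ler_wpM2r//.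
  have := ler_wpM2l B_0 b1; lra.
- move=> T S Tn Th Sh; rewrite -[difs T (dif h y)]/(difs (h :: T) y).
  have := cube (h :: T) S _ (subC _ Th) (subS _ Sh); rewrite big_cons mulrA; apply.
  by rewrite ltnS leq0n.
Qed.

Lemma nat_root (b : R) (k : nat) : 1 <= b -> (0 < k)%N -> exists2 lam : R, 1 <= lam & lam ^+ k = b.
Proof.
move=> b1 k0; exists (expR (ln b / k%:R)).
  by rewrite -expR0 ler_expR divr_ge0// ln_ge0.
by rewrite -expRM_natl mulrC divfK ?pnatr_eq0 -?lt0n// lnK// posrE (lt_le_trans ltr01).
Qed.

(* The increments of top order enter linearly: rescaling the steps by [lam] with
   [lam ^+ (size hs - 1) = beta] makes them as small as the increments of lower order. *)
Lemma difs_comp_bound_linear (e : R -> R) h hs x B b beta : (forall h, 0 <= e h) -> 0 <= B -> 0 <= b <= 1 ->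
  1 <= beta -> (1 < size hs < N)%N ->
  (forall T S, (0 < size T < size hs)%N -> subseq T (h :: hs) -> subseq S (h :: hs) ->
    `|difs T y (x + \sum_(h <- S) h)| <= B * b * \prod_(h <- T) e h) ->
  (forall T S, size T = size hs -> subseq T (h :: hs) -> subseq S (h :: hs) ->
    `|difs T y (x + \sum_(h <- S) h)| <= B * beta * b * \prod_(h <- T) e h) ->
  `|difs (h :: hs) g x| <= 4^-1 * `|difs (h :: hs) y x| +
    lip_const R (size hs) * K * B * (2 * B) * (1 + 2 * B) ^+ (size hs).-1 * (beta * b * \prod_(h <- h :: hs) e h).
Proof.
move=> e0 B_0 b01 beta1 /andP[hs1 hsN] cube cubetop; have /andP[b0 b1] := b01.
have k0 : (0 < (size hs).-1)%N by rewrite -subn1 subn_gt0.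
have [lam lam1 lamk] := nat_root beta1 k0.
have lam0 : 0 < lam := lt_le_trans ltr01 lam1.
have E0 T : 0 <= \prod_(h <- T) e h by rewrite prodr_ge0.
have prodlam T : \prod_(h <- T) (lam * e h) = lam ^+ size T * \prod_(h <- T) e h.
  by rewrite big_split/= big_const_seq count_predT iter_mulr_1.
have hsS : size hs = (size hs).-1.+1 by rewrite prednK// ltnW.
have := @difs_comp_bound (fun h => lam * e h) h hs x (B / lam) b.
move=> /(_ _ _ b01) bnd; apply: le_trans (bnd _ _ _ _) _.
- by move=> k; rewrite mulr_ge0// ltW.
- by rewrite divr_ge0// ltW.
- by rewrite ltnW.
- move=> T S /andP[T0 Tn] Th Sh; rewrite prodlam.
  have E1 : B / lam * b * (lam ^+ size T * \prod_(h <- T) e h) =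
      B * b * lam ^+ (size T).-1 * \prod_(h <- T) e h.
    rewrite -[in lam ^+ size T](prednK T0) exprS; move: (\prod_(h <- T) e h) (lam ^+ _) => p q.
    by field; rewrite gt_eqF.
  rewrite E1; move: Tn; rewrite leq_eqVlt => /predU1P[Tn|Tn].
    rewrite (le_trans (cubetop T S Tn Th Sh))// Tn lamk; apply: eq_imp_le; ring.
  apply: le_trans (cube T S _ Th Sh) _; first by rewrite T0.
  rewrite ler_wpM2r// -[leLHS]mulr1 ler_wpM2l ?mulr_ge0//.
  by rewrite exprn_ege1.
rewrite lerD2l prodlam big_cons.
have Bl : B / lam <= B by rewrite ler_pdivrMr// ler_peMr.
have l0 := lip_const_ge0 R (size hs).
set P := \prod_(h <- hs) e h; have P0 : 0 <= P := E0 hs.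
have -> : lip_const R (size hs) * K * (B / lam * b * (lam * e h)) * (2 * (B / lam)) *
    (1 + 2 * (B / lam)) ^+ (size hs).-1 * (lam ^+ size hs * P) =
   lip_const R (size hs) * K * B * (2 * B) * (1 + 2 * (B / lam)) ^+ (size hs).-1 * (beta * b * (e h * P)).
  have -> : lam ^+ size hs = lam * beta by rewrite [in LHS]hsS exprS lamk.
  move: (_ ^+ _) (lip_const _ _) => p q.
  by field; rewrite gt_eqF.
have beta0 : 0 <= beta := le_trans ler01 beta1.
have Q0 : 0 <= beta * b * (e h * P) by apply: mulr_ge0; apply: mulr_ge0.
have Q1 : 0 <= lip_const R (size hs) * K * B * (2 * B).
  by apply: mulr_ge0; apply: mulr_ge0 => //; apply: mulr_ge0.
rewrite (ler_wpM2r Q0)// (ler_wpM2l Q1)//.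
have p1 : 0 <= 1 + 2 * (B / lam) by rewrite addr_ge0// mulr_ge0// divr_ge0// ltW.
have p2 : 0 <= 1 + 2 * B by rewrite addr_ge0// mulr_ge0.
by rewrite lerXn2r ?nnegrE// lerD2l ler_wpM2l.
Qed.

Definition pw_bound (u : R -> H) n C := forall hs t, size hs = n -> pos hs -> 0 < t ->
  `|difs hs u t| <= C * (eta hs t * E t).

Definition l2_bound (u : R -> H) n C := forall hs t, size hs = n -> pos hs -> 0 < t ->
  (tail t (fun x => `|difs hs u x| ^+ 2)%R <= (C * om t * (eta hs t * E t) ^+ 2)%:E)%E.

Let etaE_ge0 hs t : 0 < t -> 0 <= eta hs t * E t.
Proof. by move=> t0; rewrite mulr_ge0 ?eta_ge0// ltW// decay_gt0. Qed.

Lemma etaE_anti hs s t : 0 < s -> s <= t -> eta hs t * E t <= eta hs s * E s.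
Proof.
move=> s0 st; rewrite ler_pM ?eta_ge0 ?(lt_le_trans s0)// ?(ltW (decay_gt0 _ _))//.
  exact: eta_anti.
exact: decay_anti.
Qed.

Lemma etaE_halfway hs t x : 0 < t -> halfway t <= x ->
  eta hs x * E x <= 2 ^+ size hs * expR c * (eta hs t * E t).
Proof.
move=> t0 tx; have [s0 _ _ _] := halfwayP t0.
rewrite (le_trans (etaE_anti _ s0 tx))// mulrACA.
by rewrite ler_pM ?eta_ge0 ?eta_halfway ?decay_halfway// ltW// decay_gt0.
Qed.

Lemma tail_etaE hs s : 0 < s -> (0 < size hs)%N -> pos hs ->
  (tail s (fun x => (eta hs x * E x) ^+ 2)%R <= ((1 + (2 * c)^-1) * om s * (eta hs s * E s) ^+ 2)%:E)%E.
Proof.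
case: hs => [//|h hs] s0 _ /= /andP[h0 hs0].
have o0 := om_gt0 s0.
have mw1 : measurable_fun setT (fun x => ((om x)^-1 * E x) ^+ 2).
  apply: measurable_funX; apply: measurable_funM; last exact: measurable_decay.
  exact: (measurableT_comp (@measurable_inv R) (@measurable_om R)).
apply: (@le_trans _ _ (((h * eta hs s) ^+ 2)%:E * tail s (fun x => ((om x)^-1 * E x) ^+ 2)%R)%E).
  rewrite -(@tailZ R s _ _ mw1 (fun x _ => sqr_ge0 _)) ?sqr_ge0//.
  apply: le_tail.
  - by apply: measurable_funX; apply: measurable_funM; [exact: measurable_eta|exact: measurable_decay].
  - exact: measurable_funM.
  move=> x sx; rewrite sqr_ge0/= -exprMn norm_le_sqr// ger0_norm ?etaE_ge0 ?(lt_trans s0)//.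
  rewrite eta_cons gtr0_norm// mulrACA mulrA (mulrAC h) ler_wpM2r ?(ltW (decay_gt0 _ _))//.
  rewrite [leLHS]mulrAC; apply: ler_wpM2r; first by rewrite invr_ge0 ltW// om_gt0// (lt_trans s0).
  by rewrite ler_wpM2l ?(ltW h0)// eta_anti// ltW.
apply: (@le_trans _ _ (((h * eta hs s) ^+ 2)%:E * ((1 + (2 * c)^-1) * (om s)^-1 * E s ^+ 2)%:E)%E).
  by rewrite lee_wpmul2l ?lee_fin ?sqr_ge0// tail_om.
rewrite -EFinM lee_fin eta_cons gtr0_norm//; apply: eq_imp_le.
by field; rewrite !gt_eqF.
Qed.

Definition comp_c n C := lip_const R n.-1 * K * C * (2 * C) * (1 + 2 * C) ^+ n.-2.

Lemma comp_c_ge0 n C : 0 <= C -> 0 <= comp_c n C.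
Proof.
move=> C0; apply: mulr_ge0; last by rewrite exprn_ge0// addr_ge0// mulr_ge0.
apply: mulr_ge0; last exact: mulr_ge0.
by apply: mulr_ge0 => //; apply: mulr_ge0 => //; exact: lip_const_ge0.
Qed.

Lemma pw_bound_shift n C hs T S x : pw_bound y n C -> 0 <= C -> size T = n -> pos hs ->
  subseq T hs -> subseq S hs -> 0 < x ->
  `|difs T y (x + \sum_(h <- S) h)| <= C * (eta T x * E x).
Proof.
move=> yC C0 Tn hs0 Th Sh x0.
have S0 := pos_sum_ge0 (pos_subseq Sh hs0).
rewrite (le_trans (yC T _ Tn (pos_subseq Th hs0) _)) ?ltr_wpDr//.
by rewrite ler_wpM2l// etaE_anti// lerDl.
Qed.

Lemma comp_bound n C hs x : (n <= N)%N -> size hs = n -> pos hs -> 0 <= C -> 0 < x ->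
  (forall j, (0 < j < n)%N -> pw_bound y j C) ->
  `|difs hs g x| <= 4^-1 * `|difs hs y x| + comp_c n C * (eta hs x * E x).
Proof.
move=> nN hsn hs0 C0 x0 yC.
have cc0 : 0 <= comp_c n C * (eta hs x * E x) by rewrite mulr_ge0 ?comp_c_ge0 ?etaE_ge0.
have lip4 := rd_lip D.
case: hs hsn hs0 cc0 => [|h [|k hs]] hsn hs0 cc0.
- by rewrite ler_wpDr//; have := lip4 (y x) 0; rewrite (rd_G0 D) !subr0.
- by rewrite ler_wpDr//; exact: lip4.
have e0 (z : R) : 0 <= `|z| / om x by rewrite divr_ge0// ltW// om_gt0.
have := @difs_comp_bound (fun h => `|h| / om x) h (k :: hs) x C (E x) e0 C0.
move=> bnd; apply: le_trans (bnd _ _ _) _.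
- by rewrite (ltW (decay_gt0 _ _)) decay_le1// ltW.
- by rewrite /= -hsn in nN *.
- move=> T S /andP[T0 Tk] Th Sh; rewrite -mulrA [E x * _]mulrC.
  apply: (pw_bound_shift (yC (size T) _) C0 _ hs0 Th Sh x0) => //.
  by rewrite T0 -hsn.
rewrite lerD2l -/(eta (k :: hs) x) -hsn /comp_c [eta (h :: _) x]eta_cons /=.
by apply: eq_imp_le; move: (lip_const _ _) (_ ^+ _) => p q; ring.
Qed.

Lemma w_bound n C hs x : (n <= N)%N -> size hs = n -> pos hs -> 0 <= C -> 0 < x ->
  (forall j, (0 < j < n)%N -> pw_bound y j C) ->
  `|difs hs w x| <= 2 * `|difs hs y x| + comp_c n C * (eta hs x * E x).
Proof.
move=> nN hsn hs0 C0 x0 yC; rewrite difs_w (le_trans (ler_normD _ _))// normrN.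
by have := comp_bound nN hsn hs0 C0 x0 yC; have := normr_ge0 (difs hs y x); lra.
Qed.

Definition l2_c n C := 2 * ramp_const R * ((2 * C + comp_c n C) * (2 ^+ n * expR c)) ^+ 2 +
  4 * (comp_c n.+1 C ^+ 2 * (1 + (2 * c)^-1) * (2 ^+ n.+1 * expR c) ^+ 2).

Lemma l2_next n C : (n < N)%N -> 0 <= C -> (forall j, (j <= n)%N -> pw_bound y j C) ->
  l2_bound y n.+1 (l2_c n C).
Proof.
move=> nN C0 yC [//|h hs] t [hsn] /= /andP[h0 hs0] t0.
have [s0 st _ _] := halfwayP t0; have o0 := om_gt0 t0.
have hhs0 : pos (h :: hs) by rewrite /= h0.
pose cn := comp_c n.+1 C; have cn0 : 0 <= cn by exact: comp_c_ge0.
have mF : measurable_fun setT (fun x => eta (h :: hs) x * E x).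
  by apply: measurable_funM; [exact: measurable_eta|exact: measurable_decay].
have mF2 : measurable_fun setT (fun x => (eta (h :: hs) x * E x) ^+ 2) by exact: measurable_funX.
set W := (2 * C + comp_c n C) * (2 ^+ n * expR c) * (eta hs t * E t).
have V0 : 0 <= 2 * C + comp_c n C by have := comp_c_ge0 n C0; lra.
have W0 : 0 <= W.
  rewrite /W; apply: mulr_ge0; last exact: etaE_ge0.
  apply: mulr_ge0 => //; by rewrite mulr_ge0 ?exprn_ge0 ?expR_ge0.
have := @energy_step h hs t W (cn ^+ 2 * ((1 + (2 * c)^-1) * om t * ((2 ^+ n.+1 * expR c) * (eta (h :: hs) t * E t)) ^+ 2))
  (fun x => cn * (eta (h :: hs) x * E x)) h0 hs0 t0 W0.
move=> /(_ (measurable_funM (measurable_cst _) mF)) ES.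
apply: le_trans (ES _ _ _ _) _.
- by move=> x sx; rewrite mulr_ge0 ?etaE_ge0 ?(lt_trans s0).
- move=> x sx; have x0 := lt_le_trans s0 sx.
  rewrite (le_trans (w_bound (ltnW nN) hsn hs0 C0 x0 _))//; first by move=> j /andP[_ /ltnW]; exact: yC.
  rewrite (@le_trans _ _ ((2 * C + comp_c n C) * (eta hs x * E x)))//.
    have := yC n (leqnn n) hs x hsn hs0 x0.
    by move: (eta hs x * E x) `|difs hs y x| (comp_c n C) => p q r; lra.
  by rewrite /W -[leRHS]mulrA (ler_wpM2l V0)// -[in 2 ^+ n]hsn etaE_halfway.
- move=> x sx; have x0 := lt_trans s0 sx.
  apply: (comp_bound (n := n.+1)) => //; first by rewrite /= hsn.
  by move=> j /andP[_]; rewrite ltnS; exact: yC.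
- apply: (@le_trans _ _ ((cn ^+ 2)%:E * tail (halfway t) (fun x => (eta (h :: hs) x * E x) ^+ 2)%R)%E).
    rewrite -(@tailZ R _ _ _ mF2 (fun x _ => sqr_ge0 _)) ?sqr_ge0//.
    rewrite le_eqVlt; apply/orP; left; apply/eqP; congr (tail _ _).
    by apply/funext => x; exact: exprMn.
  rewrite [leRHS]EFinM lee_wpmul2l ?lee_fin ?sqr_ge0//.
  rewrite (le_trans (tail_etaE s0 _ hhs0))// lee_fin.
  have k0 : 0 <= 1 + (2 * c)^-1 by rewrite addr_ge0// invr_ge0 mulr_ge0// ltW.
  rewrite ler_pM ?sqr_ge0//; first by rewrite mulr_ge0// ltW// om_gt0.
    by rewrite ler_wpM2l// om_homo.
  rewrite norm_le_sqr// ger0_norm ?etaE_ge0//.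
  have := @etaE_halfway (h :: hs) t (halfway t) t0 (lexx _); rewrite /= hsn; exact.
rewrite lee_fin /l2_c -/cn eta_cons gtr0_norm// /W; apply: eq_imp_le.
move: (eta hs t) (E t) (2 ^+ n) (2 ^+ n.+1) (expR c) (comp_c n C) (ramp_const R) => p q r u v z rc.
by field; rewrite !gt_eqF.
Qed.

Lemma difs_decay hs t : pos hs -> 0 < t -> `|difs hs y t| <= 2 ^+ size hs * B0 * E t.
Proof.
elim: hs t => [|h hs IH] t; first by move=> _ t0; rewrite mul1r; exact: (rd_decay D t0).
move=> /= /andP[h0 hs0] t0; rewrite difs_dif /dif (le_trans (ler_normB _ _))//.
have th := addr_gt0 t0 h0.
have h1 := IH _ hs0 th; have h2 := IH _ hs0 t0.
have h3 : 2 ^+ size hs * B0 * E (t + h) <= 2 ^+ size hs * B0 * E t.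
  rewrite ler_wpM2l ?mulr_ge0 ?exprn_ge0//.
  by apply: decay_anti => //; rewrite lerDl ltW.
by rewrite exprS; lra.
Qed.

Lemma difs_continuous hs t : pos hs -> 0 < t -> {for t, continuous (difs hs y)}.
Proof.
elim: hs t => [|h hs IH] t; first by move=> _; exact: (rd_continuous D).
move=> /= /andP[h0 hs0] t0; rewrite difs_dif; apply: cvgB; last exact: IH.
apply: (@continuous_comp _ _ _ (fun z : R => z + h)); last by apply: IH => //; rewrite addr_gt0.
by apply: cvgD; [exact: cvg_id|exact: cvg_cst].
Qed.

(* [sig = sup_t |difs hs y t| / (eta hs t * E t)] is finite for fixed [hs], and Agmon's
   inequality bounds its square by a linear function of [sig]. *)
Lemma absorption hs C1 C2 : pos hs -> 0 <= C1 -> 0 <= C2 ->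
  (forall t, 0 < t ->
    (tail t (fun x => `|difs hs y x| ^+ 2)%R <= (C1 * om t * (eta hs t * E t) ^+ 2)%:E)%E) ->
  (forall sig, 0 <= sig -> (forall t, 0 < t -> `|difs hs y t| <= sig * (eta hs t * E t)) ->
    forall l t, 0 < l -> 0 < t -> (tail t (fun x => `|difs (l :: hs) y x| ^+ 2)%R <=
      (C2 * (sig + 1) ^+ 2 * (eta hs t * E t) ^+ 2 * l ^+ 2 / om t)%:E)%E) ->
  forall t, 0 < t -> `|difs hs y t| <= (2 * (C1 + 1) * (C2 + 1) + 1) * (eta hs t * E t).
Proof.
move=> hs0 C10 C20 L2 Hsig.
have eE0 t : 0 < t -> 0 < eta hs t * E t.
  by move=> t0; rewrite mulr_gt0 ?eta_gt0// decay_gt0.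
pose rat t := `|difs hs y t| / (eta hs t * E t).
pose V := [set r | exists2 t, 0 < t & r = rat t].
pose M := 2 * (C1 + 1) * (C2 + 1).
have Vne : V !=set0 by exists (rat 1), 1.
have e1 : 0 < eta hs 1 by rewrite eta_gt0.
have e1t t : 0 < t -> eta hs 1 <= eta hs t.
  move=> t0; rewrite /eta ler_prod// => h _; rewrite divr_ge0 ?(ltW (om_gt0 _))//=.
  rewrite ler_wpM2l// lef_pV2 ?posrE ?om_gt0// (_ : om 1 = 1) ?om_le1//.
  by rewrite /om minxx.
have Vub : has_ubound V.
  exists (2 ^+ size hs * B0 / eta hs 1) => _ [t t0 ->].
  rewrite /rat ler_pdivrMr ?eE0// (le_trans (difs_decay hs0 t0))//.
  have b0 : 0 <= 2 ^+ size hs * B0 by rewrite mulr_ge0 ?exprn_ge0.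
  rewrite mulrA (ler_wpM2r (ltW (decay_gt0 _ _)))// mulrAC ler_pdivlMr//.
  by rewrite (ler_wpM2l b0)// e1t.
pose sig := sup V.
have ratsig t : 0 < t -> rat t <= sig by move=> t0; apply: ub_le_sup => //; exists t.
have rat0 t : 0 < t -> 0 <= rat t by move=> t0; rewrite divr_ge0// ltW// eE0.
have sig0 : 0 <= sig := le_trans (rat0 1 ltr01) (ratsig 1 ltr01).
have bnd t : 0 < t -> `|difs hs y t| <= sig * (eta hs t * E t).
  by move=> t0; rewrite -ler_pdivrMr ?eE0//; exact: ratsig.
have M0 : 2 <= M.
  rewrite /M; have := mulr_ge0 C10 C20; lra.
have sq t : 0 < t -> rat t ^+ 2 <= M * (sig + 1).
  move=> t0; have o0 := om_gt0 t0; have eE := eE0 t t0.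
  pose ro := Num.sqrt (om t); have ro0 : 0 < ro by rewrite sqrtr_gt0.
  have ro2 : om t = ro ^+ 2 by rewrite sqr_sqrtr// ltW.
  have := @agmon R H (rd_sep D) (difs hs y) t ((C2 + 1) * (sig + 1) * (eta hs t * E t) / ro)
    ((C1 + 1) * ro * (eta hs t * E t)) (hdy hs) (difs_continuous hs0 t0).
  move: (L2 t t0) (Hsig sig sig0 bnd) eE; rewrite /rat ro2.
  set z := eta hs t * E t => L2t Ht z0 Ag.
  have zE : eta hs t * E t = z by [].
  have C1p : 0 < C1 + 1 by rewrite ltr_wpDl.
  have C2p : 0 < C2 + 1 by rewrite ltr_wpDl.
  clearbody z.
  have s1 : 0 < sig + 1 by rewrite ltr_wpDl.
  have z2 : 0 <= z ^+ 2 by rewrite sqr_ge0.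
  rewrite expr_div_n ler_pdivrMr ?exprn_gt0//.
  apply: le_trans (Ag _ _ _ _) _.
  - by rewrite divr_gt0// !mulr_gt0.
  - by rewrite !mulr_gt0.
  - apply: le_trans L2t _; rewrite lee_fin -mulrA [leRHS](_ : _ = (C1 + 1) ^+ 2 * (ro ^+ 2 * z ^+ 2)); last by ring.
    have C1le : C1 <= (C1 + 1) ^+ 2.
      by rewrite -subr_ge0 (_ : _ - _ = C1 ^+ 2 + C1 + 1); [rewrite !addr_ge0 ?sqr_ge0|ring].
    by rewrite ler_wpM2r// mulr_ge0 ?sqr_ge0.
  - move=> l /andP[l0 _]; rewrite (_ : dif l (difs hs y) = difs (l :: hs) y); last by rewrite /= difs_dif.
    have := Ht l t l0 t0; rewrite ro2 zE => /le_trans; apply; rewrite lee_fin.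
    rewrite [leLHS](_ : _ = C2 * ((sig + 1) * z * l / ro) ^+ 2); last by field; rewrite gt_eqF.
    rewrite [leRHS](_ : _ = (C2 + 1) ^+ 2 * ((sig + 1) * z * l / ro) ^+ 2); last by field; rewrite gt_eqF.
    by rewrite ler_wpM2r ?sqr_ge0//; have := sqr_ge0 C2; lra.
  by apply: eq_imp_le; rewrite /M; field; rewrite gt_eqF.
have sigM : sig ^+ 2 <= M * (sig + 1).
  have b0 : 0 <= M * (sig + 1) by rewrite mulr_ge0 ?addr_ge0// (le_trans _ M0).
  suff : sig <= Num.sqrt (M * (sig + 1)).
    by move=> h; rewrite -(sqr_sqrtr b0) lerXn2r ?nnegrE ?sqrtr_ge0.
  apply: ge_sup => // _ [t t0 ->].
  by rewrite -[rat t]ger0_norm ?rat0// -sqrtr_sqr ler_sqrt// sq.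
have sM : sig <= M + 1 by rewrite leNgt; apply/negP => MS; nra.
by move=> t t0; rewrite (le_trans (bnd t t0))// ler_wpM2r// ltW// eE0.
Qed.

Lemma difs2_comp_bound h l x : (1 < N)%N ->
  `|difs [:: l; h] g x| <= 4^-1 * `|difs [:: l; h] y x| + K * (`|dif l y x| * `|dif h y x|).
Proof.
move=> N1; rewrite !difs_consE /= /g; set a := y x.
pose d := dif l y x; pose p := dif h y x; pose p' := dif h y (x + l).
have e2 : y (x + l) = a + d by rewrite /d /dif [RHS]addrC subrK.
have e3 : y (x + h) = a + p by rewrite /p /dif [RHS]addrC subrK.
have e4 : y (x + l + h) = a + d + p' by rewrite -e2 /p' /dif [RHS]addrC subrK.
rewrite -/d -/p e4 e2 e3 -/a.
have -> : G (a + d + p') - G (a + d) - (G (a + p) - G a) =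
    (G (a + d + p') - G (a + d + p)) + difs [:: d; p] G a.
  by rewrite !difs_consE /= !addrA subrK.
rewrite (le_trans (ler_normD _ _))// lerD//.
  rewrite (le_trans (rd_lip D _ _))// ler_wpM2l//.
  apply: eq_imp_le; congr `|_|; rewrite opprD addrACA subrr add0r.
  by rewrite [a + d + p']addrC addrK [a + p]addrC addrK.
by have := rd_GK D (bs := [:: d; p]) a; rewrite /= N1 big_cons big_cons big_nil mulr1; exact.
Qed.

Lemma l2_weaken hs C s t : 0 <= C -> 0 < t -> halfway t <= s -> s <= t ->
  C * om s * (eta hs s * E s) ^+ 2 <= C * om t * (2 ^+ size hs * expR c * (eta hs t * E t)) ^+ 2.
Proof.
move=> C0 t0 ts st; have [s0 _ _ _] := halfwayP t0; have sp := lt_le_trans s0 ts.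
rewrite ler_pM ?sqr_ge0//; first by rewrite mulr_ge0// ltW// om_gt0.
  by rewrite ler_wpM2l// om_homo.
by rewrite norm_le_sqr// ger0_norm ?etaE_ge0 ?etaE_halfway.
Qed.

Definition pw1_c C1 := 2 * (C1 + 1) *
  (2 * ramp_const R * 16 * expR c ^+ 2 + 64 * K ^+ 2 * expR c ^+ 4 * C1 + 1) + 1.

Lemma pw_bound1 C1 : (1 < N)%N -> 0 <= C1 -> l2_bound y 1 C1 -> pw_bound y 1 (pw1_c C1).
Proof.
move=> N1 C10 L2 [//|h [|//]] t _ hs0 t0.
have rc0 := ramp_const_ge0 R.
apply: (absorption hs0 C10) => // {t t0}.
- rewrite addr_ge0//; first by rewrite mulr_ge0 ?sqr_ge0// mulr_ge0// mulr_ge0.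
  by rewrite mulr_ge0// mulr_ge0 ?exprn_ge0 ?expR_ge0// mulr_ge0 ?sqr_ge0.
- by move=> t t0; exact: L2.
move=> sig sig0 Hsig l t l0 t0; have [s0 st _ _] := halfwayP t0; have o0 := om_gt0 t0.
set z := eta [:: h] t * E t; have z0 : 0 <= z by exact: etaE_ge0.
set L := expR c; have L0 : 0 <= L by exact: expR_ge0.
have Px x : halfway t <= x -> `|difs [:: h] y x| <= sig * (2 * L * z).
  move=> tx; rewrite (le_trans (Hsig _ (lt_le_trans s0 tx)))// ler_wpM2l//.
  exact: (@etaE_halfway [:: h]).
pose Q := K * (sig * (2 * L * z)); have V0 : 0 <= sig * (2 * L * z).
  by apply: mulr_ge0 => //; apply: mulr_ge0 => //; exact: mulr_ge0.
have Q0 : 0 <= Q by exact: mulr_ge0.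
have mF : measurable_fun setT (fun x => Q * `|difs [:: l] y x|).
  by apply: measurable_funM => //; exact: hmeas_norm (hdy [:: l]).
have W0 : 0 <= 2 * (sig * (2 * L * z)) by exact: mulr_ge0.
have := @energy_step l [:: h] t (2 * (sig * (2 * L * z)))
  (Q ^+ 2 * (C1 * om t * (2 * L * (eta [:: l] t * E t)) ^+ 2)) _ l0 hs0 t0 W0 mF.
move=> ES; apply: le_trans (ES _ _ _ _) _.
- by move=> x _; rewrite mulr_ge0.
- move=> x sx; have x0 := lt_le_trans s0 sx.
  apply: le_trans (@w_bound 1 0 [:: h] x (ltnW N1) erefl hs0 (lexx _) x0 _) _; first by move=> [|[|j]].
  by rewrite /comp_c mulr0 !mul0r addr0 ler_wpM2l//; exact: Px.
- move=> x sx; rewrite (le_trans (difs2_comp_bound h l x N1))// lerD2l -mulrA ler_wpM2l//.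
  by rewrite mulrC ler_wpM2r//; exact: Px (ltW sx).
- have ml := measurable_norm2 (hdy [:: l]).
  apply: (@le_trans _ _ ((Q ^+ 2)%:E * tail (halfway t) (fun x => `|difs [:: l] y x| ^+ 2)%R)%E).
    rewrite -(@tailZ R _ _ _ ml (fun x _ => sqr_ge0 _)) ?sqr_ge0//.
    rewrite le_eqVlt; apply/orP; left; apply/eqP; congr (tail _ _).
    by apply/funext => x; exact: exprMn.
  rewrite [leRHS]EFinM lee_wpmul2l ?lee_fin ?sqr_ge0//.
  apply: le_trans (L2 [:: l] _ erefl _ s0) _; first by rewrite /= l0.
  by rewrite lee_fin; exact: (@l2_weaken [:: l]).
rewrite lee_fin /Q /eta big_cons big_nil mulr1 gtr0_norm//.
have E1 : E t ^+ 2 <= 1 by rewrite exprn_ile1 ?(ltW (decay_gt0 _ _)) ?decay_le1// ltW.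
have -> : 2 * ramp_const R * (2 * (sig * (2 * L * z))) ^+ 2 * l ^+ 2 / om t +
    4 * ((K * (sig * (2 * L * z))) ^+ 2 * (C1 * om t * (2 * L * (l / om t * E t)) ^+ 2)) =
    (sig ^+ 2 * (2 * ramp_const R * 16 * L ^+ 2) + sig ^+ 2 * (64 * K ^+ 2 * L ^+ 4 * C1 * E t ^+ 2)) *
    (z ^+ 2 * l ^+ 2 / om t).
  by move: (ramp_const R) (E t) => rc e; field; rewrite gt_eqF.
have c1 : 0 <= 2 * ramp_const R * 16 * L ^+ 2 by rewrite mulr_ge0 ?sqr_ge0// mulr_ge0// mulr_ge0.
have c2 : 0 <= 64 * K ^+ 2 * L ^+ 4 * C1.
  by rewrite mulr_ge0// mulr_ge0 ?exprn_ge0// mulr_ge0 ?sqr_ge0.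
have c3 : 64 * K ^+ 2 * L ^+ 4 * C1 * E t ^+ 2 <= 64 * K ^+ 2 * L ^+ 4 * C1 by rewrite ler_piMr.
have s2 : sig ^+ 2 <= (sig + 1) ^+ 2 by rewrite lerXn2r ?nnegrE ?addr_ge0// lerDl.
rewrite [leRHS](_ : _ = (sig + 1) ^+ 2 * (2 * ramp_const R * 16 * L ^+ 2 + 64 * K ^+ 2 * L ^+ 4 * C1) *
  (z ^+ 2 * l ^+ 2 / om t)); last by field; rewrite gt_eqF.
rewrite ler_wpM2r//; first by rewrite divr_ge0 ?(ltW o0)// mulr_ge0 ?sqr_ge0.
rewrite -mulrDr ler_pM ?sqr_ge0//; last by rewrite lerD2l.
by rewrite addr_ge0// mulr_ge0 ?sqr_ge0.
Qed.

Lemma etaX hs t : eta hs t = (\prod_(h <- hs) `|h|) / om t ^+ size hs.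
Proof. by rewrite /eta big_split/= big_const_seq count_predT iter_mulr_1 exprVn. Qed.

Definition pwS_c n C C1 := 2 * (C1 + 1) *
  (2 * ramp_const R * ((2 + comp_c n C) * (2 ^+ n * expR c)) ^+ 2 +
   4 * (comp_c n.+1 (C + 1) ^+ 2 * (4 ^+ (2 ^ n.+1 * 2 ^ n.+1).+1 * ((1 + (2 * c)^-1 + C1) *
     (2 ^+ n.+1 * expR c) ^+ 2))) + 1) + 1.

Lemma pw_boundS n C C1 : (1 < n < N)%N -> 0 <= C -> 0 <= C1 ->
  (forall j, (0 < j < n)%N -> pw_bound y j C) -> l2_bound y n C1 ->
  pw_bound y n (pwS_c n C C1).
Proof.
move=> /andP[n1 nN] C0 C10 yC L2 hs t hsn hs0 t0.
have rc0 := ramp_const_ge0 R.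
set cc := comp_c n.+1 (C + 1).
have C'0 : 0 <= C + 1 by rewrite addr_ge0.
have cc0 : 0 <= cc by exact: comp_c_ge0.
have cn0 : 0 <= comp_c n C by exact: comp_c_ge0.
have k0 : 0 <= 1 + (2 * c)^-1 by rewrite addr_ge0// invr_ge0 mulr_ge0// ltW.
have k1 : 0 <= 1 + (2 * c)^-1 + C1 by rewrite addr_ge0.
set M4 := (2 ^ n.+1 * 2 ^ n.+1).+1.
have M40 : 0 <= (4 : R) ^+ M4 by rewrite exprn_ge0.
set L := expR c; have L0 : 0 <= L by exact: expR_ge0.
have p2n k : 0 <= (2 : R) ^+ k by rewrite exprn_ge0.
apply: (absorption hs0 C10) => // {t t0}.
- apply: addr_ge0; first by apply: mulr_ge0; [exact: mulr_ge0|exact: sqr_ge0].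
  apply: mulr_ge0 => //; apply: mulr_ge0; first exact: sqr_ge0.
  by apply: mulr_ge0 => //; apply: mulr_ge0 => //; exact: sqr_ge0.
- by move=> t t0; exact: L2.
move=> sig sig0 Hsig l t l0 t0; have [s0 st _ _] := halfwayP t0; have o0 := om_gt0 t0.
set s := halfway t in s0 st *; have os := om_gt0 s0.
set LH := l :: hs; have LHn : size LH = n.+1 by rewrite /= hsn.
have LH0 : pos LH by rewrite /= l0.
pose kT (T : seq R) := (\prod_(h <- LH) `|h|) / (\prod_(h <- T) `|h|).
pose good (j : seq R * seq R) := [&& size j.1 == n, subseq j.1 LH & subseq j.2 LH].
pose f (i : option (seq R * seq R)) x := match i with
  | None => eta LH x * E x
  | Some j => if good j then kT j.1 * ((om x)^-1 * `|difs j.1 y (x + \sum_(h <- j.2) h)|) else 0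
  end.
have prod_gt0 T : pos T -> 0 < \prod_(h <- T) `|h|.
  by move=> /seq.allP T0; rewrite big_seq prodr_gt0// => h /T0 h0; rewrite normr_gt0 gt_eqF.
have kT0 T : pos T -> 0 <= kT T by move=> T0; rewrite divr_ge0// ltW// prod_gt0.
have kTE T x : pos T -> size T = n -> 0 < x -> kT T * (om x)^-1 * eta T x = eta LH x.
  move=> T0 Tn x0; have ox := om_gt0 x0; rewrite !etaX LHn Tn /kT exprS.
  by field; rewrite !gt_eqF ?exprn_gt0 ?prod_gt0.
have f0 i x : 0 < x -> 0 <= f i x.
  move=> x0; case: i => [j|] /=; last exact: etaE_ge0.
  case: ifP => // /and3P[_ j1 _]; apply: mulr_ge0; first by rewrite kT0// (pos_subseq j1).
  by rewrite mulr_ge0// invr_ge0 ltW// om_gt0.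
have mf i : measurable_fun setT (f i).
  case: i => [j|]; rewrite /f; last by apply: measurable_funM; [exact: measurable_eta|exact: measurable_decay].
  case: (good j); last exact: measurable_cst.
  apply: measurable_funM => //; apply: measurable_funM.
    exact: (measurableT_comp (@measurable_inv R) (@measurable_om R)).
  exact: hmeas_norm (hmeas_shift _ (hdy j.1)).
pose Bd := (1 + (2 * c)^-1 + C1) * om s * (eta LH s * E s) ^+ 2.
have os2 : 0 <= om s * (eta LH s * E s) ^+ 2 by rewrite mulr_ge0 ?sqr_ge0// ltW.
have Bd0 : 0 <= Bd by rewrite /Bd -mulrA mulr_ge0.
have fB i : (tail s (fun x => f i x ^+ 2)%R <= Bd%:E)%E.
  case: i => [[T S]|]; rewrite /f; last first.
    apply: le_trans (tail_etaE s0 _ LH0) _ => //; rewrite lee_fin /Bd -!mulrA ler_wpM2r//.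
    by rewrite lerDl.
  case gE : (good (T, S)) => /=; last by rewrite /tail integral0_eq ?lee_fin// => x _; rewrite expr0n.
  move/and3P: gE => [/eqP Tn' Th' Sh'].
  have Tn : size T = n := Tn'; have Th : subseq T LH := Th'; have Sh : subseq S LH := Sh'.
  clear Tn' Th' Sh'.
  have T0 := pos_subseq Th LH0; have S0 := pos_sum_ge0 (pos_subseq Sh LH0).
  have md := measurable_norm2 (hdy T).
  have mds := measurable_norm2 (hmeas_shift (\sum_(h <- S) h) (hdy T)).
  apply: (@le_trans _ _ (((kT T / om s) ^+ 2)%:E * tail s (fun x => `|difs T y (x + \sum_(h <- S) h)| ^+ 2)%R)%E).
    rewrite -(@tailZ R _ _ _ mds (fun x _ => sqr_ge0 _)) ?sqr_ge0//.
    apply: le_tail.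
    - apply: measurable_funX; apply: measurable_funM => //; apply: measurable_funM.
        exact: (measurableT_comp (@measurable_inv R) (@measurable_om R)).
      exact: hmeas_norm (hmeas_shift _ (hdy T)).
    - exact: measurable_funM.
    move=> x sx; have x0 := lt_trans s0 sx; rewrite sqr_ge0/= -exprMn norm_le_sqr//.
    rewrite ger0_norm; last by rewrite mulr_ge0 ?kT0// mulr_ge0// invr_ge0 ltW// om_gt0.
    rewrite -[leRHS]mulrA (ler_wpM2l (kT0 T T0))// ler_wpM2r//.
    by rewrite lef_pV2 ?posrE ?om_gt0// om_homo// ltW.
  apply: (@le_trans _ _ (((kT T / om s) ^+ 2)%:E * (C1 * om s * (eta T s * E s) ^+ 2)%:E)%E).
    rewrite lee_wpmul2l ?lee_fin ?sqr_ge0//.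
    rewrite (tail_shift (F := fun x => `|difs T y x| ^+ 2))//.
    apply: le_trans (L2 T s Tn T0 s0); apply: tail_anti => //.
    by rewrite lerDl.
  rewrite -EFinM lee_fin [leLHS](_ : _ = C1 * (om s * (eta LH s * E s) ^+ 2)); last first.
    by rewrite -(kTE T s T0 Tn s0); ring.
  by rewrite /Bd -mulrA ler_wpM2r// lerDr.
pose r := None :: [seq Some j | j <- sub_pairs LH].
have rsz : size r = M4 by rewrite /= size_map size_sub_pairs LHn.
pose F x := cc * \sum_(i <- r) f i x.
have mF0 : measurable_fun setT (fun x => \sum_(i <- r) f i x) by exact: measurable_sum.
have mF : measurable_fun setT F by exact: measurable_funM.
have tF : (tail s (fun x => F x ^+ 2)%R <= (cc ^+ 2 * (4 ^+ M4 * Bd))%:E)%E.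
  have mF2 : measurable_fun setT (fun x => (\sum_(i <- r) f i x) ^+ 2) by exact: measurable_funX.
  apply: (@le_trans _ _ ((cc ^+ 2)%:E * tail s (fun x => (\sum_(i <- r) f i x) ^+ 2)%R)%E).
    rewrite -(@tailZ R _ _ _ mF2 (fun x _ => sqr_ge0 _)) ?sqr_ge0//.
    rewrite le_eqVlt; apply/orP; left; apply/eqP; congr (tail _ _).
    by apply/funext => x; exact: exprMn.
  rewrite [leRHS]EFinM lee_wpmul2l ?lee_fin ?sqr_ge0// -rsz.
  exact: tail_sum_sqr.
set z := eta hs t * E t; have z0 : 0 <= z by exact: etaE_ge0.
pose W := (2 + comp_c n C) * (sig + 1) * (2 ^+ n * L * z).
have W0 : 0 <= W.
  by apply: mulr_ge0; [apply: mulr_ge0; rewrite addr_ge0|apply: mulr_ge0 => //; exact: mulr_ge0].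
have ES := @energy_step l hs t W (cc ^+ 2 * (4 ^+ M4 * Bd)) F l0 hs0 t0 W0 mF.
apply: le_trans (ES _ _ _ tF) _; rewrite -/s.
- move=> x sx; have x0 := lt_trans s0 sx; apply: mulr_ge0 => //.
  by apply: sumr_ge0 => i _; exact: f0.
- move=> x sx; have x0 := lt_le_trans s0 sx.
  apply: le_trans (w_bound (ltnW nN) hsn hs0 C0 x0 yC) _.
  apply: (@le_trans _ _ ((2 + comp_c n C) * (sig + 1) * (eta hs x * E x))).
    have := Hsig x x0; have := etaE_ge0 hs x0.
    move: (eta hs x * E x) `|difs hs y x| (comp_c n C) cn0 => p d k kn0 pn0 dp.
    have := mulr_ge0 (mulr_ge0 kn0 sig0) pn0; nra.
  rewrite /W ler_wpM2l//; first by apply: mulr_ge0; rewrite addr_ge0.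
  by rewrite -[in 2 ^+ n]hsn; exact: etaE_halfway.
- move=> x sx; have x0 := lt_trans s0 sx.
  have e0 (h : R) : 0 <= `|h| / om x by rewrite divr_ge0// ltW// om_gt0.
  have b01 : 0 <= E x <= 1 by rewrite (ltW (decay_gt0 _ _)) decay_le1// ltW.
  pose ZL := eta LH x * E x.
  have ZL0 : 0 < ZL by rewrite mulr_gt0 ?eta_gt0// decay_gt0.
  pose beta := 1 + \sum_(j <- sub_pairs LH) f (Some j) x / ZL.
  have beta1 : 1 <= beta.
    by rewrite lerDl sumr_ge0// => j _; apply: divr_ge0; [exact: f0|exact: ltW].
  have betaZ : beta * ZL = \sum_(i <- r) f i x.
    rewrite /beta mulrDl mul1r mulr_suml big_cons big_map; congr (_ + _).
    by apply: eq_bigr => j _; rewrite divfK// gt_eqF.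
  have hsN : (1 < size hs < N)%N by rewrite hsn n1.
  apply: le_trans (difs_comp_bound_linear e0 C'0 b01 beta1 hsN _ _) _.
  + move=> T S /andP[T0 Tn] Th Sh; rewrite hsn in Tn.
    have := pw_bound_shift (yC (size T) _) C0 erefl LH0 Th Sh x0.
    rewrite T0 Tn => /(_ isT) /le_trans; apply.
    rewrite -mulrA (mulrC (E x)) ler_wpM2r ?etaE_ge0// lerDl//.
  + move=> T S Tn Th Sh; rewrite hsn in Tn; have T0 := pos_subseq Th LH0.
    have ox := om_gt0 x0.
    have fle : f (Some (T, S)) x <= beta * ZL.
      rewrite betaZ big_cons big_map (big_rem (T, S)) ?mem_sub_pairs//=.
      rewrite addrCA lerDl; apply: addr_ge0; first exact: etaE_ge0.
      by apply: sumr_ge0 => j _; exact: (f0 (Some j)).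
    have gTS : good (T, S) by apply/and3P; split => //; apply/eqP.
    have fE : f (Some (T, S)) x = kT T * ((om x)^-1 * `|difs T y (x + \sum_(h <- S) h)|).
      by rewrite /f gTS.
    move: fle; rewrite fE /ZL -(kTE T x T0 Tn x0).
    have kp : 0 < kT T / om x by rewrite divr_gt0// divr_gt0// prod_gt0.
    rewrite (mulrA (kT T)) (_ : beta * _ = kT T / om x * (beta * (eta T x * E x))); last by ring.
    rewrite ler_pM2l// => /le_trans; apply.
    rewrite -!mulrA (mulrC (E x)) -[X in _ <= _ * X]/(beta * (eta T x * E x)).
    rewrite ler_peMl ?lerDr// mulr_ge0 ?etaE_ge0//.
    exact: le_trans beta1.
  rewrite lerD2l hsn /F -betaZ /ZL -/(eta LH x); apply: eq_imp_le.
  by rewrite /cc /comp_c /=; move: (lip_const _ _) (_ ^+ _) => p q; ring.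
rewrite lee_fin.
have BdE : Bd <= (1 + (2 * c)^-1 + C1) * om t * (2 ^+ n.+1 * L * (eta LH t * E t)) ^+ 2.
  by rewrite -[in 2 ^+ n.+1]LHn; apply: l2_weaken.
have cc4 : 0 <= 4 * (cc ^+ 2 * 4 ^+ M4) by rewrite mulr_ge0// mulr_ge0 ?sqr_ge0.
have := ler_wpM2l cc4 BdE.
have sg : 1 <= (sig + 1) ^+ 2 by rewrite exprn_ege1// lerDr.
set P := 4 * (cc ^+ 2 * (4 ^+ M4 * ((1 + (2 * c)^-1 + C1) * (2 ^+ n.+1 * L) ^+ 2))).
have P0 : 0 <= P by rewrite /P mulr_ge0// mulr_ge0 ?sqr_ge0// mulr_ge0// mulr_ge0 ?sqr_ge0.
set V := z ^+ 2 * l ^+ 2 / om t.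
have V0 : 0 <= V by rewrite /V divr_ge0 ?(ltW o0)// mulr_ge0 ?sqr_ge0.
rewrite [X in _ <= X -> _](_ : _ = P * V); last first.
  have etaLH : eta LH t = l / om t * eta hs t by rewrite /LH eta_cons gtr0_norm.
  rewrite /P /V /z etaLH.
  move: (4 ^+ M4) (2 ^+ n.+1) (1 + (2 * c)^-1 + C1) (eta hs t) (E t) => p1 p2 p3 p4 p5.
  by field; rewrite gt_eqF.
move=> h1; rewrite [leRHS](_ : _ = 2 * ramp_const R * W ^+ 2 * l ^+ 2 / om t + P * (sig + 1) ^+ 2 * V); last first.
  rewrite /W /V -/L; move: (2 ^+ n) (comp_c n C) (ramp_const R) => p1 p2 p3.
  by field; rewrite gt_eqF.
rewrite lerD2l (_ : 4 * _ = 4 * (cc ^+ 2 * 4 ^+ M4) * Bd); last by ring.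
by rewrite (le_trans h1)// ler_wpM2r// ler_peMr.
Qed.

End FixedData.

Lemma pw_bound_le (H : completeNormedModType R) (u : R -> H) n C C' : C <= C' ->
  pw_bound u n C -> pw_bound u n C'.
Proof.
move=> CC uC hs t hsn hs0 t0; rewrite (le_trans (uC hs t hsn hs0 t0))// ler_wpM2r//.
by rewrite mulr_ge0 ?eta_ge0// ltW// decay_gt0.
Qed.

Lemma l2_bound_le (H : completeNormedModType R) (u : R -> H) n C C' : C <= C' ->
  l2_bound u n C -> l2_bound u n C'.
Proof.
move=> CC uC hs t hsn hs0 t0; apply: (le_trans (uC hs t hsn hs0 t0)).
by rewrite lee_fin ler_wpM2r ?sqr_ge0// ler_wpM2r// ltW// om_gt0.
Qed.

Lemma difference_bounds n : (n < N)%N -> exists C, 0 <= C /\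
  forall (H : completeNormedModType R) (ip : {dot H for (idfun : R -> R)})
    (A : {linear H -> H}) (G : H -> H) (y : R -> H), regular_data ip A G y ->
  (forall j, (j <= n)%N -> pw_bound y j C) /\ l2_bound y n.+1 C.
Proof.
elim: n => [|n IH] nN.
  exists (B0 + `|l2_c 0 B0|); split; first by rewrite addr_ge0.
  move=> H ip A G y D; have y0 : pw_bound y 0 B0.
    by move=> [|//] t _ _ t0; rewrite eta_nil mul1r; exact: (rd_decay D).
  split; first by case=> // _; apply: pw_bound_le y0; rewrite lerDl.
  apply: l2_bound_le (l2_next D nN B00 _); last by case.
  by rewrite (le_trans (ler_norm _))// lerDr.
have [C [C0 HC]] := IH (ltnW nN).
pose C' := C + `|pw1_c C| + `|pwS_c n.+1 C C|.
have CC' : C <= C' by rewrite /C' -addrA lerDl addr_ge0.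
have C'0 : 0 <= C' := le_trans C0 CC'.
exists (C' + `|l2_c n.+1 C'|); split; first by rewrite addr_ge0.
move=> H ip A G y D; have [pw l2] := HC H ip A G y D.
have pwC' j : (j <= n.+1)%N -> pw_bound y j C'.
  rewrite leq_eqVlt => /predU1P[->|]; last by rewrite ltnS => /pw; exact: pw_bound_le.
  case: n nN {IH HC} @C' CC' C'0 pw l2 => [|n] nN C' CC' C'0 pw l2.
    apply: pw_bound_le (pw_bound1 D nN C0 l2).
    by rewrite (le_trans (ler_norm _))// /C' -addrA addrCA lerDl addr_ge0.
  apply: pw_bound_le (pw_boundS D _ C0 C0 _ l2) => //; last by move=> i /andP[_ jn]; apply: pw.
  by rewrite (le_trans (ler_norm _))// /C' lerDr addr_ge0.
split; first by move=> j /pwC'; apply: pw_bound_le; rewrite lerDl.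
apply: l2_bound_le (l2_next D nN C'0 pwC').
by rewrite (le_trans (ler_norm _))// lerDr.
Qed.

End Regularity.

(** * Derivatives from differences *)

Section DerivativeFromDifferences.
Variables (R : realType) (H : completeNormedModType R).
Variables (f : R -> H) (tau B1 B2 : R).
Hypothesis B10 : 0 <= B1.
Hypothesis B20 : 0 <= B2.
Hypothesis dif1 : forall t h : R, tau <= t -> 0 < h -> `|dif h f t| <= B1 * h.
Hypothesis dif2 : forall t h l : R, tau <= t -> 0 < h -> 0 < l -> `|difs [:: l; h] f t| <= B2 * h * l.
Implicit Types t h l : R.

Let difD h l t : dif (h + l) f t = dif h f (t + l) + dif l f t.
Proof. by rewrite /dif [RHS]addrA subrK (addrC h) addrA. Qed.

Let dif2E h l t : difs [:: l; h] f t = dif h f (t + l) - dif h f t.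
Proof. exact: difs_consE. Qed.

Let multiple_dif t l m : tau <= t -> 0 < l ->
  `|dif (m%:R * l) f t - m%:R *: dif l f t| <= B2 * (m%:R * l) ^+ 2.
Proof.
move=> tt l0; elim: m => [|m IH].
  by rewrite mul0r scale0r subr0 /dif addr0 subrr normr0 expr0n mulr0.
have [->|m0] := posnP m.
  by rewrite mul1r scale1r subrr normr0 mulr_ge0 ?sqr_ge0.
have a0 : 0 < m%:R * l by rewrite mulr_gt0// ltr0n.
rewrite -natr1 mulrDl mul1r scalerDl scale1r difD opprD addrACA subrr addr0.
rewrite -(subrK (dif (m%:R * l) f t) (dif (m%:R * l) f (t + l))) -dif2E -addrA.
apply: le_trans (ler_normD _ _) _; have := lerD (dif2 tt a0 l0) IH => /le_trans; apply.
have := mulr_ge0 B20 (mulr_ge0 (ltW a0) (ltW l0)); have := mulr_ge0 B20 (sqr_ge0 l); lra.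
Qed.

(* [dif h f t] is compared with [m] times [dif l f t], [m] the integral part of [h / l]. *)
Let dif_ratio t h l : tau <= t -> 0 < h -> 0 < l ->
  `|dif h f t - (h / l) *: dif l f t| <= B2 * h ^+ 2 + 2 * B1 * l.
Proof.
move=> tt h0 l0; pose m := Num.truncn (h / l).
have := truncn_itv (ltW (divr_gt0 h0 l0)); rewrite -/m ler_pdivlMr// ltr_pdivrMr// -natr1 mulrDl mul1r.
move=> /andP[ah hal]; have am0 : 0 <= m%:R * l by rewrite mulr_ge0// ltW.
have -> : dif h f t - (h / l) *: dif l f t = (dif h f t - dif (m%:R * l) f t) +
    ((dif (m%:R * l) f t - m%:R *: dif l f t) + (m%:R - h / l) *: dif l f t).
  by rewrite scalerBl !subrKA.
have e1 : `|dif h f t - dif (m%:R * l) f t| <= B1 * l.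
  have -> : dif h f t - dif (m%:R * l) f t = dif (h - m%:R * l) f (t + m%:R * l).
    by have := difD (h - m%:R * l) (m%:R * l) t; rewrite subrK => ->; rewrite addrK.
  move: ah; rewrite le_eqVlt => /predU1P[->|ah].
    by rewrite subrr /dif addr0 subrr normr0 mulr_ge0// ltW.
  rewrite (le_trans (dif1 _ _))// ?subr_gt0 ?ler_wpDr//.
  by rewrite ler_wpM2l// lerBlDl ltW.
have e2 := multiple_dif m tt l0.
have e3 : `|(m%:R - h / l) *: dif l f t| <= B1 * l.
  rewrite normrZ -[leRHS]mul1r ler_pM// ?dif1//.
  rewrite distrC ger0_norm ?subr_ge0 ?ler_pdivlMr// lerBlDl ler_pdivrMr// mulrDl mul1r.
  exact: ltW.
have e4 : B2 * (m%:R * l) ^+ 2 <= B2 * h ^+ 2.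
  by rewrite ler_wpM2l// lerXn2r ?nnegrE// ltW.
apply: le_trans (ler_normD _ _) _; have := ler_normD (dif (m%:R * l) f t - m%:R *: dif l f t) ((m%:R - h / l) *: dif l f t).
by move: e1 e2 e3 e4; move: `|_ - dif _ f t| `|_ + _ *: _| `|_ - _ *: _| `|_ *: _| => u v p q; lra.
Qed.

Let quotient_cauchy t h h' : tau <= t -> 0 < h -> 0 < h' ->
  `|h^-1 *: dif h f t - h'^-1 *: dif h' f t| <= B2 * (h + h').
Proof.
move=> tt h0 h'0; apply/ler_addgt0Pr => /= e e0.
have D0 : 0 < 2 * B1 * (h^-1 + h'^-1) + 1.
  by rewrite ltr_wpDl// mulr_ge0 ?mulr_ge0// addr_ge0// invr_ge0 ltW.
pose l : R := e / (2 * B1 * (h^-1 + h'^-1) + 1); have l0 : 0 < l by rewrite divr_gt0.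
have lE : 2 * B1 * (h^-1 + h'^-1) * l <= e.
  apply: (@le_trans _ _ ((2 * B1 * (h^-1 + h'^-1) + 1) * l)); first by rewrite ler_wpM2r ?lerDl// ltW.
  by rewrite mulrC divfK ?gt_eqF.
have q (k : R) : 0 < k -> `|k^-1 *: dif k f t - l^-1 *: dif l f t| <= B2 * k + 2 * B1 * l / k.
  move=> k0; have -> : k^-1 *: dif k f t - l^-1 *: dif l f t = k^-1 *: (dif k f t - (k / l) *: dif l f t).
    by rewrite [RHS]scalerBr scalerA mulrA mulVf ?mul1r// gt_eqF.
  rewrite normrZ gtr0_norm ?invr_gt0// ler_pdivrMl// (le_trans (dif_ratio tt k0 l0))//.
  by apply: eq_imp_le; field; rewrite gt_eqF.
have := q h h0; have := q h' h'0; rewrite distrC => q1 q2.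
rewrite -(subrKA (l^-1 *: dif l f t)) (le_trans (ler_normD _ _))//.
apply: le_trans (lerD q2 q1) _.
rewrite [leLHS](_ : _ = B2 * (h + h') + 2 * B1 * (h^-1 + h'^-1) * l); last by ring.
by rewrite lerD2l.
Qed.

Let right_derivative t : tau <= t -> exists g : H,
  forall h, 0 < h -> `|h^-1 *: dif h f t - g| <= B2 * h.
Proof.
move=> tt; pose s n : R := n.+1%:R^-1.
have s0 n : 0 < s n by rewrite invr_gt0.
have scv : s n @[n --> \oo] --> (0 : R) by exact: cvg_harmonic.
pose q n := (s n)^-1 *: dif (s n) f t.
have : cvg (q n @[n --> \oo]).
  apply: cauchy_cvg; apply: cauchy_exP => e e0.
  have e1 : 0 < e / (2 * B2 + 1) by rewrite divr_gt0// ltr_wpDl// mulr_ge0.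
  have [n0 _ n0e] := cvg0_norm_lt scv e1.
  exists (q n0); exists n0 => // n /= nn; rewrite -ball_normE/=.
  apply: le_lt_trans (quotient_cauchy tt (s0 n0) (s0 n)) _.
  have := n0e n0 (leqnn _); have := n0e n nn; rewrite /= !gtr0_norm// => a1 a2.
  have e2 : (2 * B2 + 1) * (e / (2 * B2 + 1)) = e by rewrite mulrC divfK// gt_eqF// ltr_wpDl// mulr_ge0.
  have a4 := ler_wpM2l B20 (ltW a1); have a5 := ler_wpM2l B20 (ltW a2).
  by move: e1 e2 a4 a5 {a1 a2}; move: (e / _) (s n) (s n0) => d x y; lra.
move=> qcv; exists (lim (q n @[n --> \oo])) => h h0.
have c1 : `|h^-1 *: dif h f t - q n| @[n --> \oo] --> `|h^-1 *: dif h f t - lim (q n @[n --> \oo])|.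
  by apply: cvg_norm; apply: cvgB => //; exact: cvg_cst.
have c2 : B2 * (h + s n) @[n --> \oo] --> B2 * (h + 0).
  by apply: cvgM; [exact: cvg_cst|apply: cvgD => //; exact: cvg_cst].
rewrite addr0 in c2; apply: (ler_cvg_to c1 c2); apply: nearW => n.
exact: quotient_cauchy.
Qed.

Lemma derivable_of_difs t : tau < t -> derivable f t 1.
Proof.
move=> taut; have [g gP] := right_derivative (ltW taut).
suff : is_derive t (1 : R) f g by case.
apply/is_deriveP; apply/cvgrPdist_le => /= e e0.
have e1 : 0 < e / (2 * B2 + 1) by rewrite divr_gt0// ltr_wpDl// mulr_ge0.
have eE : 2 * B2 * (e / (2 * B2 + 1)) <= e.
  apply: (@le_trans _ _ ((2 * B2 + 1) * (e / (2 * B2 + 1)))); first by rewrite ler_wpM2r ?lerDl// ltW.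
  by rewrite mulrC divfK// gt_eqF// ltr_wpDl// mulr_ge0.
have ttau : 0 < t - tau by rewrite subr_gt0.
near=> h.
have h0 : h != 0 by near: h; exact: nbhs_dnbhs_neq.
have ht : `|h| < t - tau.
  by near: h; apply: dnbhs0_lt.
have he : `|h| <= e / (2 * B2 + 1) by near: h; apply: dnbhs0_le.
have main : `|g - h^-1 *: (f (h + t) - f t)| <= 2 * B2 * `|h|; last first.
  by rewrite (le_trans main)// (le_trans _ eE)// ler_wpM2l// mulr_ge0.
move: h0; rewrite neq_lt => /orP[hn|hp]; last first.
  rewrite distrC (addrC h) gtr0_norm// (le_trans (gP h hp))// -mulrA ler_peMl//.
    by rewrite mulr_ge0// ltW.
  by rewrite ler1n.
pose k := - h; have k0 : 0 < k by rewrite oppr_gt0.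
have kE : `|h| = k by rewrite ltr0_norm.
rewrite kE in ht *; have tk : tau <= t - k by move: ht; lra.
have [g' g'P] := right_derivative tk.
have q1 : h^-1 *: (f (h + t) - f t) = k^-1 *: dif k f (t - k).
  by rewrite /dif subrK /k opprK (addrC h) invrN scaleNr -scalerN opprB.
rewrite q1 -(subrKA g') (le_trans (ler_normD _ _))// -mulrA mulr_natl mulr2n lerD//; last first.
  by rewrite distrC; exact: g'P.
have gg' : forall l, 0 < l -> `|g - g'| <= B2 * k + 2 * B2 * l.
  move=> l l0; have a1 := gP l l0; have a2 := g'P l l0.
  have a3 : `|l^-1 *: dif l f t - l^-1 *: dif l f (t - k)| <= B2 * k.
    rewrite -scalerBr normrZ gtr0_norm ?invr_gt0// ler_pdivrMl//.
    have := dif2 tk l0 k0; rewrite dif2E subrK => /le_trans; apply.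
    by apply: eq_imp_le; ring.
  rewrite distrC in a1.
  have -> : g - g' = (g - l^-1 *: dif l f t) + ((l^-1 *: dif l f t - l^-1 *: dif l f (t - k)) +
      (l^-1 *: dif l f (t - k) - g')) by rewrite !subrKA.
  rewrite (le_trans (ler_normD _ _))//.
  have := ler_normD (l^-1 *: dif l f t - l^-1 *: dif l f (t - k)) (l^-1 *: dif l f (t - k) - g').
  by move=> a4; apply: le_trans (lerD a1 (le_trans a4 (lerD a3 a2))) _; lra.
apply/ler_addgt0Pr => /= d d0.
have d1 : 0 < d / (2 * B2 + 1) by rewrite divr_gt0// ltr_wpDl// mulr_ge0.
apply: le_trans (gg' _ d1) _; rewrite lerD2l.
apply: (@le_trans _ _ ((2 * B2 + 1) * (d / (2 * B2 + 1)))); first by rewrite ler_wpM2r ?lerDl// ltW.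
by rewrite mulrC divfK// gt_eqF// ltr_wpDl// mulr_ge0.
Unshelve. all: by end_near. Qed.

End DerivativeFromDifferences.

Section SmoothnessFromDifferences.
Variables (R : realType) (H : completeNormedModType R).
Implicit Types (f : R -> H) (hs : seq R).
Local Notation pos := (all (fun h : R => 0 < h)).

Lemma cvg_difs (F : nat -> R -> H) f hs (t : R) : pos hs -> 0 < t ->
  (forall s, 0 < s -> F n s @[n --> \oo] --> f s) ->
  difs hs (F n) t @[n --> \oo] --> difs hs f t.
Proof.
elim: hs t => [|h hs IH] t; first by move=> _ t0; exact.
move=> /= /andP[h0 hs0] t0 Ff; rewrite difs_dif.
rewrite (_ : (fun n => _) = (fun n => difs hs (F n) (t + h) - difs hs (F n) t)); last first.
  by apply/funext => n; rewrite difs_dif.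
by apply: cvgB; apply: IH => //; rewrite addr_gt0.
Qed.

Lemma difs_derive1_le f hs (t B : R) : (forall s : R, 0 < s -> derivable f s 1) ->
  pos hs -> 0 < t -> (forall h : R, 0 < h -> `|difs (h :: hs) f t| <= B * h) ->
  `|difs hs f^`()%classic t| <= B.
Proof.
move=> df hs0 t0 fB; pose s n : R := n.+1%:R^-1.
have s0 n : 0 < s n by rewrite invr_gt0.
have scv : s n @[n --> \oo] --> (0 : R) by exact: cvg_harmonic.
have sn0 n : s n != 0 by rewrite gt_eqF.
have sc : s n @[n --> \oo] --> (0 : R)^'.
  by move=> P /scv [n0 _ n0P]; exists n0 => // n /n0P /(_ (sn0 n)).
pose F n x := (s n)^-1 *: dif (s n) f x.
have Ff x : 0 < x -> F n x @[n --> \oo] --> f^`()%classic x.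
  move=> x0; have : is_derive x (1 : R) f (f^`()%classic x).
    by rewrite derive1E; apply: DeriveDef => //; exact: df.
  move=> /is_deriveP /(cvg_comp _ _ sc).
  apply: cvg_trans; apply: near_eq_cvg; apply: nearW => n /=.
  by rewrite /F /dif (addrC x).
have c1 : `|difs hs (F n) t| @[n --> \oo] --> `|difs hs f^`()%classic t|.
  by apply: cvg_norm; exact: cvg_difs.
have c2 : B @[n --> \oo] --> B by exact: cvg_cst.
apply: (ler_cvg_to c1 c2); apply: nearW => n.
have -> : difs hs (F n) t = (s n)^-1 *: difs (s n :: hs) f t.
  exact: (difs_comp_additive ( *:%R (s n)^-1) hs (dif (s n) f) t).
by rewrite normrZ gtr0_norm ?invr_gt0// ler_pdivrMl// mulrC fB.
Qed.

Variables (c : R) (C : nat -> R) (y : R -> H).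
Hypothesis c0 : 0 < c.
Hypothesis yC : forall n, pw_bound c y n (C n).

Let dyn_bound k (f : R -> H) := forall hs (t : R), pos hs -> 0 < t ->
  `|difs hs f t| <= C (k + size hs) * ((\prod_(h <- hs) `|h|) * om t ^- (k + size hs) * decay c t).

Let local_bound k f hs (tau : R) : dyn_bound k f -> 0 < tau -> pos hs -> forall t, tau <= t ->
  `|difs hs f t| <= `|C (k + size hs)| * om tau ^- (k + size hs) * \prod_(h <- hs) `|h|.
Proof.
move=> fb tau0 hs0 t taut; have t0 := lt_le_trans tau0 taut.
apply: le_trans (fb hs t hs0 t0) _; set m := (k + size hs)%N.
have P0 : 0 <= \prod_(h <- hs) `|h| by rewrite prodr_ge0.
have o1 : om t ^- m <= om tau ^- m.
  rewrite lef_pV2 ?posrE ?exprn_gt0 ?om_gt0// lerXn2r ?nnegrE ?om_homo// ltW// om_gt0//.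
have o0 : 0 <= om t ^- m by rewrite invr_ge0 exprn_ge0// ltW// om_gt0.
have d1 : decay c t <= 1 by rewrite decay_le1// ltW.
have d0 : 0 <= decay c t by rewrite ltW// decay_gt0.
have X0 : 0 <= \prod_(h <- hs) `|h| * om t ^- m * decay c t by rewrite !mulr_ge0.
apply: (@le_trans _ _ (`|C m| * (\prod_(h <- hs) `|h| * om t ^- m * decay c t))).
  by rewrite ler_wpM2r// ler_norm.
rewrite -[leRHS]mulrA; apply: ler_wpM2l => //; rewrite -[leRHS]mulr1.
apply: ler_pM => //; first exact: mulr_ge0.
by rewrite mulrC ler_wpM2r.
Qed.

Let dyn_derivable k f (t : R) : dyn_bound k f -> 0 < t -> derivable f t 1.
Proof.
move=> fb t0; have t2 : 0 < t / 2 by rewrite divr_gt0.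
have o2 j : 0 <= om (t / 2) ^- j by rewrite invr_ge0 exprn_ge0// ltW// om_gt0.
apply: (@derivable_of_difs R H f (t / 2) (`|C (k + 1)| * om (t / 2) ^- (k + 1))
    (`|C (k + 2)| * om (t / 2) ^- (k + 2))); rewrite ?mulr_ge0//; last by lra.
- move=> s h ss h0; have h1 : pos [:: h] by rewrite /= h0.
  by have := local_bound fb t2 h1 ss; rewrite big_cons big_nil mulr1 (gtr0_norm h0).
- move=> s h l ss h0 l0; have h1 : pos [:: l; h] by rewrite /= h0 l0.
  have := local_bound fb t2 h1 ss; rewrite !big_cons big_nil mulr1 (gtr0_norm h0) (gtr0_norm l0).
  by rewrite (mulrC l) mulrA.
Qed.

Let dyn_next k f : dyn_bound k f -> dyn_bound k.+1 f^`()%classic.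
Proof.
move=> fb hs t hs0 t0; apply: difs_derive1_le => // [s s0|h h0]; first exact: dyn_derivable fb s0.
have h1 : pos (h :: hs) by rewrite /= h0.
have := fb (h :: hs) t h1 t0; rewrite big_cons (gtr0_norm h0)/= -addSnnS => /le_trans; apply.
by apply: eq_imp_le; move: (om t ^- _) => p; ring.
Qed.

Let dyn_all k : dyn_bound k (y^`(k)%classic).
Proof.
elim: k => [|k IH]; last by rewrite derive1nS; exact: dyn_next.
move=> hs t hs0 t0; rewrite derive1n0 add0n.
by have := yC erefl hs0 t0; rewrite etaX !mulrA.
Qed.

Lemma smooth_of_pw_bound : smooth_on `]0, +oo[ y.
Proof. by move=> k t /=; rewrite in_itv/= andbT; exact: dyn_derivable (dyn_all k). Qed.

Lemma derive1n_bound k (t : R) : 0 < t ->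
  `|(y^`(k)%classic) t| <= C k * (om t ^- k * decay c t).
Proof. by move=> t0; have := @dyn_all k [::] t isT t0; rewrite big_nil mul1r addn0. Qed.

End SmoothnessFromDifferences.

(** * Bounds for the solution *)

Section Assembly.
Variable R : realType.
Local Notation mu := (@lebesgue_measure R).

Definition dif_mass (M : R) : R := Num.sqrt (8 * ramp_const R * M ^+ 2) + 1.

Definition tail_mass (M a : R) : R :=
  Num.sqrt (M ^+ 2 * (1 + ramp_const R * a ^+ 2) * expR (8 * decay_rate a)) + 1.

Definition amplitude (M a : R) : R :=
  Num.sqrt (2 * dif_mass M * tail_mass M a) + `|M| * expR (decay_rate a).

Lemma amplitude_ge0 M a : 0 <= amplitude M a.
Proof. by rewrite addr_ge0// mulr_ge0// expR_ge0. Qed.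

Variables (H : completeNormedModType R) (ip : {dot H for (idfun : R -> R)}).
Variables (A : {linear H -> H}) (G : H -> H).
Hypothesis hip : hilbert_inner ip.
Hypothesis sepH : separable_space H.
Hypothesis contA : continuous A.
Hypothesis symA : self_adjoint ip A.
Hypothesis G0 : G 0 = 0.
Let a := fine (opnorm A).

Section Decay.
Hypothesis G4 : forall u v : H, `|G u - G v| <= 4^-1 * `|u - v|.
Variables (y : R -> H) (M : R).
Hypothesis my : hmeas y.
Hypothesis yM : forall t, `|y t| <= M.
Hypothesis cy : forall t : R, 0 < t -> {for t, continuous y}.
Hypothesis soly : weak_sol ip A set0 y (fun t => rhs G (y t)).
Local Notation c := (decay_rate a).

Let M0 : 0 <= M. Proof. exact: le_trans (yM 0). Qed.

Let N0 : mu.-negligible set0. Proof. exact: negligible_set0. Qed.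

Let far t : 1 <= t -> `|y t| <= Num.sqrt (2 * dif_mass M * tail_mass M a) * decay c t.
Proof.
move=> t1; have t0 : 0 < t by exact: lt_le_trans t1.
have dif0 : 0 < dif_mass M by rewrite ltr_wpDl// sqrtr_ge0.
have tail0 : 0 < tail_mass M a by rewrite ltr_wpDl// sqrtr_ge0.
have be0 : 0 < tail_mass M a * expR (- (2 * c) * t) by rewrite mulr_gt0// expR_gt0.
have r0 := ramp_const_ge0 R.
have sq (u : R) : 0 <= u -> u <= (Num.sqrt u + 1) ^+ 2.
  move=> u0; rewrite -{1}(sqr_sqrtr u0) lerXn2r ?nnegrE ?sqrtr_ge0 ?addr_ge0 ?sqrtr_ge0//.
  by rewrite lerDl.
have e2 : (tail t (fun x : R => (`|y x| ^+ 2)%R) <= ((tail_mass M a * expR (- (2 * c) * t)) ^+ 2)%:E)%E.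
  apply: le_trans (tail_decay hip sepH contA symA G0 G4 my yM N0 soly t0) _.
  rewrite lee_fin exprMn -expRM_natr.
  rewrite -/a (_ : - (2 * c) * t * 2 = - (4 * c) * t); last by ring.
  rewrite ler_wpM2r ?expR_ge0// sq// mulr_ge0 ?expR_ge0//.
  by rewrite mulr_ge0 ?sqr_ge0// addr_ge0// mulr_ge0// sqr_ge0.
have e1 (l : R) : 0 < l <= 1 -> (tail t (fun x : R => (`|dif l y x| ^+ 2)%R) <= ((dif_mass M * l) ^+ 2)%:E)%E.
  move=> /andP[l0 l1].
  apply: le_trans (tail_dif_bound hip sepH contA symA G0 G4 my yM N0 soly t0 (ltW l0)) _.
  rewrite lee_fin exprMn ler_wpM2r ?sqr_ge0//.
  have K0 : 0 <= 8 * ramp_const R * M ^+ 2 by rewrite mulr_ge0 ?sqr_ge0// mulr_ge0.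
  by rewrite (le_trans _ (sq _ K0))// ler_pdivrMr// ler_peMr.
have := agmon sepH my (cy t0) dif0 be0 e2 e1.
rewrite mulrA => /ler_wsqrtr; rewrite sqrtr_sqr normr_id => /le_trans; apply.
rewrite sqrtrM; last by rewrite mulr_ge0// ?mulr_ge0// ltW.
rewrite ler_wpM2l ?sqrtr_ge0// /decay.
rewrite (_ : - (2 * c) * t = - c * t * 2); last by ring.
by rewrite expRM_natr sqrtr_sqr ger0_norm// expR_ge0.
Qed.

Lemma solution_decay t : 0 < t -> `|y t| <= amplitude M a * decay c t.
Proof.
move=> t0; have d0 : 0 <= decay c t by exact: expR_ge0.
have e0 : 0 <= `|M| * expR c by rewrite mulr_ge0// expR_ge0.
rewrite mulrDl; have [t1|t1] := leP 1 t.
  by rewrite (le_trans (far t1))// lerDl mulr_ge0.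
apply: (@le_trans _ _ (`|M| * expR c * decay c t)); last by rewrite lerDr mulr_ge0// sqrtr_ge0.
rewrite (ger0_norm M0) -mulrA -expRD (le_trans (yM t))// ler_peMr// -expR0 ler_expR.
have := decay_rate_gt0 a => c0; have : 0 <= c * (1 - t) by rewrite mulr_ge0 ?subr_ge0// ltW.
by move=> ct; rewrite (_ : c + - c * t = c * (1 - t))//; ring.
Qed.

End Decay.

Hypothesis smoothG : frechet_smooth G.
Hypothesis G1 : (sup_frechet G 1 <= (4^-1)%:E)%E.

Lemma smooth_lipschitz u v : `|G u - G v| <= 4^-1 * `|u - v|.
Proof.
have Gk k : (0 < k <= 1)%N -> (sup_frechet G k <= (4^-1)%:E)%E by case: k => [|[|k]].
have := difs_smooth_le hip smoothG Gk (bs := [:: u - v]) v isT.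
by rewrite big_cons big_nil mulr1 /= /dif (addrC v) subrK.
Qed.

Variable x : R -> H.
Hypothesis solx : weak_L2loc_solution ip A G x.
Hypothesis Lx : Linf x.
Let M := fine (Linf_norm x).

Lemma regular_representative : exists y : R -> H,
  {ae mu, forall t : R, 0 < t -> y t = x t} /\
  forall K N, (forall bs z, (0 < size bs <= N)%N -> `|difs bs G z| <= K * \prod_(b <- bs) `|b|) ->
    regular_data (decay_rate a) (amplitude M a) K N ip A G y.
Proof.
have G4 := smooth_lipschitz; have r0 := ramp_const_ge0 R.
have [X [N [mX XM N0 Xx solX]]] := solution_representative hip sepH contA G4 G0 solx Lx.
pose K := 8 * ramp_const R * M ^+ 2 + 1.
have K0 : 0 < K by rewrite ltr_wpDl// mulr_ge0 ?sqr_ge0// mulr_ge0.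
have dX (t h : R) : 0 < t -> 0 <= h ->
    (tail t (fun x : R => (`|dif h X x| ^+ 2)%R) <= (K / t * h ^+ 2)%:E)%E.
  move=> t0 h0; apply: le_trans (tail_dif_bound hip sepH contA symA G0 G4 mX XM N0 solX t0 h0) _.
  by rewrite lee_fin ler_wpM2r ?sqr_ge0// ler_wpM2r ?invr_ge0 ?lerDl// ltW.
have [y [my yM yX cy]] := continuous_representative hip sepH mX XM K0 dX.
have rhsM (u : R -> H) : (forall t, `|u t| <= M) -> forall t, `|rhs G (u t)| <= 2 * M.
  by move=> uM t; rewrite (le_trans (rhs_le G4 G0 _))// ler_wpM2l.
have rX : {ae mu, forall t : R, 0 < t -> rhs G (y t) = rhs G (X t)}.
  by apply: lebesgue_aeS yX => t tP t0; rewrite tP.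
have soly := weak_sol_extend hip sepH contA N0 (hmeas_rhs G4 mX) (hmeas_rhs G4 my)
  (rhsM _ XM) (rhsM _ yM) yX rX cy solX.
exists y; split.
  by apply: lebesgue_aeS (lebesgue_aeI yX Xx) => t [tX tx] t0; rewrite tX// tx.
move=> B n GB; apply: RegularData => //; first by exists M.
exact: solution_decay.
Qed.

End Assembly.

Section Constants.
Variable R : realType.

Definition order_bound n (S : n.-tuple R) : R := \sum_(i < n) `|tnth S i|.

Lemma order_bound_ge0 n (S : n.-tuple R) : 0 <= order_bound S.
Proof. exact: sumr_ge0. Qed.

Lemma difs_order_bound (H : completeNormedModType R) (ip : {dot H for (idfun : R -> R)})
    (G : H -> H) n : hilbert_inner ip -> frechet_smooth G ->
  (forall k, (1 <= k)%N -> (sup_frechet G k < +oo)%E) ->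
  forall bs z, (0 < size bs <= n)%N ->
    `|difs bs G z| <= order_bound [tuple fine (sup_frechet G j.+1) | j < n] * \prod_(b <- bs) `|b|.
Proof.
move=> hip smoothG Goo bs z; apply: (difs_smooth_le hip smoothG) => k /andP[k0 kn].
apply: (@le_trans _ _ (fine (sup_frechet G k))%:E).
  by have := Goo k k0; case: (sup_frechet G k) => // _; rewrite leNye.
have k1 : (k.-1 < n)%N by rewrite prednK.
rewrite lee_fin /order_bound (bigD1 (Ordinal k1))//= tnth_mktuple/= prednK//.
by rewrite (le_trans (ler_norm _))// lerDl sumr_ge0.
Qed.

Definition derivative_const (M a : R) k (S : k.+1.-tuple R) : R :=
  sval (cid (difference_bounds (decay_rate_gt0 a) (amplitude_ge0 M a) (order_bound_ge0 S) (ltnSn k))).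

Lemma derivative_const_ge0 M a k (S : k.+1.-tuple R) : 0 <= derivative_const M a S.
Proof. by rewrite /derivative_const; case: cid => C [] . Qed.

Lemma derivative_constP M a k (S : k.+1.-tuple R) (H : completeNormedModType R) ip A (G : H -> H) y :
  regular_data (decay_rate a) (amplitude M a) (order_bound S) k.+1 ip A G y ->
  pw_bound (decay_rate a) y k (derivative_const M a S).
Proof.
by rewrite /derivative_const; case: cid => C /= [_ CP] /CP[yC _]; exact: yC.
Qed.

End Constants.

Theorem theorem1p3 (R : realType) :
  exists (c : R -> R) (C : R -> R -> forall k : nat, k.+1.-tuple R -> R),
    (forall a : R, 0 <= a -> 0 < c a) /\
    forall (H : completeNormedModType R) (ip : {dot H for (idfun : R -> R)})
      (A : {linear H -> H}) (G : H -> H) (x : R -> H),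
      hilbert_inner ip -> separable_space H ->
      continuous A -> self_adjoint ip A ->
      frechet_smooth G -> G 0 = 0 ->
      (sup_frechet G 1 <= (4^-1)%:E)%E ->
      (forall k : nat, (1 <= k)%N -> (sup_frechet G k < +oo)%E) ->
      weak_L2loc_solution ip A G x -> Linf x ->
      exists y : R -> H,
        [/\ {ae lebesgue_measure, forall t : R, 0 < t -> y t = x t},
            smooth_on `]0, +oo[ y,
            forall k : nat, exp_decay (y^`(k)%classic) &
            forall (k : nat) (t : R), 0 < t ->
              let a := fine (opnorm A) in
              let Ck := C (fine (Linf_norm x)) a k
                          [tuple fine (sup_frechet G j.+1) | j < k.+1] in
              `|(y^`(k)%classic) t| <= if t < 1 then Ck * t ^- k
                               else Ck * expR (- c a * t)].
Proof.
exists (@decay_rate R), (@derivative_const R); split=> [a _|H ip A G x]; first exact: decay_rate_gt0.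
move=> hip sepH contA symA smoothG G0 G1 Goo solx Lx.
have [y [yx yreg]] := regular_representative hip sepH contA symA G0 smoothG G1 solx Lx.
set a := fine (opnorm A); have c0 := decay_rate_gt0 a.
pose Ck k := derivative_const (fine (Linf_norm x)) a [tuple fine (sup_frechet G j.+1) | j < k.+1].
have yC k : pw_bound (decay_rate a) y k (Ck k).
  apply: derivative_constP; apply: yreg; exact: difs_order_bound hip smoothG Goo.
have bnd k (t : R) : 0 < t ->
    `|(y^`(k)%classic) t| <= if t < 1 then Ck k * t ^- k else Ck k * expR (- decay_rate a * t).
  move=> t0; have := derive1n_bound c0 yC k t0; have C0 : 0 <= Ck k by exact: derivative_const_ge0.
  have [t1|t1] := ltP t 1 => /le_trans; apply.
    rewrite /om (min_idPl (ltW t1)) ler_wpM2l// ler_piMr ?invr_ge0 ?exprn_ge0 ?(ltW t0)//.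
    by apply: decay_le1 => //; exact: ltW.
  by rewrite /om (min_idPr t1) expr1n invr1 mul1r.
exists y; split=> //; first exact: smooth_of_pw_bound c0 yC.
move=> k; exists (decay_rate a), (Ck k); split=> //; near=> t.
have t1 : 1 <= t by near: t; exact: nbhs_pinfty_ge.
by have := bnd k t (lt_le_trans ltr01 t1); rewrite ltNge t1.
Unshelve. all: by end_near. Qed.
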